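(* Let $\pi:M\to B$ be a surjective submersion of $C^\infty$ manifolds, write $M_b=\pi^{-1}(b)$, $i_b:M_b\hookrightarrow M$ for the inclusion, and $\rho:T^*M\to V^*M=(\ker d\pi)^*$ for the restriction of covectors to $\ker d\pi$. Let $\Lambda\subset T^*M\setminus 0$ be a conic Lagrangian submanifold transverse to $\pi$. Then: 1. $\Lambda\cap(\ker d\pi)^\perp=\emptyset$. 2. $(i_b^*\Lambda)_{b\in B}$ is a $C^\infty$ family of conic Lagrangian local submanifolds of $T^*M_b\setminus 0$. In other words, $\rho(\Lambda)$ is a local submanifold of $V^*M$ transverse to $\pi$, and for any $b\in B$ the fiber $$\Lambda_b=i_b^*(\Lambda)=\rho(\Lambda)\cap T^*M_b$$ is a conic Lagrangian local submanifold of $T^*M_b\setminus 0$.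
   Context: All manifolds are $C^\infty$, $\sigma$-compact, with connected components of the same dimension; all maps are $C^\infty$. Conic means invariant under multiplication of covectors by positive reals. $(\ker d\pi)^\perp\subset T^*M$ is the bundle of covectors vanishing on $\ker d\pi$. A local submanifold of dimension $p$ of a manifold $X$ is a subset of $X$ that is a countable union of submanifolds of $X$ of dimension $p$. A local submanifold is called conic, Lagrangian, etc. if it can be written as a countable union of submanifolds (of the same dimension) with the corresponding property. Given a surjective submersion $\tau:X\to B$, a submanifold $Z\subset X$ is transverse to $\tau$ if $\tau|_Z:Z\to B$ is a submersion; a local submanifold is transverse to $\tau$ if it can be covered by countably many submanifolds (of the same dimension) transverse to $\tau$. A family $(Z_b)_{b\in B}$ of subsets $Z_b\subset\tau^{-1}(b)$ is a $C^\infty$ family of (local) submanifolds subordinated to $\tau$ if $\bigcup_bZ_b$ is a (local) submanifold of $X$ transverse to $\tau$. $V^*M=(\ker d\pi)^*=\bigcup_bT^*M_b$; ''transverse to $\pi$'' for a (local) submanifold of $T^*M$ or of $V^*M$ means transverse to the composed submersion $T^*M\to M\to B$, respectively $V^*M\to M\to B$; families $(\Lambda_b)_b$ with $\Lambda_b\subset T^*M_b$ are understood with respect to $V^*M\to B$. $i_b^*\Lambda=\{(m,\zeta|_{T_mM_b}) : (m,\zeta)\in\Lambda,\ m\in M_b\}$. *)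

(* Defs.v *)
From HB Require Import structures.
From mathcomp Require Import all_boot all_order all_algebra.
From mathcomp Require Import all_classical all_reals all_analysis.

Set Implicit Arguments.
Unset Strict Implicit.
Unset Printing Implicit Defensive.

Import Order.TTheory GRing.Theory Num.Theory.
Import numFieldNormedType.Exports.

Local Open Scope classical_set_scope.
Local Open Scope ring_scope.

Section Charts.
Variable R : realType.

Fixpoint Ck_on n m (r : nat) (U : set 'rV[R]_n) (f : 'rV[R]_n -> 'rV[R]_m) :
    Prop :=
  if r is r'.+1 then
    (forall x, U x -> differentiable f x) /\
    (forall v, Ck_on r' U (fun x => 'd f x v))
  else forall x, U x -> {for x, continuous f}.

Definition smooth_on n m (U : set 'rV[R]_n) (f : 'rV[R]_n -> 'rV[R]_m) :=
  forall r, Ck_on r U f.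

(* [coord] is only meaningful on [dom]. *)
Record chart (X : Type) (n : nat) :=
  Chart { dom : set X; coord : X -> 'rV[R]_n }.

(* The inverse of [coord c] on [coord c @` dom c]; [x0] is only a value for
   the vectors that are outside this set. *)
Definition chart_inv X n (c : chart X n) (x0 : X) : 'rV[R]_n -> X :=
  'pinv_(fun=> x0) (dom c) (coord c).

Definition is_chart X n (c : chart X n) :=
  (forall x y, dom c x -> dom c y -> coord c x = coord c y -> x = y) /\
  open (coord c @` dom c).

Definition smooth_transition X n (c d : chart X n) :=
  let U := coord c @` (dom c `&` dom d) in
  open U /\
  forall x0, (dom c `&` dom d) x0 ->
    smooth_on U (fun y => coord d (chart_inv c x0 y)).

Definition compatible X n (c d : chart X n) :=
  smooth_transition c d /\ smooth_transition d c.

(* A set with a collection of charts, without axioms: [manifold] below adds the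
   axioms, while T^*X, V^*M and the fibers of a submersion are given by their
   usual charts. *)
Record smooth_space (n : nat) :=
  SmoothSpace { carrier :> Type; atlas : set (chart carrier n) }.
Arguments atlas {n} X : rename.

Definition maximal_atlas n (X : smooth_space n) : set (chart X n) :=
  [set c | is_chart c /\ forall d, atlas X d -> compatible c d].

Definition sigma_compact (T : topologicalType) :=
  exists K : nat -> set T,
    (forall i, compact (K i)) /\ \bigcup_i K i = [set: T].

Definition is_homeomorphic_chart (T : topologicalType) n (c : chart T n) :=
  [/\ open (dom c), is_chart c &
      forall U : set T, U `<=` dom c -> (open U <-> open (coord c @` U))].

Definition manifold_axiom n (T : topologicalType) (A : set (chart T n)) :=
  [/\ hausdorff_space T,
      sigma_compact T,
      forall x, exists2 c, A c & dom c x,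
      forall c, A c -> is_homeomorphic_chart c &
      forall c d, A c -> A d -> compatible c d].

Record manifold (n : nat) := Manifold {
  mtop : topologicalType;
  matlas : set (chart mtop n);
  manifoldP : manifold_axiom matlas }.

Definition space_of_manifold n (M : manifold n) : smooth_space n :=
  @SmoothSpace n (mtop M) (@matlas n M).
Coercion space_of_manifold : manifold >-> smooth_space.

(* A chosen chart of the atlas at x. *)
Definition chart_at n (X : smooth_space n) (x : X) : chart X n :=
  if pselect (exists c, atlas X c /\ dom c x) is left h then projT1 (cid h)
  else Chart set0 (fun=> 0).

(* The tangent space at x is 'rV[R]_n: a tangent vector is given by its
   components in the chart [chart_at x]. *)
Definition tangent n (X : smooth_space n) (x : X) : Type := 'rV[R]_n.

(* Components in the chart c of a vector tangent at x. *)
Definition dcoord n (X : smooth_space n) (c : chart X n) (x : X) :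
    'Hom('rV[R]_n, 'rV[R]_n) :=
  linfun ('d (fun y => coord c (chart_inv (chart_at x) x y))
             (coord (chart_at x) x)).

Definition mdiff n m (X : smooth_space n) (Y : smooth_space m) (f : X -> Y)
    (x : X) : 'Hom('rV[R]_n, 'rV[R]_m) :=
  linfun ('d (fun y => coord (chart_at (f x))
                         (f (chart_inv (chart_at x) x y)))
             (coord (chart_at x) x)).

Definition smooth_map n m (X : smooth_space n) (Y : smooth_space m)
    (f : X -> Y) :=
  forall c d, atlas X c -> atlas Y d ->
    let D := dom c `&` f @^-1` dom d in
    open (coord c @` D) /\
    forall x0, D x0 ->
      smooth_on (coord c @` D) (fun y => coord d (f (chart_inv c x0 y))).

Definition submersion n m (X : smooth_space n) (Y : smooth_space m)
    (f : X -> Y) :=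
  smooth_map f /\ forall x, limg (mdiff f x) = fullv.

Definition surjective_submersion n m (X : smooth_space n) (Y : smooth_space m)
    (f : X -> Y) :=
  submersion f /\ forall y, exists x, f x = y.

(* R^p x 0 inside R^n *)
Definition flat n (p : nat) : set 'rV[R]_n :=
  [set v | forall i : 'I_n, (p <= i)%N -> v 0 i = 0].

Definition slice_chart n (X : smooth_space n) (p : nat) (Z : set X)
    (c : chart X n) :=
  maximal_atlas c /\
  coord c @` (dom c `&` Z) = coord c @` dom c `&` flat p.

(* Embedded, not necessarily closed. *)
Definition submanifold n (X : smooth_space n) (p : nat) (Z : set X) :=
  (p <= n)%N /\ forall z, Z z -> exists2 c, slice_chart p Z c & dom c z.

Definition tangent_sub n (X : smooth_space n) (p : nat) (Z : set X) (z : X) :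
    set (tangent z) :=
  [set v | exists c, [/\ slice_chart p Z c, dom c z & flat p (dcoord c z v)]].
Arguments tangent_sub {n X} p Z z.

(* A submanifold Z of dimension p as a space in its own right: the charts are
   the first p coordinates of the slice charts. *)
Definition subspace_chart n (X : smooth_space n) (p : nat) (Z : set X)
    (c : chart X n) : chart Z p :=
  Chart [set x : Z | dom c (val x)]
        (fun x => coord c (val x) *m (pid_mx p : 'M[R]_(n, p))).

Definition sub_space n (X : smooth_space n) (p : nat) (Z : set X) :
    smooth_space p :=
  @SmoothSpace p Z (@subspace_chart n X p Z @` slice_chart p Z).

Definition local_submanifold_with n (X : smooth_space n) (p : nat)
    (P : set X -> Prop) (Z : set X) :=
  exists S : nat -> set X,
    (forall i, submanifold p (S i) /\ P (S i)) /\ Z = \bigcup_i S i.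

Definition transverse n k (X : smooth_space n) (B : smooth_space k)
    (tau : X -> B) (p : nat) (Z : set X) :=
  forall z, Z z -> forall w : tangent (tau z),
    exists2 v, tangent_sub p Z z v & mdiff tau z v = w.

(* A local submanifold, of some dimension, which is transverse to tau. *)
Definition transverse_local_submanifold n k (X : smooth_space n)
    (B : smooth_space k) (tau : X -> B) (Z : set X) :=
  exists p, local_submanifold_with p (transverse tau p) Z.

Definition smooth_family n k (X : smooth_space n) (B : smooth_space k)
    (tau : X -> B) (Z : B -> set X) :=
  (forall b, Z b `<=` tau @^-1` [set b]) /\
  transverse_local_submanifold tau (\bigcup_b Z b).

Definition cotangent_point n (X : smooth_space n) : Type :=
  X * 'Hom('rV[R]_n, R^o).

(* The components of a covector are its values on the coordinate vectors of c. *)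
Definition cotangent_chart n (X : smooth_space n) (c : chart X n) :
    chart (cotangent_point X) (n + n) :=
  Chart [set z : cotangent_point X | dom c z.1]
        (fun z => row_mx (coord c z.1)
           (\row_j z.2 ((dcoord c z.1)^-1%VF (delta_mx 0 j)))).

Definition cotangent n (X : smooth_space n) : smooth_space (n + n) :=
  @SmoothSpace (n + n) (cotangent_point X) (@cotangent_chart n X @` atlas X).

Definition nonzero_covectors n (X : smooth_space n) : set (cotangent X) :=
  [set z : cotangent_point X | z.2 != 0].

Definition conic n (X : smooth_space n) (L : set (cotangent X)) :=
  forall (t : R) x xi, 0 < t -> L (x, xi) -> L (x, t *: xi).

(* The canonical form  sum_j d xi_j /\ d x_j.  The atlas of T^*X consists of the
   canonical charts (x, xi) only, so that the components of a tangent vector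
   at z are (dx, dxi). *)
Definition symplectic_form n (X : smooth_space n) (z : cotangent X)
    (u v : 'rV[R]_(n + n)) : R :=
  \sum_j (rsubmx u 0 j * lsubmx v 0 j - rsubmx v 0 j * lsubmx u 0 j).

Definition lagrangian n (X : smooth_space n) (L : set (cotangent X)) :=
  submanifold n L /\
  forall z, L z -> forall u v : tangent z,
    tangent_sub n L z u -> tangent_sub n L z v -> symplectic_form z u v = 0.

Definition conic_lagrangian_local_submanifold n (X : smooth_space n)
    (L : set (cotangent X)) :=
  local_submanifold_with n (fun S => conic S /\ lagrangian S) L.

Definition cotangent_pullback n m (X : smooth_space n) (Y : smooth_space m)
    (f : X -> Y) (L : set (cotangent Y)) : set (cotangent X) :=
  [set z : cotangent_point X | exists zeta,
     L (f z.1, zeta) /\ z.2 = (zeta \o mdiff f z.1)%VF].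

Section Fibration.
Variables (n k : nat) (M : smooth_space n) (B : smooth_space k) (pi : M -> B).

Definition vertical (m : M) : {vspace 'rV[R]_n} := lker (mdiff pi m).

Definition conormal : set (cotangent M) :=
  [set z : cotangent_point M | forall v, v \in vertical z.1 -> z.2 v = 0].

Definition vdual_point : Type :=
  {m : M & 'Hom(subvs_of (vertical m), R^o)}.

(* A smooth frame of ker(d pi) over the domain of c. *)
Definition vertical_frame (c : chart M n) (e : M -> 'I_(n - k) -> 'rV[R]_n) :=
  (forall m, dom c m -> basis_of (vertical m) (codom (e m))) /\
  (forall i x0, dom c x0 ->
     smooth_on (coord c @` dom c)
       (fun y => let m := chart_inv c x0 y in dcoord c m (e m i))).

Definition vdual_chart (c : chart M n) (e : M -> 'I_(n - k) -> 'rV[R]_n) :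
    chart vdual_point (n + (n - k)) :=
  Chart [set w : vdual_point | dom c (tag w)]
        (fun w => row_mx (coord c (tag w))
           (\row_i tagged w (vsproj (vertical (tag w)) (e (tag w) i)))).

(* V^*M = (ker d pi)^*, the dual bundle of the vector bundle ker(d pi). *)
Definition vdual : smooth_space (n + (n - k)) :=
  SmoothSpace [set C | exists c e, [/\ maximal_atlas c, vertical_frame c e &
                                       C = vdual_chart c e]].

Definition vdual_proj (w : vdual) : B := pi (tag (w : vdual_point)).

Definition cotangent_proj (z : cotangent M) : B := pi (z : cotangent_point M).1.

Definition vdual_of m (eta : 'Hom(subvs_of (vertical m), R^o)) : vdual :=
  existT (fun m => 'Hom(subvs_of (vertical m), R^o)) m eta.

(* Restriction of covectors to ker(d pi). *)
Definition vdual_restrict (z : cotangent M) : vdual :=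
  let: (m, zeta) := z : cotangent_point M in
  vdual_of (zeta \o linfun (@vsval _ _ (vertical m)))%VF.

Definition fiber (b : B) : smooth_space (n - k) :=
  sub_space (n - k) (pi @^-1` [set b]).

Definition fiber_incl (b : B) (x : fiber b) : M := val x.

(* The identification of T^*M_b with the fiber over b of V^*M -> B, given by
   the isomorphism d i_b from T_m M_b onto ker(d pi)_m; [^-1] is the inverse
   of d i_b on its image. *)
Definition fiber_to_vdual (b : B) (z : cotangent (fiber b)) : vdual :=
  let: (m, zeta) := z : cotangent_point (fiber b) in
  vdual_of (m := fiber_incl m)
    (zeta \o (mdiff (@fiber_incl b) m)^-1
          \o linfun (@vsval _ _ (vertical (fiber_incl m))))%VF.

End Fibration.
End Charts.

Arguments vdual {R n k M B} pi.
Arguments vdual_proj {R n k M B} pi w.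
Arguments vdual_restrict {R n k M B} pi z.
Arguments fiber_incl {R n k M B} pi b x : rename.
Arguments fiber_to_vdual {R n k M B} pi b z.
Arguments atlas {R n} X : rename.
Arguments nonzero_covectors {R n} X.
Arguments tangent_sub {R n X} p Z z.

(* Main.v *)
(* A vector tangent to Lambda in the conormal directions (no base component, covector
   component vanishing on ker dpi) is symplectically orthogonal to every tangent vector
   of Lambda, so its covector component vanishes on the projection of the tangent space
   of Lambda to the tangent space of M. It also vanishes on ker dpi, and by
   transversality these two spaces span, so it is zero. At a conormal point the radial
   vector would be such a vector, which gives the first claim. The kernel of d rho
   consists of conormal directions, so rho is an immersion on Lambda and Lambda is
   covered by open pieces on which rho is an embedding; the same holds for the part of
   Lambda over a fiber, on which rho preserves the symplectic form. Pieces of the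
   pullback to a fiber are made conic by normalizing a fiber coordinate that is nonzero
   by the first claim, and countably many pieces suffice by the Lindelof property. *)
From HB Require Import structures.
Require Import Defs.
From mathcomp Require Import all_boot all_order all_algebra.
From mathcomp Require Import all_classical all_reals all_analysis.
From mathcomp Require Import ring lra.

Set Implicit Arguments.
Unset Strict Implicit.
Unset Printing Implicit Defensive.

Import Order.TTheory GRing.Theory Num.Theory.
Import numFieldNormedType.Exports.
Import Defs.

Local Open Scope classical_set_scope.
Local Open Scope ring_scope.

(** * Smooth maps between normed modules *)

Section Smoothness.
Context {R : realType}.
Implicit Types V W : normedModType R.

(** Submanifolds are defined by slice charts, which are awkward to produce for images and
    intersections. The proof works with submersive local equations instead and returns to slice
    charts by the inverse function theorem. In charts where [pi] is the projection onto the last k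
    coordinates, both the restriction to ker dpi and the pullback to a fiber are multiplication by a
    constant block matrix. One statement on linear images of zero sets, [immersed_image], therefore
    serves V^*M and every fiber. The form in [lagrangian] is computed in one chosen canonical chart
    at each point; comparing it with other charts requires the symmetry of second derivatives. On a
    fiber the obstacle is conicity: the image of a small neighbourhood is not conic, and in its
    dilates points at unrelated scales must be kept from having nearby images. Prescribing the value
    of one covector component selects a single representative on each ray and so controls the
    scale. *)

Lemma diff_near V W (f g : V -> W) x : {near x, f =1 g} -> differentiable f x ->
  differentiable g x /\ ('d g x = 'd f x :> (V -> W)).
Proof.
move=> fg df; have fgx : f x = g x by exact: nbhs_singleton fg.
have E : g \o shift x = cst (g x) + 'd f x +o_ 0 id.
  apply/eqaddoP => e e0.
  have /eqaddoP/(_ e e0) := diff_locally df.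
  have : \forall h \near (0 : V), f (h + x) = g (h + x).
    have : \forall y \near x, f y = g y by [].
    by rewrite (near_shift 0) subr0.
  apply: filterS2 => h /= fgh; rewrite /= -fgx.
  by rewrite !fctE /= fgh.
have D := diff_unique (diff_continuous df) E.
split=> //; apply/diff_locallyP; rewrite D; split=> //.
exact: diff_continuous.
Qed.

Lemma diff_eval V W (f df : V -> W) x v : is_diff x f df -> 'd f x v = df v.
Proof. by case=> _ E; rewrite -[LHS]/(('d f x : V -> W) v) E. Qed.

(** The recursion of [Ck_on], extended to normed modules so that scalar and matrix valued maps, such
    as determinants and inverse matrices, are covered too. *)
Fixpoint Ck V W (r : nat) (U : set V) (f : V -> W) : Prop :=
  if r is r'.+1 then
    (forall x, U x -> differentiable f x) /\
    (forall v, Ck r' U (fun x => 'd f x v))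
  else forall x, U x -> {for x, continuous f}.

Lemma Ck_onE n m r (U : set 'rV[R]_n) (f : 'rV[R]_n -> 'rV[R]_m) :
  Ck_on r U f <-> Ck r U f.
Proof.
by elim: r f => [//|r IH] f /=; split=> -[? Hd]; split=> // v; apply/IH/Hd.
Qed.

Lemma Ck_subset V W r (U U' : set V) (f : V -> W) :
  U' `<=` U -> Ck r U f -> Ck r U' f.
Proof.
move=> UU; elim: r f => [|r IH] f /=; first by move=> H x /UU/H.
by move=> [H1 H2]; split=> [x /UU/H1//|v]; apply/IH/H2.
Qed.

Lemma Ck_ext V W r (U : set V) (f g : V -> W) : open U ->
  (forall x, U x -> f x = g x) -> Ck r U f -> Ck r U g.
Proof.
move=> oU; have N h1 h2 x : (forall x, U x -> h1 x = h2 x) -> U x ->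
    {near x, h1 =1 (h2 : V -> W)}.
  by move=> H Ux; near=> y; apply: H; near: y; exact: open_nbhs_nbhs.
elim: r f g => [|r IH] f g fg /=.
  move=> H x Ux; have := H x Ux; rewrite /prop_for /continuous_at -fg// => cf.
  apply: cvg_trans cf; apply: near_eq_cvg; exact: N.
move=> [H1 H2]; have D x Ux := diff_near (N _ _ x fg Ux) (H1 _ Ux).
split=> [x /D[]//|v]; apply: IH (H2 v) => x /D[_ E].
by rewrite -[RHS]/(('d g x : V -> W) v) E.
Unshelve. all: by end_near. Qed.

Lemma Ck_local V W r (U : set V) (f : V -> W) :
  (forall x, U x -> exists O, [/\ open O, O x & Ck r O f]) -> Ck r U f.
Proof.
elim: r f => [|r IH] f /= H; first by move=> x /H[A [_ Ox HO]]; exact: HO.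
split=> [x /H[A [_ Ox [+ _]]]|v]; first exact.
by apply: IH => x /H[A [oO Ox [_ H2]]]; exists A.
Qed.

Lemma CkW V W r (U : set V) (f : V -> W) : Ck r.+1 U f -> Ck r U f.
Proof.
elim: r f => [|r IH] f /= [H1 H2].
  by move=> x /H1; exact: differentiable_continuous.
by split=> // v; apply/IH/H2.
Qed.

Lemma Ck_cst V W r (U : set V) (c : W) : Ck r U (fun=> c).
Proof.
elim: r c => [|r IH] c /=; first by move=> x _; exact: cst_continuous.
split=> [x _|v]; first exact: differentiable_cst.
by under eq_fun do rewrite (@diff_cst _ V W c)/=; exact: IH.
Qed.

Lemma CkD V W r (U : set V) (f g : V -> W) : open U ->
  Ck r U f -> Ck r U g -> Ck r U (fun x => f x + g x).
Proof.
move=> oU; elim: r f g => [|r IH] f g /=.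
  by move=> Hf Hg x Ux; apply: continuousD; [exact: Hf|exact: Hg].
move=> [f1 f2] [g1 g2]; split=> [x Ux|v].
  by apply: differentiableD; [exact: f1|exact: g1].
apply: Ck_ext (IH _ _ (f2 v) (g2 v)) => // x Ux.
have D : is_diff x (fun y => f y + g y) (fun w => 'd f x w + 'd g x w).
  exact: is_diffD (differentiableP (f1 x Ux)) (differentiableP (g1 x Ux)).
by rewrite (diff_eval v D).
Qed.

Lemma Ck_sum V W r (U : set V) (I : Type) (s : seq I) (P : pred I)
    (f : I -> V -> W) : open U -> (forall i, P i -> Ck r U (f i)) ->
  Ck r U (fun x => \sum_(i <- s | P i) f i x).
Proof.
move=> oU H; elim: s => [|i s IH].
  by under eq_fun do rewrite big_nil; exact: Ck_cst.
case: (boolP (P i)) => Pi; under eq_fun do rewrite big_cons.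
  by rewrite Pi; apply: CkD => //; exact: H.
by rewrite (negbTE Pi).
Qed.

(** The bilinear instance gives access to [diff_bilin], from which the product rule [is_diff_scale]
    follows. *)
Lemma scale_is_bilinear W :
  bilinear_for
    (GRing.Scale.Law.clone _ _ *:%R _) (GRing.Scale.Law.clone _ _ *:%R _)
    (@GRing.scale R W).
Proof.
split=> [u'|u] a x y /=; first by rewrite scalerDl scalerA.
by rewrite scalerDr !scalerA mulrC.
Qed.

HB.instance Definition _ W := bilinear_isBilinear.Build R R W W _ _
  (@GRing.scale R W) (scale_is_bilinear W).

Lemma is_diff_scale V W (a : V -> R) (f : V -> W) (da : V -> R) (df : V -> W) x :
  is_diff x a da -> is_diff x f df ->
  is_diff x (fun y => a y *: f y) (fun v => a x *: df v + da v *: f x).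
Proof.
move=> Da Df.
pose b : {bilinear R -> W -> W} := @GRing.scale R W.
have cb : continuous (fun p : R * W => b p.1 p.2) by exact: scale_continuous.
have Db : is_diff (a x, f x) (fun p => b p.1 p.2)
   (fun q => b (a x) q.2 + b q.1 (f x)).
  by apply: DiffDef; [exact: differentiable_bilin|rewrite diff_bilin].
have Dp := is_diff_pair Da Df.
exact: (is_diff_comp Dp Db).
Qed.

Lemma CkZ V W r (U : set V) (a : V -> R) (f : V -> W) : open U ->
  Ck r U a -> Ck r U f -> Ck r U (fun x => a x *: f x).
Proof.
move=> oU; elim: r a f => [|r IH] a f /=.
  by move=> Ha Hf x Ux; apply: cvgZ; [exact: Ha|exact: Hf].
move=> Ha Hf; have [a1 a2] := Ha; have [f1 f2] := Hf.
have D x (Ux : U x) :=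
  is_diff_scale (differentiableP (a1 x Ux)) (differentiableP (f1 x Ux)).
split=> [x /D[]//|v].
apply: (@Ck_ext _ _ _ _ (fun x => a x *: 'd f x v + 'd a x v *: f x)) => //.
  by move=> x Ux; rewrite (diff_eval v (D x Ux)).
by apply: CkD => //; apply: IH => //; exact: CkW.
Qed.

Lemma Ck_linear V W r (U : set V) (f : {linear V -> W}) :
  continuous f -> Ck r U f.
Proof.
move=> cf; case: r => [|r] /=; first by move=> x _; exact: cf.
split=> [x _|v]; first exact: linear_differentiable.
by under eq_fun do rewrite diff_lin//; exact: Ck_cst.
Qed.

Lemma Ck_linear_comp V V' W r (U : set V) (L : {linear V' -> W})
    (f : V -> V') : open U -> continuous L ->
  Ck r U f -> Ck r U (fun x => L (f x)).
Proof.
move=> oU cL; elim: r f => [|r IH] f /=.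
  by move=> H x Ux; apply: continuous_comp; [exact: H|exact: cL].
move=> [f1 f2]; split=> [x Ux|v].
  apply: differentiable_comp; [exact: f1|exact: linear_differentiable].
apply: Ck_ext (IH _ (f2 v)) => // x Ux.
rewrite (@diff_comp _ _ _ _ f L) //=; last 2 first.
  exact: f1.
  exact: linear_differentiable.
by rewrite diff_lin.
Qed.

Lemma continuous_sum (T : topologicalType) W (I : Type) (s : seq I)
    (f : I -> T -> W) :
  (forall i, continuous (f i)) -> continuous (fun x => \sum_(i <- s) f i x).
Proof.
move=> H; elim: s => [|i s IH].
  by under eq_fun do rewrite big_nil; exact: cst_continuous.
by under eq_fun do rewrite big_cons; move=> x; apply: cvgD; [exact: H|exact: IH].
Qed.

Lemma linear_mx_continuous m n W (L : {linear 'M[R]_(m, n) -> W}) :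
  continuous L.
Proof.
have -> : (L : _ -> _) = fun A => \sum_i \sum_j A i j *: L (delta_mx i j).
  apply/funext => A; rewrite {1}(matrix_sum_delta A) linear_sum.
  by apply: eq_bigr => i _; rewrite linear_sum; apply: eq_bigr => j _; rewrite linearZ.
do 2 (apply: continuous_sum => ?); move=> A.
apply: (@cvgZr_tmp _ W _ (nbhs A)); apply: coord_continuous.
Qed.

Lemma Ck_mx m n V r (U : set V) (f : V -> 'M[R]_(m, n)) : open U ->
  (forall i j, Ck r U (fun x => f x i j)) <-> Ck r U f.
Proof.
move=> oU; split=> H.
  have -> : f = fun x => \sum_i \sum_j f x i j *: delta_mx i j.
    by apply/funext => x; exact: matrix_sum_delta.
  do 2 (apply: Ck_sum => // ? _); apply: CkZ => //; exact: Ck_cst.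
move=> i j; pose g (A : 'M[R]_(m, n)) : R := A i j.
have lg : linear g by move=> a u v; rewrite /g !mxE.
pose L : {linear 'M[R]_(m, n) -> R} := HB.pack g (GRing.isLinear.Build _ _ _ _ _ lg).
apply: (@Ck_linear_comp V 'M[R]_(m, n) R^o r U L f oU _ H); exact: linear_mx_continuous.
Qed.

(** In the chain rule the direction ['d f x v] varies with x, whereas the induction hypothesis is
    about fixed directions. Expanding this direction in the standard basis leaves products of its
    components with derivatives of [g] along basis vectors; hence the row vectors as source of
    [g]. *)
Lemma Ck_comp m V W r (U : set V) (O : set 'rV[R]_m) (g : 'rV[R]_m -> W)
    (f : V -> 'rV[R]_m) : open U -> (forall x, U x -> O (f x)) ->
  Ck r O g -> Ck r U f -> Ck r U (fun x => g (f x)).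
Proof.
move=> oU UO; elim: r g => [|r IH] g /=.
  by move=> Hg Hf x Ux; apply: continuous_comp; [exact: Hf|exact/Hg/UO].
move=> [g1 g2] Hf; have [f1 f2] := Hf; split=> [x Ux|v].
  by apply: differentiable_comp; [exact: f1|exact/g1/UO].
apply: (@Ck_ext _ _ _ _
  (fun x => \sum_j ('d f x v) 0 j *: 'd g (f x) (delta_mx 0 j))) => //.
  move=> x Ux; rewrite (@diff_comp _ _ _ _ f g) //=; [|exact: f1|exact/g1/UO].
  rewrite [in RHS](row_sum_delta ('d f x v)) linear_sum.
  by apply: eq_bigr => j _; rewrite linearZ.
apply: Ck_sum => // j _; apply: (CkZ oU);
  last by apply: (IH (fun y => 'd g y (delta_mx 0 j))); [exact: g2|exact: CkW].
by have /Ck_mx := f2 v; exact.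
Qed.

Lemma CkM V r (U : set V) (f g : V -> R) : open U ->
  Ck r U f -> Ck r U g -> Ck r U (fun x => f x * g x).
Proof. exact: (@CkZ V (R^o : normedModType R)). Qed.

Lemma Ck_prod V r (U : set V) (I : Type) (s : seq I) (P : pred I)
    (f : I -> V -> R) : open U -> (forall i, P i -> Ck r U (f i)) ->
  Ck r U (fun x => \prod_(i <- s | P i) f i x).
Proof.
move=> oU H; elim: s => [|i s IH].
  by under eq_fun do rewrite big_nil; exact: Ck_cst.
case: (boolP (P i)) => Pi; under eq_fun do rewrite big_cons.
  by rewrite Pi; apply: CkM => //; exact: H.
by rewrite (negbTE Pi).
Qed.

Lemma CkV V r (U : set V) (f : V -> R) : open U ->
  (forall x, U x -> f x != 0) -> Ck r U f -> Ck r U (fun x => (f x)^-1).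
Proof.
move=> oU f0; elim: r => [|r IH] /=.
  by move=> H x Ux; apply: cvgV; [exact: f0|exact: H].
move=> Hf; have [f1 f2] := Hf; split=> [x Ux|v].
  by apply: differentiableV; [exact: f1|exact: f0].
apply: (@Ck_ext _ _ _ _ (fun x => - 1 * ((f x)^-1 * (f x)^-1) * 'd f x v)) => //.
  move=> x Ux.
  have D : is_diff x (fun y => (f y)^-1) (- (f x)^-2 \*: 'd f x).
    by apply: DiffDef; [apply: differentiableV|apply: diffV]; auto.
  by rewrite (diff_eval v D) /= mulN1r -invfM -expr2.
by apply: CkM => //; apply: CkM; [|exact: Ck_cst|apply: CkM] => //;
  apply: IH; exact: CkW.
Qed.

Lemma Ck_mulmx m n p V r (U : set V) (f : V -> 'M[R]_(m, n))
    (g : V -> 'M[R]_(n, p)) : open U ->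
  Ck r U f -> Ck r U g -> Ck r U (fun x => f x *m g x).
Proof.
move=> oU /Ck_mx-/(_ oU) Hf /Ck_mx-/(_ oU) Hg; apply/Ck_mx => // i j.
under eq_fun do rewrite mxE; apply: Ck_sum => // l _.
by apply: CkM.
Qed.

Lemma Ck_trmx m n V r (U : set V) (f : V -> 'M[R]_(m, n)) : open U ->
  Ck r U f -> Ck r U (fun x => (f x)^T).
Proof.
move=> oU /Ck_mx-/(_ oU) Hf; apply/Ck_mx => // i j.
by under eq_fun do rewrite mxE; exact: Hf.
Qed.

Lemma Ck_det n V r (U : set V) (f : V -> 'M[R]_n) : open U ->
  Ck r U f -> Ck r U (fun x => \det (f x)).
Proof.
move=> oU /Ck_mx-/(_ oU) Hf; apply: Ck_sum => // s _.
by apply: CkM => //; [exact: Ck_cst|apply: Ck_prod].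
Qed.

(** Cramer's rule: the entries are polynomials in those of [f], divided by the determinant. *)
Lemma Ck_invmx n V r (U : set V) (f : V -> 'M[R]_n) : open U ->
  (forall x, U x -> f x \in unitmx) ->
  Ck r U f -> Ck r U (fun x => invmx (f x)).
Proof.
move=> oU fU Hf; apply: (@Ck_ext _ _ _ _ (fun x => (\det (f x))^-1 *: \adj (f x))) => //.
  by move=> x /fU fx; rewrite /invmx fx.
apply: CkZ => //.
  apply: CkV => //; last exact: Ck_det.
  by move=> x /fU; rewrite unitmxE unitfE.
apply/Ck_mx => // i j; under eq_fun do rewrite mxE /cofactor.
apply: CkM => //; first exact: Ck_cst.
apply: Ck_det => //; apply/Ck_mx => // k l; under eq_fun do rewrite !mxE.
by have /Ck_mx := Hf; exact.
Qed.

End Smoothness.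

(** * The inverse function theorem and the symmetry of second derivatives *)

Section InverseFunction.
Context {R : realType}.

(** Completeness is what [banach_fixed_point] asks for in the inverse function theorem. *)
HB.instance Definition _ m n := Complete.on 'M[R]_(m, n).

Definition smooth (V W : normedModType R) (U : set V) (f : V -> W) :=
  forall r, Ck r U f.

Lemma smooth_onE n m (U : set 'rV[R]_n) (f : 'rV[R]_n -> 'rV[R]_m) :
  smooth_on U f <-> smooth U f.
Proof. by split=> H r; apply/Ck_onE; exact: H. Qed.

Lemma smooth_differentiable (V W : normedModType R) (U : set V) (f : V -> W) x :
  smooth U f -> U x -> differentiable f x.
Proof. by move=> /(_ 1)[+ _]; exact. Qed.

Lemma smooth_continuous (V W : normedModType R) (U : set V) (f : V -> W) x :
  smooth U f -> U x -> {for x, continuous f}.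
Proof. by move=> /(_ 0); exact. Qed.

Lemma nbhs_closed_ball (V : normedModType R) (x : V) (P : set V) : nbhs x P ->
  exists2 e : R, 0 < e & forall y, `|y - x| <= e -> P y.
Proof.
move=> /nbhs_normP[e /= e0 H]; exists (e / 2); first by rewrite divr_gt0.
move=> y yx; apply: H => /=; rewrite distrC (le_lt_trans yx)//.
by rewrite ltr_pdivrMr// ltr_pMr// ltr1n.
Qed.

Lemma open_of_ball (V : normedModType R) (A : set V) :
  (forall x, A x -> exists2 e : R, 0 < e & forall y, `|y - x| < e -> A y) -> open A.
Proof.
move=> H; rewrite openE => x /H[e e0 He]; apply: (filterS He).
have := nbhsx_ballx x e e0; rewrite -ball_normE /=.
by apply: filterS => y /=; rewrite distrC.
Qed.

Lemma rV_norm_le n (z : 'rV[R]_n) (c : R) : 0 <= c ->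
  (forall i, `|z 0 i| <= c) -> `|z| <= c.
Proof.
move=> c0 H; rewrite [leLHS]/Num.Def.normr /= mx_normrE; apply: bigmax_le => // -[i j] _ /=.
by rewrite (ord1 i).
Qed.

Lemma rV_coord_le n (z : 'rV[R]_n) i : `|z 0 i| <= `|z|.
Proof.
by rewrite [leRHS]/Num.Def.normr /= mx_normrE; exact: (le_bigmax _ _ (0, i)).
Qed.

Lemma is_derive_line (V W : normedModType R) (f : V -> W) (a v : V) (t : R) :
  differentiable f (a + t *: v) ->
  is_derive t 1 (fun s => f (a + s *: v)) ('d f (a + t *: v) v).
Proof.
move=> df.
have Dl : is_diff t (fun s : R => a + s *: v) (fun s => 0 + s *: v).
  exact: is_diffD (is_diff_cst a t) (is_diff_scalel t v).
have Dc := is_diff_comp Dl (differentiableP df).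
have [dc _] := Dc.
apply: DeriveDef; first exact: diff_derivable.
by rewrite deriveE// (diff_eval (1 : R) Dc)/= add0r scale1r.
Qed.

Lemma segment_mvt (V : normedModType R) (f : V -> R) (a v : V) (h : R) : 0 <= h ->
  (forall t, 0 <= t <= h -> differentiable f (a + t *: v)) ->
  exists2 t, 0 <= t <= h &
    f (a + h *: v) - f a = h * 'd f (a + t *: v) v.
Proof.
move=> h0 df; pose g t := f (a + t *: v); pose dg t := 'd f (a + t *: v) v.
have Dg t : 0 <= t <= h -> is_derive t (1 : R) g (dg t).
  by move=> th; apply: is_derive_line; exact: df.
have [||t th E] := @MVT_segment R g dg 0 h h0.
- move=> x; rewrite in_itv/= => /andP[x0 xh]; apply: Dg.
  by rewrite (ltW x0) (ltW xh).
- apply: derivable_within_continuous => x; rewrite in_itv/= => xh.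
  by have [] := Dg x xh.
exists t => //.
by move: E; rewrite /g scale0r addr0 subr0 mulrC.
Qed.

(** The norm is the maximum of the coordinates, so the mean value theorem may be applied to each
    coordinate of [g] along the segment, which stays in the ball by convexity; no common
    intermediate point is necessary. *)
Lemma lipschitz_of_diff n m (g : 'rV[R]_n -> 'rV[R]_m) (x0 : 'rV[R]_n) (r c : R) :
  0 <= c ->
  (forall x, `|x - x0| <= r -> differentiable g x) ->
  (forall x v, `|x - x0| <= r -> `|'d g x v| <= c * `|v|) ->
  forall x y, `|x - x0| <= r -> `|y - x0| <= r -> `|g x - g y| <= c * `|x - y|.
Proof.
move=> c0 dg bg x y xr yr; apply: rV_norm_le => [|i]; first by rewrite mulr_ge0.
pose p (z : 'rV[R]_m) : R := z 0 i.
have lp : linear p by move=> a u v; rewrite /p !mxE.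
pose L : {linear 'rV[R]_m -> R} := HB.pack p (GRing.isLinear.Build _ _ _ _ _ lp).
have cL : continuous (L : _ -> R^o) by exact: (@linear_mx_continuous _ _ _ R^o L).
have seg t : 0 <= t <= 1 -> `|y + t *: (x - y) - x0| <= r.
  move=> /andP[t0 t1].
  have -> : y + t *: (x - y) - x0 = t *: (x - x0) + (1 - t) *: (y - x0).
    by apply/rowP => j; rewrite !mxE; ring.
  rewrite (le_trans (ler_normD _ _))// !normrZ !ger0_norm ?subr_ge0//.
  rewrite (_ : r = t * r + (1 - t) * r); last by ring.
  by rewrite lerD// ler_wpM2l// subr_ge0.
have D z : `|z - x0| <= r -> is_diff z (L \o g) (L \o 'd g z).
  move=> zr; apply: (is_diff_comp (differentiableP (dg z zr))).
  by apply: DiffDef; [exact: linear_differentiable|exact: diff_lin].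
have [|t t01 E] := @segment_mvt _ (L \o g) y (x - y) 1 ler01.
  by move=> t t01; have [] := D _ (seg t t01).
rewrite scale1r subrKC mul1r (diff_eval _ (D _ (seg t t01))) /= /p in E.
rewrite !mxE E (le_trans (rV_coord_le _ _))//.
by apply: bg; exact: seg.
Qed.

Lemma small_differential n m (O : set 'rV[R]_n) (g : 'rV[R]_n -> 'rV[R]_m) x0 (c : R) :
  0 < c -> open O -> O x0 -> smooth O g -> (forall v, 'd g x0 v = 0) ->
  exists2 r : R, 0 < r & forall x, `|x - x0| <= r ->
    O x /\ forall v, `|'d g x v| <= c * `|v|.
Proof.
(* The n values on basis vectors are each made smaller than [e], so they add up to at most [c]. The
   denominator n + 1 is positive also for n = 0. *)
move=> c0 oO Ox sg dg0; pose e := c / n.+1%:R.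
have e0 : 0 < e by rewrite divr_gt0.
have N j : \forall x \near x0, `|'d g x (delta_mx 0 j)| < e.
  have [_ /(_ (delta_mx 0 j))/(_ _ Ox)] := sg 1.
  move=> /cvgr_norm_lt; apply.
  by rewrite dg0 normr0.
have /nbhs_closed_ball[r r0 Hr] : \forall x \near x0,
    O x /\ forall j, `|'d g x (delta_mx 0 j)| < e.
  near=> x; split; first by near: x; exact: open_nbhs_nbhs.
  by near: x; apply: filter_forall N.
exists r => // x /Hr[Ox' H]; split=> // v.
rewrite [in leLHS](row_sum_delta v) linear_sum (le_trans (ler_norm_sum _ _ _))//.
apply: (@le_trans _ _ (\sum_(j < n) e * `|v|)).
  apply: ler_sum => j _; rewrite linearZ normrZ mulrC ler_pM//.
    by rewrite ltW.
  exact: rV_coord_le.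
rewrite sumr_const card_ord -mulrnAl ler_wpM2r// -mulr_natr /e.
rewrite mulrAC ler_pdivrMr// ler_pM2l// ler_nat.
exact: leqnSn.
Unshelve. all: by end_near. Qed.

Lemma invertible_lin1 n (L : {linear 'rV[R]_n -> 'rV[R]_n}) :
  (forall v, L v = 0 -> v = 0) -> lin1_mx L \in unitmx.
Proof.
move=> H; rewrite -row_free_unit; apply/row_freeP.
have : kermx (lin1_mx L) = 0.
  apply/row_matrixP => i; rewrite row0; apply: H.
  by rewrite -mul_rV_lin1 -row_mul mulmx_ker row0.
by move=> /eqP; rewrite kermx_eq0 => /row_freeP.
Qed.

(* The inverse of a perturbation [F] of the identity: [y - (F - id)] is a
   contraction, and its fixed point is the preimage of [y]. *)
Lemma inverse_near_id N (O : set 'rV[R]_N) (F : 'rV[R]_N -> 'rV[R]_N) x0 :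
  open O -> O x0 -> smooth O F -> (forall v, 'd F x0 v = v) ->
  exists U, [/\ open U, U x0, U `<=` O & open (F @` U)] /\
    (forall x v, U x -> 'd F x v = 0 -> v = 0) /\
    (forall x y, U x -> U y -> `|x - y| <= 2 * `|F x - F y|).
Proof.
move=> oO Ox sF dF; pose g x := x - F x.
have sg : smooth O g.
  move=> r; apply: CkD => //.
    apply: (@Ck_linear _ _ _ r O idfun).
    exact: (@linear_mx_continuous _ 1 N 'rV[R]_N idfun).
  apply: (@Ck_ext _ _ _ _ _ (fun x => -1 *: F x)) => //.
    by move=> x _; rewrite scaleN1r.
  by apply: CkZ => //; exact: Ck_cst.
have Dg x : O x -> is_diff x g (fun v => v - 'd F x v).
  move=> Ox'; apply: is_diffB.
  exact: differentiableP (smooth_differentiable sF Ox').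
have dg0 v : 'd g x0 v = 0.
  by rewrite (diff_eval v (Dg _ Ox)) dF subrr.
have h0 : 0 < 2^-1 :> R by rewrite invr_gt0.
have [r r0 Hr] := small_differential h0 oO Ox sg dg0.
have lg x y : `|x - x0| <= r -> `|y - x0| <= r ->
    `|g x - g y| <= 2^-1 * `|x - y|.
  apply: lipschitz_of_diff; first exact: ltW.
    by move=> z /Hr[/Dg[]].
  by move=> z v /Hr[_]; exact.
(* Since x - y = (g x - g y) + (F x - F y), the Lipschitz constant 1/2 of [g] leaves at least half
   of the distance to [F]. *)
have lF x y : `|x - x0| <= r -> `|y - x0| <= r -> `|x - y| <= 2 * `|F x - F y|.
  move=> xr yr; have := lg _ _ xr yr.
  have : `|x - y| <= `|g x - g y| + `|F x - F y|.
    rewrite (le_trans _ (ler_normD _ _))// /g.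
    by rewrite le_eqVlt; apply/orP; left; apply/eqP; congr (`| _ |);
       apply/rowP => j; rewrite !mxE; ring.
  set a := `|x - y|; set b := `|g x - g y|; set c := `|F x - F y|; lra.
exists [set x | `|x - x0| < r]; split; [split|split].
- have -> : [set x | `|x - x0| < r] = ball x0 r.
    by rewrite -ball_normE; apply/seteqP; split=> x /=; rewrite distrC.
  exact: ball_open.
- by rewrite /= subrr normr0.
- by move=> x /= /ltW/Hr[].
- apply: open_of_ball => _ [x1 /= x1r <-].
  pose s := (r - `|x1 - x0|) / 2.
  have s0 : 0 < s by rewrite divr_gt0// subr_gt0.
  have xs z : `|z - x1| <= s -> `|z - x0| < r.
    move=> zs; rewrite -(subrKA x1) (le_lt_trans (ler_normD _ _))//.
    by rewrite /s in zs s0; lra.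
  (* The ball of radius [s] about [x1] is preserved by [T]: the distance of [y] to [F x1]
     contributes s/2, and the contraction of factor 1/2 contributes another s/2. *)
  exists (s / 2); first by rewrite divr_gt0.
  move=> y ys.
  pose C := [set z : 'rV[R]_N | `|z - x1| <= s].
  pose T z := y + g z.
  have TC : set_fun C C T.
    move=> z zC; rewrite /C /=; have -> : T z - x1 = (y - F x1) + (g z - g x1).
      by rewrite /T /g; apply/rowP => j; rewrite !mxE; ring.
    rewrite (le_trans (ler_normD _ _))//.
    have := lg z x1 (ltW (xs z zC)) (ltW x1r).
    rewrite /C/= in zC; lra.
  pose T' : {fun C >-> C} := HB.pack T (isFun.Build _ _ _ _ T TC).
  have cT : is_contraction T'.
    exists (NngNum (ltW h0)); split=> /=; first by rewrite invf_lt1// ltr1n.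
    move=> [u v] /= [uC vC]; rewrite /T opprD addrACA subrr add0r.
    exact: lg (ltW (xs u uC)) (ltW (xs v vC)).
  have clC : closed C.
    have -> : C = closed_ball_ Num.Def.normr x1 s.
      by apply/seteqP; split=> z; rewrite /C /closed_ball_/= distrC.
    exact: closed_closed_ball_.
  have [|z Cz Tz] := banach_fixed_point cT clC.
    by exists x1; rewrite /C /= subrr normr0 ltW.
  exists z; first exact: xs.
  by move: Tz; rewrite /= /T /g addrCA -{1}[z]addr0 => /addrI/eqP;
    rewrite eq_sym subr_eq0 => /eqP.
- move=> x v /= /ltW xr dv0.
  have [Ox' /(_ v)] := Hr _ xr.
  rewrite (diff_eval v (Dg _ Ox')) dv0 subr0 => Hv.
  by apply/eqP; rewrite -normr_le0; lra.
- by move=> x y /ltW xr /ltW yr; exact: lF.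
Qed.

Lemma is_diff_of_bound (V W : normedModType R) (f : V -> W) (L : {linear V -> W}) x :
  continuous L ->
  (forall e : R, 0 < e -> \forall h \near 0,
     `|f (h + x) - (f x + L h)| <= e * `|h|) -> is_diff x f L.
Proof.
move=> cL H; have E : f \o shift x = cst (f x) + L +o_ 0 id.
  by apply/eqaddoP => e e0; exact: H.
have D := diff_unique cL E; apply: DiffDef => //.
by apply/diff_locallyP; rewrite D.
Qed.

(** For x' = g (F x + k), the error of the candidate linearization of [g] is minus the inverse
    differential applied to the error of the linearization of [F] at x' - x. The latter is small
    compared with |x' - x|, which is at most 2 |k|. *)
Lemma inverse_diff N (U : set 'rV[R]_N) (F g : 'rV[R]_N -> 'rV[R]_N) x :
  U x -> open (F @` U) -> differentiable F x ->
  (forall v, 'd F x v = 0 -> v = 0) ->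
  (forall x y, U x -> U y -> `|x - y| <= 2 * `|F x - F y|) ->
  (forall x, U x -> g (F x) = x) ->
  is_diff (F x) g (mulmxr (invmx (lin1_mx ('d F x)))).
Proof.
move=> Ux oFU dF inj lF gF; set A := lin1_mx _.
have uA : A \in unitmx by exact: invertible_lin1.
pose L : {linear 'rV[R]_N -> 'rV[R]_N} := mulmxr (invmx A).
have cL : continuous L by exact: linear_mx_continuous.
have [M M0 LM] := linear_lipschitz cL.
have LF h : L ('d F x h) = h.
  by rewrite /L /= -(mul_rV_lin1 ('d F x)) -/A mulmxK.
apply: (is_diff_of_bound (L := L)) => // e e0.
(* [M] bounds the inverse differential and the 2 comes from the expansion estimate [lF]; for the
   same reason [k] is restricted to norm below d / 2. *)
have e'0 : 0 < e / (2 * M) by rewrite divr_gt0// mulr_gt0.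
have /eqaddoP/(_ _ e'0)/nbhs_closed_ball[d d0 Hd] := diff_locally dF.
have H1 : \forall k \near (0 : 'rV[R]_N), (F @` U) (k + F x).
  have : \forall y \near F x, (F @` U) y.
    by apply: open_nbhs_nbhs; split=> //; exists x.
  by rewrite (near_shift 0) subr0.
have d20 : 0 < d / 2 by rewrite divr_gt0.
have H2 : \forall k \near (0 : 'rV[R]_N), `|k| < d / 2 by exact: nbhs0_lt.
apply: filterS2 H1 H2 => k /= [x' Ux' Fx'] kd.
have lh := lF _ _ Ux' Ux; rewrite Fx' addrK in lh.
have := Hd (x' - x); rewrite subr0 => /(_ _)/=.
rewrite !fctE /= subrK => Hx.
rewrite -Fx' !gF//.
have -> : x' - (x + L k) = - L (F x' - (F x + 'd F x (x' - x))).
  have -> : F x' - (F x + 'd F x (x' - x)) = k - 'd F x (x' - x).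
    by rewrite Fx'; apply/rowP => j; rewrite !mxE; ring.
  by rewrite linearB LF; apply/rowP => j; rewrite !mxE; ring.
rewrite normrN (le_trans (LM _))// (@le_trans _ _ (M * (e / (2 * M) * `|x' - x|)))//.
  by rewrite ler_pM2l//; apply: Hx; lra.
have -> : M * (e / (2 * M) * `|x' - x|) = e / 2 * `|x' - x| by field; rewrite gt_eqF.
by rewrite -mulrA ler_pM2l// ler_pdivrMl.
Qed.

(** Bootstrapping: the differential of [g] at y is the inverse matrix of the differential of [F] at
    [g y], so it is of class r as soon as [g] is, and then [g] is of class r + 1. *)
Lemma inverse_smooth N (U : set 'rV[R]_N) (F g : 'rV[R]_N -> 'rV[R]_N) :
  open U -> open (F @` U) -> smooth U F ->
  (forall x v, U x -> 'd F x v = 0 -> v = 0) ->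
  (forall x y, U x -> U y -> `|x - y| <= 2 * `|F x - F y|) ->
  (forall x, U x -> g (F x) = x) -> smooth (F @` U) g.
Proof.
move=> oU oFU sF inj lF gF.
have D x (Ux : U x) := inverse_diff Ux oFU (smooth_differentiable sF Ux)
   (fun v => inj x v Ux) lF gF.
elim=> [|r IH].
  by move=> _ [x Ux <-]; apply: differentiable_continuous; have [] := D x Ux.
split=> [_ [x Ux <-]|v]; first by have [] := D x Ux.
apply: (@Ck_ext _ _ _ _ _ (fun y => v *m invmx (lin1_mx ('d F (g y))))) => //.
  by move=> _ [x Ux <-]; rewrite (diff_eval v (D x Ux)) gF.
apply: Ck_mulmx => //; first exact: Ck_cst.
apply: Ck_invmx => //.
  by move=> _ [x Ux <-]; rewrite gF//; apply: invertible_lin1 => w; exact: inj.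
apply/Ck_mx => // i j; under eq_fun do rewrite mxE.
apply: (@Ck_comp _ _ _ _ _ _ U (fun z => 'd F z (delta_mx 0 i) 0 j) g) => //.
  by move=> _ [x Ux <-]; rewrite gF.
have [_ /(_ (delta_mx 0 i))] := sF r.+1.
by move=> /Ck_mx; exact.
Qed.

(** Composing with the inverse of the differential at [x0] reduces to a map whose differential there
    is the identity. *)
Lemma inverse_function N (O : set 'rV[R]_N) (F : 'rV[R]_N -> 'rV[R]_N) x0 :
  open O -> O x0 -> smooth O F -> (forall v, 'd F x0 v = 0 -> v = 0) ->
  exists U G, [/\ open U, U x0, U `<=` O & open (F @` U)] /\
    smooth (F @` U) G /\ forall x, U x -> G (F x) = x.
Proof.
move=> oO Ox sF inj; pose A := lin1_mx ('d F x0).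
have uA : A \in unitmx by exact: invertible_lin1.
pose K : {linear 'rV[R]_N -> 'rV[R]_N} := mulmxr (invmx A).
have cK : continuous K by exact: linear_mx_continuous.
pose F' x := K (F x).
have sF' : smooth O F' by move=> r; apply: Ck_linear_comp => //; exact: sF.
have D x : O x -> is_diff x F' (K \o 'd F x).
  move=> Ox'; apply: (is_diff_comp (differentiableP (smooth_differentiable sF Ox'))).
  by apply: DiffDef; [exact: linear_differentiable|exact: diff_lin].
have dF' v : 'd F' x0 v = v.
  rewrite (diff_eval v (D _ Ox)) /= -(mul_rV_lin1 ('d F x0)) -/A.
  by rewrite mulmxK.
have [U [[oU Ux UO oFU] [injU lU]]] := inverse_near_id oO Ox sF' dF'.
pose g := 'pinv_(fun=> x0) U F'.
have gF x : U x -> g (F' x) = x.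
  move=> Ux'; apply: pinvKV; rewrite ?inE// => y z; rewrite !inE => Uy Uz E.
  have := lU _ _ Uy Uz; rewrite E subrr normr0 mulr0 normr_le0 subr_eq0.
  by move=> /eqP.
have FUE : F @` U = K @^-1` (F' @` U).
  apply/seteqP; split=> [_ [x Ux' <-]|y [x Ux' E]]; first by exists x.
  by exists x => //; exact: (can_inj (mulmxKV uA)).
have oFU' : open (F @` U).
  by rewrite FUE; apply: open_comp => // y _; exact: cK.
have sg : smooth (F' @` U) g.
  by apply: inverse_smooth => // r; apply: Ck_subset (sF' r).
exists U, (g \o K); split=> //; split; last by move=> x Ux'; rewrite /= gF.
move=> r; apply: (@Ck_comp _ _ _ _ _ _ (F' @` U)) => //.
  by move=> _ [x Ux' <-]; exists x.
exact: Ck_linear.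
Qed.

End InverseFunction.

Section SecondDerivative.
Context {R : realType}.

(** The mean value theorem is used twice: along u for y |-> f (y + h v) - f y, then along v for the
    derivative of [f] in the direction u. *)
Lemma second_difference (V : normedModType R) (U : set V) (f : V -> R)
    (x u v : V) (h : R) : 0 <= h -> Ck 2 U f ->
  (forall s t, 0 <= s <= h -> 0 <= t <= h -> U (x + s *: u + t *: v)) ->
  exists s t, [/\ 0 <= s <= h, 0 <= t <= h &
    f (x + h *: u + h *: v) - f (x + h *: u) - (f (x + h *: v) - f x) =
    h * (h * 'd (fun y => 'd f y u) (x + s *: u + t *: v) v)].
Proof.
move=> h0 [f1 f2] HU; pose g y := f (y + h *: v) - f y.
have hh : 0 <= h <= h by rewrite h0 lexx.
have z0 : 0 <= (0 : R) <= h by rewrite h0 lexx.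
have Us s : 0 <= s <= h -> U (x + s *: u).
  by move=> sh; have := HU s 0 sh z0; rewrite scale0r addr0.
have D s : 0 <= s <= h -> is_diff (x + s *: u) g
    (fun w => 'd f (x + s *: u + h *: v) w - 'd f (x + s *: u) w).
  move=> sh; apply: is_diffB; last exact/differentiableP/f1/Us.
  apply: (is_diff_comp (f := fun y => y + h *: v) (df := id)).
    by apply: is_diff_eq; rewrite addr0.
  exact/differentiableP/f1/HU.
have [|s sh E1] := @segment_mvt _ V g x u h h0.
  by move=> t th; have [] := D t th.
have [|t th E2] := @segment_mvt _ V (fun y => 'd f y u) (x + s *: u) v h h0.
  by move=> t th; have [H _] := f2 u; apply/H/HU.
exists s, t; split=> //.
rewrite -E2 -(diff_eval u (D s sh)) -E1 /g.
by rewrite addrAC.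
Qed.

(** The second difference is symmetric in u and v, and by [second_difference] it is h^2 times either
    mixed derivative at some point near x. Continuity of the two mixed derivatives then makes their
    values at x differ by at most any e > 0. *)
Lemma Ck2_sym (V : normedModType R) (U : set V) (f : V -> R) (x u v : V) :
  open U -> U x -> Ck 2 U f ->
  'd (fun y => 'd f y u) x v = 'd (fun y => 'd f y v) x u.
Proof.
move=> oU Ux f2; apply/eqP; rewrite -subr_eq0 -normr_le0.
apply/ler_addgt0Pr => e e0; rewrite add0r.
pose D u v y := 'd (fun y => 'd f y u) y v : R.
have cD u' v' : {for x, continuous (D u' v')}.
  by have [_ /(_ u')[_ /(_ v')/(_ _ Ux)]] := f2.
have e20 : 0 < e / 2 by rewrite divr_gt0.
have N u' v' : \forall y \near x, `|D u' v' x - D u' v' y| < e / 2.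
  by have := cD u' v'; move/cvgrPdist_lt; exact.
have /nbhs_closed_ball[r r0 Hr] : \forall y \near x, [/\ U y,
    `|D u v x - D u v y| < e / 2 & `|D v u x - D v u y| < e / 2].
  near=> y; split; near: y; [exact: open_nbhs_nbhs|exact: N|exact: N].
(* This keeps the parallelogram spanned by h u and h v in the ball of radius [r]; the 1 avoids a
   zero denominator. *)
pose h := r / (`|u| + `|v| + 1).
have p0 : 0 < `|u| + `|v| + 1 by rewrite ltr_wpDl// addr_ge0.
have h0 : 0 < h by rewrite divr_gt0.
have near_x s t : 0 <= s <= h -> 0 <= t <= h ->
    `|x + s *: u + t *: v - x| <= r.
  move=> /andP[s0 sh] /andP[t0 th].
  have -> : x + s *: u + t *: v - x = s *: u + t *: v
    by rewrite -[x + _ + _]addrA [LHS]addrAC subrr add0r.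
  rewrite (le_trans (ler_normD _ _))// !normrZ !ger0_norm//.
  have -> : r = h * (`|u| + `|v| + 1) by rewrite /h divfK// gt_eqF.
  rewrite !mulrDr mulr1 -addrA lerD ?ler_wpM2r//.
  by rewrite (le_trans (ler_wpM2r _ th))// lerDl ltW.
have [|s [t [sh th E1]]] := @second_difference _ U f x u v h (ltW h0) f2.
  by move=> s t sh th; have [] := Hr _ (near_x s t sh th).
have [|t' [s' [th' sh' E2]]] := @second_difference _ U f x v u h (ltW h0) f2.
  by move=> s' t' sh' th'; rewrite addrAC; have [] := Hr _ (near_x t' s' th' sh').
have : D u v (x + s *: u + t *: v) = D v u (x + s' *: u + t' *: v).
  have hn0 : h != 0 by rewrite gt_eqF.
  apply: (mulfI hn0); apply: (mulfI hn0); rewrite /D -E1 [in RHS]addrAC -E2.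
  by rewrite [x + h *: v + h *: u]addrAC; ring.
have [_ + _] := Hr _ (near_x s t sh th).
have [_ _ +] := Hr _ (near_x s' t' sh' th').
rewrite -!/(D _ _ _).
set a := D u v x; set b := D v u x; set c := D u v _; set d := D v u _.
move=> H1 H2 E.
rewrite -/a -/b.
have -> : a - b = (a - c) - (b - d) by rewrite E; ring.
by rewrite (le_trans (ler_normB _ _))//; lra.
Unshelve. all: by end_near. Qed.

Lemma smooth_diff (V W : normedModType R) (U : set V) (f : V -> W) v :
  smooth U f -> smooth U (fun x => 'd f x v).
Proof. by move=> sf r; have [_ /(_ v)] := sf r.+1. Qed.

Lemma smooth_subset (V W : normedModType R) (U U' : set V) (f : V -> W) :
  U' `<=` U -> smooth U f -> smooth U' f.
Proof. by move=> UU sf r; exact: Ck_subset (sf r). Qed.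

Lemma smooth_ext (V W : normedModType R) (U : set V) (f g : V -> W) : open U ->
  (forall x, U x -> f x = g x) -> smooth U f -> smooth U g.
Proof. by move=> oU fg sf r; exact: Ck_ext fg (sf r). Qed.

Lemma smooth_local (V W : normedModType R) (U : set V) (f : V -> W) :
  (forall x, U x -> exists O, [/\ open O, O x & smooth O f]) -> smooth U f.
Proof.
move=> H r; apply: Ck_local => x /H[A [oA Ax sA]]; exists A; split=> //; exact: sA.
Qed.

Lemma smooth_comp m (V W : normedModType R) (U : set V) (O : set 'rV[R]_m)
    (g : 'rV[R]_m -> W) (f : V -> 'rV[R]_m) : open U ->
  (forall x, U x -> O (f x)) -> smooth O g -> smooth U f ->
  smooth U (fun x => g (f x)).
Proof. by move=> oU UO sg sf r; exact: Ck_comp UO (sg r) (sf r). Qed.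

Lemma smooth_linear m n (W : normedModType R) (U : set 'M[R]_(m, n))
  (L : {linear 'M[R]_(m, n) -> W}) : smooth U L.
Proof. move=> r; apply: Ck_linear; exact: linear_mx_continuous. Qed.

Lemma smooth_linear_comp m n (V W : normedModType R) (U : set V)
    (L : {linear 'M[R]_(m, n) -> W}) (f : V -> 'M[R]_(m, n)) : open U ->
  smooth U f -> smooth U (fun x => L (f x)).
Proof.
move=> oU sf r; apply: Ck_linear_comp (sf r) => //.
exact: linear_mx_continuous.
Qed.

Lemma smooth_coord m n (V : normedModType R) (U : set V) (f : V -> 'M[R]_(m, n)) :
  open U -> (forall i j, smooth U (fun x => f x i j)) <-> smooth U f.
Proof.
move=> oU; split=> H; first by move=> r; apply/Ck_mx => // i j; exact: H.
by move=> i j r; have /Ck_mx := H r; exact.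
Qed.

Lemma is_diff_linear m n (W : normedModType R) (L : {linear 'M[R]_(m, n) -> W}) x :
  is_diff x L L.
Proof.
have cL : continuous L by exact: linear_mx_continuous.
by apply: DiffDef; [exact: linear_differentiable|exact: diff_lin].
Qed.

Lemma is_diff_smooth (V W : normedModType R) (U : set V) (f : V -> W) x :
  smooth U f -> U x -> is_diff x f ('d f x).
Proof. by move=> sf Ux; exact: differentiableP (smooth_differentiable sf Ux). Qed.

Lemma smooth_sym m n (U : set 'rV[R]_m) (f : 'rV[R]_m -> 'rV[R]_n) x u v :
  open U -> U x -> smooth U f ->
  'd (fun y => 'd f y u) x v = 'd (fun y => 'd f y v) x u.
Proof.
move=> oU Ux sf; apply/rowP => i.
pose p (z : 'rV[R]_n) : R := z 0 i.
have lp : linear p by move=> a y z; rewrite /p !mxE.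
pose L : {linear 'rV[R]_n -> R^o} := HB.pack p (GRing.isLinear.Build _ _ _ _ _ lp).
have E (g : 'rV[R]_m -> 'rV[R]_n) y w : differentiable g y ->
    'd g y w 0 i = 'd (fun z => g z 0 i : R^o) y w.
  move=> dg; have D := is_diff_comp (differentiableP dg) (is_diff_linear L (g y)).
  by rewrite -[LHS]/((L \o 'd g y) w) -(diff_eval w D).
have sd w := smooth_diff w sf.
have d' w : differentiable (fun y => 'd f y w) x.
  exact: smooth_differentiable (sd w) Ux.
have E1 := E (fun y => 'd f y u) x v (d' u).
have E2 := E (fun y => 'd f y v) x u (d' v).
have S : Ck 2 U (fun z => f z 0 i : R^o) by have /Ck_mx := sf 2; exact.
have := @Ck2_sym _ U (fun z => f z 0 i) x u v oU Ux S.
have X w a : 'd (fun y => 'd f y w 0 i : R^o) x a =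
             'd (fun y => 'd (fun z => f z 0 i : R^o) y w) x a.
  have N : {near x, (fun y => 'd (fun z => f z 0 i : R^o) y w) =1
                    (fun y => 'd f y w 0 i : R^o)}.
    near=> y; rewrite E//; apply: smooth_differentiable sf _.
    by near: y; exact: open_nbhs_nbhs.
  have dS : differentiable (fun y => 'd (fun z => f z 0 i : R^o) y w) x.
    by have [_ /(_ w)[+ _]] := S; exact.
  by have [_ d2] := diff_near N dS; exact: (congr1 (fun h => h a) d2).
move=> E3.
have E4 := etrans E1 (X u v).
have E5 := etrans E2 (X v u).
exact: (etrans E4 (etrans E3 (esym E5))).
Unshelve. all: by end_near. Qed.

End SecondDerivative.

(** * Charts and local representations of smooth maps *)

Section Opens.
Context {T S : topologicalType}.

Lemma open_nbhd (A : set T) :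
  (forall x, A x -> exists O, [/\ open O, O x & O `<=` A]) -> open A.
Proof.
move=> H; rewrite openE => x /H[U [oU Ux UA]].
by apply: (filterS UA); exact: open_nbhs_nbhs.
Qed.

Lemma open_preimage (U : set T) (f : T -> S) (V : set S) : open U -> open V ->
  (forall x, U x -> {for x, continuous f}) -> open (U `&` f @^-1` V).
Proof.
move=> oU oV cf; rewrite openE => x [Ux Vx].
apply: filterI; first exact: open_nbhs_nbhs.
by apply: (cf x Ux); exact: open_nbhs_nbhs.
Qed.
End Opens.

Section ChartTransitions.
Context {R : realType}.

Lemma diff_near_eval (V W : normedModType R) (f g df : V -> W) x v :
  {near x, f =1 g} -> is_diff x f df -> 'd g x v = df v.
Proof.
move=> N D; have [_ E] := diff_near N (@ex_diff _ _ _ _ _ _ _ D).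
exact: etrans (congr1 (fun h : V -> W => h v) E) (diff_eval v D).
Qed.

Local Notation chart := (chart R).
Local Notation smooth_space := (smooth_space R).

Lemma chart_invK (X : Type) n (c : chart X n) x0 x :
  is_chart c -> dom c x -> chart_inv c x0 (coord c x) = x.
Proof.
move=> [inj _] cx; apply: pinvKV; rewrite ?inE// => y z; rewrite !inE.
exact: inj.
Qed.

Definition transition (X : Type) n (c d : chart X n) x0 y :=
  coord d (chart_inv c x0 y).

Lemma transitionE (X : Type) n (c d : chart X n) x0 x :
  is_chart c -> dom c x -> transition c d x0 (coord c x) = coord d x.
Proof. by move=> chc cx; rewrite /transition chart_invK. Qed.

Definition overlap (X : Type) n (c d : chart X n) := coord c @` (dom c `&` dom d).

(** The part of the manifold axioms that involves no topology. It is the common ground of manifolds,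
    cotangent bundles, fibers and V^*M, the last three of which are given by an atlas alone. *)
Definition good_space n (X : smooth_space n) :=
  [/\ forall c, atlas X c -> is_chart c,
      forall c d, atlas X c -> atlas X d -> compatible c d &
      forall x, exists2 c, atlas X c & dom c x].

(** Near a common point the transition from [c] to [d] factors through the intermediate chart [a].
    This gives the mutual compatibility of charts of the maximal atlas. *)
Lemma compatible_trans (X : Type) n (c d : chart X n) : is_chart c -> is_chart d ->
  (forall x, dom c x -> dom d x -> exists a, [/\ is_chart a, dom a x,
     compatible c a & compatible a d]) -> smooth_transition c d.
Proof.
move=> chc chd H.
have key x : dom c x -> dom d x -> exists O a, [/\ open O, O (coord c x) &
    [/\ is_chart a, dom a x, compatible c a, compatible a d &
       forall y, O y -> exists z, [/\ dom c z, dom a z, dom d z & y = coord c z]]].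
  move=> cx dx; have [a [cha ax ca cad]] := H x cx dx.
  have [[oca sca] _] := ca; have [[oad _] _] := cad.
  exists (overlap c a `&` transition c a x @^-1` overlap a d), a; split.
  - apply: (open_preimage oca oad) => y Uy.
    exact: smooth_continuous (iffLR (smooth_onE _ _) (sca x (conj cx ax))) Uy.
  - split; first by exists x.
    by rewrite /= transitionE//; exists x.
  - split=> // y [[z [cz az] <-]]; rewrite /= transitionE// => -[w [aw dw]].
    by move=> /(cha.1 _ _ aw az) E; exists z; split=> //; rewrite -E.
have oU : open (overlap c d).
  apply: open_nbhd => _ [x [cx dx] <-].
  have [A [a [oA Ax [_ _ _ _ HA]]]] := key x cx dx.
  by exists A; split=> // y /HA[z [cz az dz ->]]; exists z.
split=> // x0 [cx0 dx0]; apply/smooth_onE; apply: smooth_local => _ [x [cx dx] <-].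
have [A [a [oA Ax [cha ax [[oca sca] _] [[oad sad] _] HA]]]] := key x cx dx.
exists A; split=> //.
apply: (@smooth_ext _ _ _ _ (fun y => transition a d x (transition c a x y))) => //.
  by move=> _ /HA[z [cz az dz ->]]; rewrite /transition !chart_invK.
apply: (@smooth_comp _ _ _ _ _ (overlap a d)) => //.
- by move=> _ /HA[z [cz az dz ->]]; rewrite transitionE//; exists z.
- by apply/smooth_onE; exact: sad.
- have /smooth_onE := sca x (conj cx ax); apply: smooth_subset.
  by move=> _ /HA[z [cz az dz ->]]; exists z.
Qed.

Lemma compatible_sym (X : Type) n (c d : chart X n) : compatible c d -> compatible d c.
Proof. by case. Qed.

Section GoodSpace.
Context {n : nat} {X : smooth_space n}.
Hypothesis gX : good_space X.
Implicit Types (c d e : chart X n) (x : X).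

Lemma atlas_maximal c : atlas X c -> maximal_atlas c.
Proof. by case: gX => H1 H2 _ ac; split=> [|d ad]; [exact: H1|exact: H2]. Qed.

Lemma maximal_compatible c d : maximal_atlas c -> maximal_atlas d -> compatible c d.
Proof.
have H c' d' : maximal_atlas c' -> maximal_atlas d' -> smooth_transition c' d'.
  move=> [chc Hc] [chd Hd]; apply: compatible_trans => // x cx dx.
  case: gX => H1 _ /(_ x)[a aa ax]; exists a; split=> //; [exact: H1|exact: Hc|].
  exact/compatible_sym/Hd.
by move=> mc md; split; exact: H.
Qed.

Lemma overlap_open c d : maximal_atlas c -> maximal_atlas d -> open (overlap c d).
Proof. by move=> mc md; have [[]] := maximal_compatible mc md. Qed.

Lemma smooth_transitionP c d x0 : maximal_atlas c -> maximal_atlas d ->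
  smooth (overlap c d) (transition c d x0).
Proof.
move=> mc md; have oU := overlap_open mc md.
apply: smooth_local => _ [x [cx dx] <-]; exists (overlap c d); split=> //.
  by exists x.
apply: (@smooth_ext _ _ _ _ (transition c d x)) => //.
  by move=> _ [z [cz dz] <-]; rewrite !transitionE//; case: mc.
by apply/smooth_onE; have [[_ H] _] := maximal_compatible mc md; exact: H.
Qed.

Lemma transition_diff c d x : maximal_atlas c -> maximal_atlas d ->
  dom c x -> dom d x -> is_diff (coord c x) (transition c d x)
    ('d (transition c d x) (coord c x)).
Proof.
move=> mc md cx dx; apply: (is_diff_smooth (smooth_transitionP x mc md)).
by exists x.
Qed.

Lemma near_overlap c d x : maximal_atlas c -> maximal_atlas d ->
  dom c x -> dom d x -> \forall y \near coord c x, overlap c d y.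
Proof.
move=> mc md cx dx; apply: open_nbhs_nbhs; split; first exact: overlap_open.
by exists x.
Qed.

Lemma transition_chain c d e x v :
  maximal_atlas c -> maximal_atlas d -> maximal_atlas e ->
  dom c x -> dom d x -> dom e x ->
  'd (transition d e x) (coord d x) ('d (transition c d x) (coord c x) v) =
  'd (transition c e x) (coord c x) v.
Proof.
move=> mc md me cx dx ex; have [chc _] := mc; have [chd _] := md.
have D1 := transition_diff mc md cx dx.
have D2 := transition_diff md me dx ex.
have E : transition c d x (coord c x) = coord d x by exact: transitionE.
rewrite -E in D2.
have D3 := is_diff_comp D1 D2.
have N : {near coord c x, transition d e x \o transition c d x =1 transition c e x}.
  have := near_overlap mc md cx dx; apply: filterS => _ [z [cz dz] <-] /=.
  by rewrite !transitionE.
by apply: esym; apply: (etrans (diff_near_eval v N D3)); rewrite /= E.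
Qed.

Lemma transition_id c x v : maximal_atlas c -> dom c x ->
  'd (transition c c x) (coord c x) v = v.
Proof.
move=> mc cx; have [chc _] := mc.
have N : {near coord c x, id =1 transition c c x}.
  have := near_overlap mc mc cx cx; apply: filterS => _ [z [cz dz] <-] /=.
  by rewrite transitionE.
exact: diff_near_eval v N (is_diff_id (coord c x)).
Qed.

Lemma chart_atP x : atlas X (chart_at x) /\ dom (chart_at x) x.
Proof.
rewrite /chart_at; case: pselect => [h|]; first by case: (cid h).
by case; case: gX => _ _ /(_ x)[c ac cx]; exists c.
Qed.

Lemma chart_at_maximal x : maximal_atlas (chart_at x).
Proof. exact: atlas_maximal (chart_atP x).1. Qed.

Lemma dcoordE c x v :
  dcoord c x v = 'd (transition (chart_at x) c x) (coord (chart_at x) x) v.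
Proof. by rewrite lfunE. Qed.

Lemma dcoord_chart_at x v : dcoord (chart_at x) x v = v.
Proof.
rewrite dcoordE; exact: transition_id (chart_at_maximal x) (chart_atP x).2.
Qed.

Lemma dcoord_transition c d x v : maximal_atlas c -> maximal_atlas d ->
  dom c x -> dom d x ->
  'd (transition c d x) (coord c x) (dcoord c x v) = dcoord d x v.
Proof.
move=> mc md cx dx.
apply: (etrans (congr1 _ (dcoordE c x v))); apply: esym.
apply: (etrans (dcoordE d x v)); apply: esym.
exact: transition_chain (chart_at_maximal x) mc md (chart_atP x).2 cx dx.
Qed.

Lemma dcoord_from c x v : maximal_atlas c -> dom c x ->
  'd (transition c (chart_at x) x) (coord c x) (dcoord c x v) = v.
Proof.
move=> mc cx; apply: etrans (dcoord_chart_at x v).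
exact: dcoord_transition mc (chart_at_maximal x) cx (chart_atP x).2.
Qed.

Lemma dcoord_lker0 c x : maximal_atlas c -> dom c x -> lker (dcoord c x) == 0%VS.
Proof.
move=> mc cx; apply/lker0P => u v E.
by rewrite -(dcoord_from u mc cx) E; exact: dcoord_from.
Qed.

Lemma dcoordK c x : maximal_atlas c -> dom c x ->
  cancel (dcoord c x) (dcoord c x)^-1%VF.
Proof. by move=> mc cx; apply: lker0_lfunK; exact: dcoord_lker0. Qed.

Lemma dcoordVK c x : maximal_atlas c -> dom c x ->
  cancel (dcoord c x)^-1%VF (dcoord c x).
Proof. by move=> mc cx; apply: lker0_lfunVK; exact: dcoord_lker0. Qed.

Definition comp_chart c (O : set 'rV[R]_n) (psi : 'rV[R]_n -> 'rV[R]_n) : chart X n :=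
  Chart [set x | dom c x /\ O (coord c x)] (fun x => psi (coord c x)).

(** All special charts below (restricted, slice, centered and adapted ones) arise by composing a
    known chart with a local diffeomorphism. *)
Lemma comp_chart_maximal c O psi phi : maximal_atlas c -> open O ->
  O `<=` coord c @` dom c -> smooth O psi -> open (psi @` O) ->
  smooth (psi @` O) phi -> (forall y, O y -> phi (psi y) = y) ->
  maximal_atlas (comp_chart c O psi).
Proof.
move=> mc oO Oc spsi opO sphi K; have [chc Hc] := mc.
have chc' : is_chart (comp_chart c O psi).
  split=> /= [x y [cx Ox] [cy Oy] E|].
    by apply: chc.1 => //; rewrite -(K _ Ox) E K.
  suff -> : (fun x => psi (coord c x)) @` [set x | dom c x /\ O (coord c x)] =
      psi @` O by [].
  apply/seteqP; split=> [_ [x [cx Ox] <-]|_ [y Oy <-]]; first by exists (coord c x).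
  by have [x cx E] := Oc _ Oy; exists x; rewrite /= E.
split=> // d ad; have [[ocd scd] [odc sdc]] := Hc d ad.
have chd : is_chart d by case: gX => H _ _; exact: H.
have md := atlas_maximal ad.
have U1 : coord (comp_chart c O psi) @` (dom (comp_chart c O psi) `&` dom d) =
    psi @` O `&` phi @^-1` overlap c d.
  apply/seteqP; split=> [_ [x [/= [cx Ox] dx] <-]|_ [[y Oy <-]] /=].
    by split; [exists (coord c x)|rewrite /= K//; exists x].
  by rewrite K// => -[x [cx dx] E]; exists x; rewrite /= E.
split; split.
- rewrite U1; apply: (open_preimage opO (overlap_open mc md)) => y.
  exact: smooth_continuous sphi.
- move=> x0 [_ dx0]; apply/smooth_onE; rewrite U1.
  apply: (@smooth_ext _ _ _ _ (fun y => transition c d x0 (phi y))).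
  + apply: (open_preimage opO (overlap_open mc md)) => y.
    exact: smooth_continuous sphi.
  + move=> _ [[y Oy <-]]; rewrite /= K// => -[x [cx dx] E].
    rewrite -E transitionE//.
    have := @transitionE _ _ (comp_chart c O psi) d x0 x chc'.
    rewrite /transition /= => ->//.
    by rewrite E.
  + apply: (@smooth_comp _ _ _ _ _ (overlap c d)).
    * apply: (open_preimage opO (overlap_open mc md)) => y.
      exact: smooth_continuous sphi.
    * by move=> y [].
    * exact: smooth_transitionP.
    * by apply: smooth_subset sphi => y [].
- apply: open_nbhd => _ [x [dx [cx Ox]] <-].
  exists (overlap d c `&` transition d c x @^-1` O); split.
  + apply: (open_preimage (overlap_open md mc) oO) => y.
    exact: smooth_continuous (smooth_transitionP x md mc).
  + by split; [exists x|rewrite /= transitionE].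
  + by move=> _ [[z [dz cz] <-]] /=; rewrite transitionE// => Oz; exists z.
- move=> x0 [dx0 _]; apply/smooth_onE; apply: smooth_local => _ [x [dx [cx Ox]] <-].
  have oW : open (overlap d c `&` transition d c x @^-1` O).
    apply: (open_preimage (overlap_open md mc) oO) => y.
    exact: smooth_continuous (smooth_transitionP x md mc).
  exists (overlap d c `&` transition d c x @^-1` O); split=> //.
    by split; [exists x|rewrite /= transitionE].
  apply: (@smooth_ext _ _ _ _ (fun y => psi (transition d c x y))) => //.
    by move=> _ [[z [dz cz] <-] _]; rewrite transitionE// chart_invK.
  apply: (@smooth_comp _ _ _ _ _ O) => //; first by move=> y [].
  by apply: smooth_subset (smooth_transitionP x md mc) => y [].
Qed.

Lemma comp_chart_atlas_inv c O psi x0 y : maximal_atlas c ->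
  is_chart (comp_chart c O psi) -> O y -> O `<=` coord c @` dom c ->
  chart_inv (comp_chart c O psi) x0 (psi y) = chart_inv c x0 y.
Proof.
move=> [chc _] chc' Oy /(_ _ Oy)[x cx E].
rewrite -E (chart_invK x0 chc cx).
by have := @chart_invK _ _ (comp_chart c O psi) x0 x chc'; apply => /=; rewrite E.
Qed.

Lemma restrict_chart_maximal c O : maximal_atlas c -> open O ->
  O `<=` coord c @` dom c -> maximal_atlas (comp_chart c O id).
Proof.
move=> mc oO Oc; have E : (@id 'rV[R]_n) @` O = O by rewrite image_id.
have si (A : set 'rV[R]_n) : smooth A id by exact: (@smooth_linear _ _ _ _ A idfun).
by apply: (@comp_chart_maximal c O id id) => //; rewrite E.
Qed.

End GoodSpace.

(** * Differentials of smooth maps in arbitrary charts *)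

Section SmoothMaps.
Context {n m : nat} {X : smooth_space n} {Y : smooth_space m}.
Hypotheses (gX : good_space X) (gY : good_space Y).
Implicit Types (c : chart X n) (d : chart Y m) (f : X -> Y) (x : X).

Definition local_rep c d f x0 (y : 'rV[R]_n) := coord d (f (chart_inv c x0 y)).

Lemma local_repE c d f x0 x : is_chart c -> dom c x ->
  local_rep c d f x0 (coord c x) = coord d (f x).
Proof. by move=> chc cx; rewrite /local_rep chart_invK. Qed.

(** A single pair of charts is asked for, from the maximal atlases. Inclusions and bundle
    projections meet this directly by a formula in well chosen charts. *)
Definition smooth_near f x := exists c d,
  [/\ maximal_atlas c, maximal_atlas d, dom c x, (forall z, dom c z -> dom d (f z)) &
      smooth (coord c @` dom c) (local_rep c d f x)].

Lemma smooth_near_nbhd f x c d : smooth_near f x -> maximal_atlas c ->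
  maximal_atlas d -> dom c x -> dom d (f x) -> exists W, [/\ open W, W (coord c x),
    (forall y, W y -> exists z, [/\ dom c z, dom d (f z) & y = coord c z]) &
    smooth W (local_rep c d f x)].
Proof.
move=> [c0 [d0 [mc0 md0 c0x fc0 s0]]] mc md cx dfx.
have [chc _] := mc; have [chd _] := md; have [chc0 _] := mc0; have [chd0 _] := md0.
have oc0 : open (coord c0 @` dom c0) by case: chc0.
pose h y := transition d0 d (f x) (local_rep c0 d0 f x (transition c c0 x y)).
have oV : open (coord c0 @` dom c0 `&` local_rep c0 d0 f x @^-1` overlap d0 d).
  apply: (open_preimage oc0 (overlap_open gY md0 md)) => y.
  exact: smooth_continuous s0.
pose W := overlap c c0 `&` transition c c0 x @^-1`
  (coord c0 @` dom c0 `&` local_rep c0 d0 f x @^-1` overlap d0 d).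
have oW : open W.
  apply: (open_preimage (overlap_open gX mc mc0) oV) => y.
  exact: smooth_continuous (smooth_transitionP gX x mc mc0).
have Wx : W (coord c x).
  split; first by exists x.
  rewrite /= transitionE//; split; first by exists x.
  by rewrite /= local_repE//; exists (f x) => //; split=> //; exact: fc0.
have sh : smooth W h.
  apply: (@smooth_comp _ _ _ _ _ (overlap d0 d)) => //.
  - by move=> y [_ []].
  - exact: smooth_transitionP.
  - apply: (@smooth_comp _ _ _ _ _ (coord c0 @` dom c0)) => //.
      by move=> y [_ []].
    by apply: smooth_subset (smooth_transitionP gX x mc mc0) => y [].
have WP y : W y -> exists z, [/\ dom c z, dom d (f z), y = coord c z & h y = coord d (f z)].
  move=> [[z [cz c0z] <-]] /=; rewrite /h transitionE//.
  move=> [_]; rewrite /= !local_repE// => -[w [d0w dw] E].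
  have E' : w = f z by apply: chd0.1 => //; exact: fc0.
  exists z; split=> //; first by rewrite -E'.
  by rewrite -E transitionE// E'.
exists W; split=> //; first by move=> y /WP[z [? ? ?]]; exists z.
apply: (smooth_ext oW _ sh) => y /WP[z [cz dz -> ->]].
by rewrite local_repE.
Qed.

Lemma smooth_near_diff f x c d : smooth_near f x -> maximal_atlas c ->
  maximal_atlas d -> dom c x -> dom d (f x) ->
  is_diff (coord c x) (local_rep c d f x) ('d (local_rep c d f x) (coord c x)).
Proof.
move=> sf mc md cx dfx; have [W [oW Wx _ sW]] := smooth_near_nbhd sf mc md cx dfx.
exact: is_diff_smooth sW Wx.
Qed.

(** [mdiff] lives in the charts chosen at x and f x. Both sides are the derivative of the
    representation of [f] from the chosen chart at x to [d], computed by the chain rule through the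
    chosen chart at f x and through [c]. *)
Lemma mdiffE f x c d v : smooth_near f x -> maximal_atlas c ->
  maximal_atlas d -> dom c x -> dom d (f x) ->
  dcoord d (f x) (mdiff f x v) =
  'd (local_rep c d f x) (coord c x) (dcoord c x v).
Proof.
move=> sf mc md cx dfx; set a := chart_at x; set b := chart_at (f x).
have ma : maximal_atlas a by exact: chart_at_maximal.
have mb : maximal_atlas b by exact: chart_at_maximal.
have ax : dom a x by exact: (chart_atP gX x).2.
have bfx : dom b (f x) by exact: (chart_atP gY (f x)).2.
have [chc _] := mc; have [cha _] := ma; have [chb _] := mb.
have -> : mdiff f x v = 'd (local_rep a b f x) (coord a x) v by rewrite lfunE.
rewrite (dcoordE _ _ _) (dcoordE c x v) -/a -/b.
have D1 := smooth_near_diff sf ma mb ax bfx.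
have D2 := transition_diff gY mb md bfx dfx.
rewrite -(local_repE b f x cha ax) in D2.
have D12 := is_diff_comp D1 D2.
have D3 := transition_diff gX ma mc ax cx.
have D4 := smooth_near_diff sf mc md cx dfx.
rewrite -(transitionE c x cha ax) in D4.
have D34 := is_diff_comp D3 D4.
have L := smooth_near_diff sf ma md ax dfx.
have N1 : {near coord a x, transition b d (f x) \o local_rep a b f x =1
    local_rep a d f x}.
  have [W [oW Wx HW _]] := smooth_near_nbhd sf ma mb ax bfx.
  have : \forall y \near coord a x, W y by apply: open_nbhs_nbhs.
  apply: filterS => y /HW[z [az bz ->]] /=.
  by rewrite !local_repE// transitionE.
have N2 : {near coord a x, local_rep c d f x \o transition a c x =1
    local_rep a d f x}.
  have := near_overlap gX ma mc ax cx.
  by apply: filterS => _ [z [az cz] <-] /=; rewrite transitionE// !local_repE.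
have := etrans (esym (diff_near_eval v N1 D12)) (diff_near_eval v N2 D34).
have Eb : local_rep a b f x (coord a x) = coord b (f x) by exact: local_repE.
have Ec : transition a c x (coord a x) = coord c x by exact: transitionE.
by rewrite /= Eb Ec; exact.
Qed.

Lemma mdiff_local_rep f x c d (h : 'rV[R]_n -> 'rV[R]_m) v : maximal_atlas c ->
  maximal_atlas d -> dom c x -> (forall z, dom c z -> dom d (f z)) ->
  (forall z, dom c z -> coord d (f z) = h (coord c z)) ->
  smooth (coord c @` dom c) h ->
  smooth_near f x /\
  dcoord d (f x) (mdiff f x v) = 'd h (coord c x) (dcoord c x v).
Proof.
move=> mc md cx fcd E sh; have [chc oc] := mc.
have oc' : open (coord c @` dom c) by case: chc.
have sf : smooth_near f x.
  exists c, d; split=> //; apply: smooth_ext sh => // _ [z cz <-].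
  by rewrite local_repE// E.
split=> //; rewrite (mdiffE v sf mc md cx (fcd _ cx)).
have N : {near coord c x, h =1 local_rep c d f x}.
  have : \forall y \near coord c x, (coord c @` dom c) y.
    by apply: open_nbhs_nbhs; split=> //; exists x.
  by apply: filterS => _ [z cz <-]; rewrite local_repE// E.
have Dh : is_diff (coord c x) h ('d h (coord c x)).
  by apply: is_diff_smooth sh _; exists x.
exact: diff_near_eval N Dh.
Qed.

Lemma smooth_map_near f x : smooth_map f -> smooth_near f x.
Proof.
move=> sf; have [_ _ /(_ x)[c ac cx]] := gX; have [_ _ /(_ (f x))[d ad dfx]] := gY.
have [oD sD] := sf c d ac ad; set D := dom c `&` f @^-1` dom d in oD sD.
have mc := atlas_maximal gX ac; have [chc _] := mc.
have Oc : coord c @` D `<=` coord c @` dom c by move=> _ [z [cz _] <-]; exists z.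
(* The domain has to be cut down, since [smooth_near] wants all of it mapped into the domain of
   [d]. *)
have mc' := restrict_chart_maximal gX mc oD Oc.
have inD z : dom c z -> (coord c @` D) (coord c z) -> D z.
  by move=> cz [w [cw fw]] /(chc.1 _ _ cw cz) <-.
exists (comp_chart c (coord c @` D) id), d; split=> //.
- exact: atlas_maximal.
- by split=> //; exists x.
- by move=> z [cz /(inD _ cz)[]].
have E : coord (comp_chart c (coord c @` D) id) @` dom (comp_chart c (coord c @` D) id)
    = coord c @` D.
  apply/seteqP; split=> [_ [z [cz Dz] <-]//|_ [z [cz Dz] <-]].
  by exists z => //; split=> //; exists z.
rewrite E; have /smooth_onE := sD x (conj cx dfx).
apply: smooth_ext => // y Dy; rewrite /local_rep.
congr (coord d (f _)); apply/esym.
exact: (comp_chart_atlas_inv x mc (mc'.1) Dy Oc).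
Qed.

End SmoothMaps.
End ChartTransitions.

(** * Local equations of submanifolds *)

(* Unification would otherwise unfold the choices hidden in these terms. *)
#[local] Opaque diff dcoord mdiff.

Section LinearAlgebra.
Context {F : fieldType}.

Lemma surjective_rank N q (J : 'M[F]_(N, q)) :
  (forall w : 'rV_q, exists v : 'rV_N, v *m J = w) -> \rank J = q.
Proof.
move=> H; apply/eqP; rewrite -[_ == _]/(row_full J) -sub1mx.
by apply/row_subP => i; have [v <-] := H (row i 1%:M); exact: submxMl.
Qed.

(** The columns of [B] complete those of [A] to a basis. This is how independent equations are
    completed to coordinate systems. *)
Lemma complement_mx N p q (A : 'M[F]_(N, q)) : N = (p + q)%N -> \rank A = q ->
  exists B : 'M[F]_(N, p), forall v : 'rV_N, v *m B = 0 -> v *m A = 0 -> v = 0.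
Proof.
move=> E rA; pose C := (A^T^C)%MS.
have rC : \rank C = p by rewrite mxrank_compl mxrank_tr rA E addnK.
pose B := castmx (rC, erefl N) (row_base C).
have eB : (B :=: C)%MS by apply: eqmx_trans (eqmx_cast _ _) (eq_row_base _).
exists B^T => v vB vA.
have /row_fullP[X XE] : row_full (col_mx A^T B).
  have := addsmx_compl_full A^T; rewrite -!sub1mx => /submx_trans; apply.
  by rewrite -addsmxE addsmxS// eB.
rewrite -[v]mulmx1 -[1%:M]trmx1 -XE trmx_mul mulmxA tr_col_mx mul_mx_row.
by rewrite trmxK vB vA row_mx0 mul0mx.
Qed.

End LinearAlgebra.

Section Submanifolds.
Context {R : realType}.
Local Notation chart := (chart R).
Local Notation smooth_space := (smooth_space R).

Lemma lin1_mxE n m (L : {linear 'rV[R]_n -> 'rV[R]_m}) v : L v = v *m lin1_mx L.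
Proof. by rewrite mul_rV_lin1. Qed.

Lemma flat_rsubmx p q (v : 'rV[R]_(p + q)) : flat p v <-> rsubmx v = 0.
Proof.
split=> [H|H i pi].
  by apply/rowP => j; rewrite !mxE; apply: H; rewrite /= leq_addr.
case: (splitP i) => j E; first by move: pi; rewrite E leqNgt ltn_ord.
have -> : i = rshift p j by apply/val_inj.
by have /rowP/(_ j) := H; rewrite !mxE.
Qed.

Lemma diff_zero_along (V W : normedModType R) (O : set V) (h : V -> W) y w :
  smooth O h -> O y -> (\forall s \near (0 : R), h (y + s *: w) = 0) ->
  'd h y w = 0.
Proof.
move=> sh Oy N.
have D1 : is_diff (0 : R) (fun s : R => y + s *: w) (fun s => 0 + s *: w).
  exact: is_diffD (is_diff_cst y (0 : R)) (is_diff_scalel 0 w).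
have D2 : is_diff (y + 0 *: w) h ('d h y).
  by rewrite scale0r addr0; exact: is_diff_smooth sh Oy.
have D := is_diff_comp D1 D2.
have N' : {near (0 : R), (h \o (fun s : R => y + s *: w)) =1 cst 0} by [].
have := diff_near_eval (1 : R) N' D.
rewrite (diff_eval _ (is_diff_cst (0 : W) (0 : R))) /= add0r scale1r.
by move=> <-.
Qed.

(** Unlike slice charts, equations can simply be juxtaposed or composed with linear maps, which is
    how the part of Lambda over a fiber and its dilates are treated. *)
Definition local_equation n (X : smooth_space n) q (c : chart X n) (Z : set X) (z : X)
    (O : set 'rV[R]_n) (h : 'rV[R]_n -> 'rV[R]_q) :=
  [/\ open O, O (coord c z), O `<=` coord c @` dom c, smooth O h &
      forall w, exists v, 'd h (coord c z) v = w] /\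
  forall x, dom c x -> O (coord c x) -> (Z x <-> h (coord c x) = 0).

Section GoodSpace.
Context {n : nat} {X : smooth_space n}.
Hypothesis gX : good_space X.
Implicit Types (c d s t : chart X n) (x z : X) (Z : set X).

Lemma dcoord_comp_chart c O psi z v : maximal_atlas c ->
  maximal_atlas (comp_chart c O psi) -> open O -> smooth O psi -> dom c z ->
  O (coord c z) ->
  dcoord (comp_chart c O psi) z v = 'd psi (coord c z) (dcoord c z v).
Proof.
move=> mc ms oO sp cz Oz; have [chc _] := mc.
have sz : dom (comp_chart c O psi) z by [].
apply: (etrans (esym (dcoord_transition gX v mc ms cz sz))).
have N : {near coord c z, psi =1 transition c (comp_chart c O psi) z}.
  have HO : \forall y \near coord c z, O y by apply: open_nbhs_nbhs.
  have := near_overlap gX mc ms cz sz; apply: filterS2 HO.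
  by move=> y Oy [x [cx _] <-]; rewrite transitionE.
exact: diff_near_eval N (is_diff_smooth sp Oz).
Qed.

(** The base point is only a default value off the image of the chart, so it does not affect the
    germ. *)
Lemma transition_base c d x x0 v : maximal_atlas c -> maximal_atlas d -> dom c x ->
  dom d x ->
  'd (transition c d x0) (coord c x) v = 'd (transition c d x) (coord c x) v.
Proof.
move=> mc md cx dx; have [chc _] := mc.
have N : {near coord c x, transition c d x =1 transition c d x0}.
  have := near_overlap gX mc md cx dx; apply: filterS => _ [z [cz dz] <-].
  by rewrite !transitionE.
exact: diff_near_eval N (transition_diff gX mc md cx dx).
Qed.

(** Makes the existential in [tangent_sub] independent of the slice chart: a short flat segment in
    the chart [s] stays in [Z], so the coordinates of [t] of index at least p vanish along it, and
    so do their derivatives. *)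
Lemma slice_tangent p Z z s t v : slice_chart p Z s -> slice_chart p Z t ->
  dom s z -> dom t z -> Z z -> flat p (dcoord s z v) -> flat p (dcoord t z v).
Proof.
move=> [ms Hs] [mt Ht] sz tz Zz fv i pi.
have [chs [_ os]] : is_chart s * is_chart s by case: ms.
have sT := smooth_transitionP gX z ms mt.
pose h y : R^o := transition s t z y 0 i.
have sh : smooth (overlap s t) h.
  by have /smooth_coord := sT; move=> /(_ (overlap_open gX ms mt)); exact.
have Oz : overlap s t (coord s z) by exists z.
have E : 'd h (coord s z) (dcoord s z v) = (dcoord t z v) 0 i.
  have E := dcoord_transition gX v ms mt sz tz.
  apply: esym; apply: (etrans (congr1 (fun u : 'rV[R]_n => u 0 i) (esym E))).
  apply: esym; pose f (y : 'rV[R]_n) : R^o := y 0 i.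
  have lf : linear f by move=> a x y; rewrite /f !mxE.
  pose L : {linear 'rV[R]_n -> R^o} := HB.pack f (GRing.isLinear.Build _ _ _ _ _ lf).
  exact: diff_eval (is_diff_comp (transition_diff gX ms mt sz tz)
    (is_diff_linear L (transition s t z (coord s z)))).
rewrite -E; apply: (diff_zero_along sh Oz).
have flatz : flat p (coord s z).
  have : (coord s @` dom s `&` flat p) (coord s z) by rewrite -Hs; exists z.
  by case.
have C : (fun r : R => coord s z + r *: dcoord s z v) @ (0 : R) --> coord s z.
  rewrite -[X in _ --> X]addr0 -[X in _ --> _ + X](scale0r (dcoord s z v)).
  apply: cvgD; [exact: cvg_cst|].
  exact: (@scalel_continuous _ _ (dcoord s z v) 0).
have HC : \forall r \near (0 : R), overlap s t (coord s z + r *: dcoord s z v).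
  exact: C _ (near_overlap gX ms mt sz tz).
move: HC; apply: filterS => r [x [sx tx] Ex].
have [x' [sx' Zx'] Ex'] : (coord s @` (dom s `&` Z)) (coord s x).
  rewrite Hs; split; first by exists x.
  by rewrite Ex => j pj; rewrite !mxE flatz// fv// mulr0 addr0.
have xx : x' = x by apply: chs.1.
rewrite /h -Ex transitionE//.
have : (coord t @` dom t `&` flat p) (coord t x).
  by rewrite -Ht; exists x => //; split=> //; rewrite -xx.
by case=> _; exact.
Qed.

End GoodSpace.

(** Linear functions complementary to the differential of [h] complete [h] to a local
    diffeomorphism, by the inverse function theorem; in the new chart [h] becomes the last q
    coordinates. *)
Lemma slice_of_equation n (X : smooth_space n) p q (c : chart X n) (Z : set X) (z : X)
    O (h : 'rV[R]_n -> 'rV[R]_q) : good_space X -> n = (p + q)%N ->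
  maximal_atlas c -> dom c z -> local_equation c Z z O h ->
  exists s, [/\ slice_chart p Z s, dom s z &
    forall v, flat p (dcoord s z v) <-> 'd h (coord c z) (dcoord c z v) = 0].
Proof.
move=> gX En; subst n => mc cz [[oO Oz Oc sh surj] HZ].
have [chc _] := mc.
have rJ : \rank (lin1_mx ('d h (coord c z))) = q.
  apply: surjective_rank => w; have [v <-] := surj w.
  by exists v; rewrite lin1_mxE.
have [B HB] := complement_mx (erefl (p + q)%N) rJ.
pose psi y := y *m row_mx B 0 + h y *m row_mx 0 1%:M.
have psiE y : psi y = row_mx (y *m B) (h y).
  by rewrite /psi !mul_mx_row !mulmx0 mulmx1 add_row_mx addr0 add0r.
have Dpsi y : O y -> is_diff y psi (fun v => row_mx (v *m B) ('d h y v)).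
  move=> Oy.
  have D1 : is_diff y (fun y => y *m row_mx B 0 : 'rV[R]_(p + q)) (fun v => v *m row_mx B 0).
    exact: (is_diff_linear (mulmxr (row_mx B 0)) y).
  have D2 : is_diff y (fun y => h y *m row_mx 0 1%:M : 'rV[R]_(p + q))
      (fun v => 'd h y v *m row_mx 0 1%:M).
    exact: is_diff_comp (is_diff_smooth sh Oy)
      (is_diff_linear (mulmxr (row_mx 0 1%:M)) (h y)).
  have D3 : is_diff y psi
      (fun v => v *m row_mx B 0 + 'd h y v *m row_mx 0 1%:M) by exact: is_diffD D1 D2.
  apply: (is_diff_eq D3); apply/funext => v.
  by rewrite !mul_mx_row !mulmx0 mulmx1 add_row_mx addr0 add0r.
have sp : smooth O psi.
  move=> r; apply: CkD => //.
    exact: (@smooth_linear _ _ _ _ O (mulmxr (row_mx B 0))).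
  exact: (@smooth_linear_comp _ _ _ _ _ O (mulmxr (row_mx 0 1%:M)) h).
have inj v : 'd psi (coord c z) v = 0 -> v = 0.
  rewrite (diff_eval v (Dpsi _ Oz)) => E; apply: HB.
    by rewrite -(row_mxKl (v *m B) ('d h (coord c z) v)) E linear0.
  by rewrite -lin1_mxE -(row_mxKr (v *m B) ('d h (coord c z) v)) E linear0.
have [U [G [[oU Uz UO opU] [sG GK]]]] := inverse_function oO Oz sp inj.
have sU : smooth U psi by exact: smooth_subset sp.
have ms : maximal_atlas (comp_chart c U psi).
  by apply: (comp_chart_maximal gX mc oU _ sU opU sG GK) => y /UO/Oc.
exists (comp_chart c U psi); split=> //.
- split=> //; apply/seteqP; split.
    move=> _ [x [[cx Ux] Zx] <-]; split; first by exists x.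
    rewrite /= psiE flat_rsubmx row_mxKr.
    by apply/(HZ x cx (UO _ Ux)).
  move=> _ [[x [cx Ux] <-]]; rewrite /= psiE flat_rsubmx row_mxKr => hx.
  exists x; rewrite ?psiE//; split=> //.
  by apply/(HZ x cx (UO _ Ux)).
- move=> v; have E1 := dcoord_comp_chart gX v mc ms oU sU cz Uz.
  have E2 := diff_eval (dcoord c z v) (Dpsi _ Oz).
  have key u (a : 'rV[R]_p) (b : 'rV[R]_q) : u = row_mx a b -> flat p u <-> b = 0.
    by move=> ->; rewrite flat_rsubmx row_mxKr.
  exact: key (etrans E1 E2).
Qed.

Lemma submanifold_of_equation n (X : smooth_space n) p q (Z : set X) :
  good_space X -> n = (p + q)%N ->
  (forall z, Z z -> exists c O (h : 'rV[R]_n -> 'rV[R]_q),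
     [/\ maximal_atlas c, dom c z & local_equation c Z z O h]) ->
  submanifold p Z.
Proof.
move=> gX En H; split; first by rewrite En leq_addr.
move=> z /H[c [A [h [mc cz Hh]]]].
by have [s [Hs sz _]] := slice_of_equation gX En mc cz Hh; exists s.
Qed.

Lemma tangent_of_equation n (X : smooth_space n) p q (c : chart X n) (Z : set X)
    (z : X) O (h : 'rV[R]_n -> 'rV[R]_q) (v : 'rV[R]_n) : good_space X ->
  n = (p + q)%N -> maximal_atlas c -> dom c z -> Z z -> local_equation c Z z O h ->
  tangent_sub p Z z v <-> 'd h (coord c z) (dcoord c z v) = 0.
Proof.
move=> gX En mc cz Zz Hh.
have [s [Hs sz Es]] := slice_of_equation gX En mc cz Hh.
split=> [[t [Ht tz ft]]|/Es fs]; last by exists s.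
by apply/Es; exact: (slice_tangent gX Ht Hs tz sz Zz ft).
Qed.

(** The last q coordinates of a slice chart at [z] serve. The same [O] and [h] are valid at all
    points near [z], which is needed to treat a whole piece of Lambda with one equation. *)
Lemma equation_of_submanifold n (X : smooth_space n) p q (c : chart X n) (Z : set X)
    (z : X) : good_space X -> n = (p + q)%N ->
  submanifold p Z -> Z z -> maximal_atlas c -> dom c z ->
  exists O (h : 'rV[R]_n -> 'rV[R]_q), O (coord c z) /\
    forall x, dom c x -> O (coord c x) -> local_equation c Z x O h.
Proof.
move=> gX En; subst n => -[_ HZ] Zz mc cz.
have [s [ms Hs] sz] := HZ z Zz.
have [chc _] := mc; have [chs _] := ms.
exists (overlap c s), (fun y => rsubmx (transition c s z y)); split.
  by exists z.
move=> x cx Ox; have sx : dom s x by move: Ox => [x' [cx' +]] /(chc.1 _ _ cx' cx) <-.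
split.
- split.
  + exact: overlap_open.
  + by exists x.
  + by move=> _ [x' [cx' _] <-]; exists x'.
  + apply: (@smooth_linear_comp _ _ _ _ _ (overlap c s) rsubmx).
      exact: overlap_open.
    exact: smooth_transitionP.
  + move=> w; pose u : 'rV[R]_(p + q) := row_mx 0 w.
    exists (dcoord c x ((dcoord s x)^-1%VF u)).
    have D := is_diff_comp (is_diff_smooth (smooth_transitionP gX z mc ms) Ox)
      (is_diff_linear rsubmx (transition c s z (coord c x))).
    apply: (etrans (diff_eval _ D)) => /=.
    apply: (etrans (congr1 rsubmx (transition_base gX z _ mc ms cx sx))).
    apply: (etrans (congr1 rsubmx (dcoord_transition gX _ mc ms cx sx))).
    by apply: (etrans (congr1 rsubmx (dcoordVK gX ms sx u))); exact: row_mxKr.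
- move=> y cy [x' [cx' sx'] /(chc.1 _ _ cx' cy) xx].
  rewrite xx in sx'; rewrite transitionE// -flat_rsubmx; split.
    move=> Zx; have : (coord s @` dom s `&` flat p) (coord s y).
      by rewrite -Hs; exists y.
    by case.
  move=> fx; have : (coord s @` (dom s `&` Z)) (coord s y).
    by rewrite Hs; split=> //; exists y.
  by move=> [w [sw Zw] /(chs.1 _ _ sw sx') <-].
Qed.

End Submanifolds.

(** * Cotangent charts and the symplectic form *)

Section Cotangent.
Context {R : realType}.
Local Notation chart := (chart R).
Local Notation smooth_space := (smooth_space R).

Lemma manifold_good n (M : manifold R n) : good_space M.
Proof.
have [_ _ H1 H2 H3] := manifoldP M; split=> //.
by move=> c /H2[].
Qed.

Definition dot n (u v : 'rV[R]_n) : R := \sum_j u 0 j * v 0 j.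

Lemma dotC n (u v : 'rV[R]_n) : dot u v = dot v u.
Proof. by apply: eq_bigr => j _; rewrite mulrC. Qed.

Lemma dot_linear n (u : 'rV[R]_n) : linear (dot u : 'rV[R]_n -> R^o).
Proof.
move=> a x y; rewrite /dot scaler_sumr -big_split; apply: eq_bigr => j _ /=.
by rewrite !mxE -[_ *: _]/(a * (u 0 j * x 0 j)); ring.
Qed.
HB.instance Definition _ n u := GRing.isLinear.Build R 'rV[R]_n R^o _ (dot u)
  (@dot_linear n u).

Lemma dot_delta n (u : 'rV[R]_n) j : dot u (delta_mx 0 j) = u 0 j.
Proof.
rewrite /dot (bigD1 j)//= mxE !eqxx mulr1 big1 ?addr0// => i /negbTE ij.
by rewrite mxE eqxx /= ij mulr0.
Qed.

Lemma dot_eq n (u v : 'rV[R]_n) : (forall w, dot u w = dot v w) -> u = v.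
Proof. by move=> H; apply/rowP => j; rewrite -!dot_delta H. Qed.

Lemma dot_mulmx n m (u : 'rV[R]_n) (A : 'M[R]_(m, n)) v :
  dot u (v *m A) = dot (u *m A^T) v.
Proof.
rewrite /dot; under eq_bigr do rewrite mxE mulr_sumr.
under [RHS]eq_bigr do rewrite mxE mulr_suml.
rewrite exchange_big; apply: eq_bigr => i _; apply: eq_bigr => j _.
by rewrite mxE; ring.
Qed.

Lemma is_diff_dot (V : normedModType R) n (f g df dg : V -> 'rV[R]_n) x :
  is_diff x f df -> is_diff x g dg ->
  is_diff x (fun y => dot (f y) (g y) : R^o) (fun v => dot (f x) (dg v) + dot (df v) (g x)).
Proof.
move=> Df Dg.
have coordD (h dh : V -> 'rV[R]_n) j : is_diff x h dh ->
    is_diff x (fun y => h y 0 j : R^o) (fun v => dh v 0 j).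
  move=> Dh; pose p (z : 'rV[R]_n) : R^o := z 0 j.
  have lp : linear p by move=> a y z; rewrite /p !mxE.
  pose L : {linear 'rV[R]_n -> R^o} := HB.pack p (GRing.isLinear.Build _ _ _ _ _ lp).
  exact: is_diff_comp Dh (is_diff_linear L (h x)).
have S (I : Type) (s : seq I) (F dF : I -> V -> R^o) :
    (forall i, is_diff x (F i) (dF i)) ->
    is_diff x (fun y => \sum_(i <- s) F i y : R^o) (fun v => \sum_(i <- s) dF i v).
  move=> H; elim: s => [|i s IH].
    under eq_fun do rewrite big_nil; under [X in is_diff_def _ _ X]eq_fun do rewrite big_nil.
    exact: is_diff_cst.
  under eq_fun do rewrite big_cons; under [X in is_diff_def _ _ X]eq_fun do rewrite big_cons.
  exact: is_diffD (H i) IH.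
have D j := is_diff_scale (coordD _ _ j Df) (coordD _ _ j Dg).
apply: (is_diff_eq (S _ (index_enum 'I_n) _ _ D)).
by apply/funext => v; rewrite /dot -big_split.
Qed.

Lemma smooth_row_mx (V : normedModType R) n m (U : set V) (f : V -> 'rV[R]_n)
    (g : V -> 'rV[R]_m) : open U -> smooth U f -> smooth U g ->
  smooth U (fun x => row_mx (f x) (g x)).
Proof.
move=> oU /smooth_coord-/(_ oU) sf /smooth_coord-/(_ oU) sg.
apply/smooth_coord => // i j; case: (splitP j) => l E.
  have -> : j = lshift m l by apply/val_inj.
  by under eq_fun do rewrite row_mxEl; exact: sf.
have -> : j = rshift n l by apply/val_inj.
by under eq_fun do rewrite row_mxEr; exact: sg.
Qed.

Lemma smooth_dot (V : normedModType R) n (U : set V) (f g : V -> 'rV[R]_n) : open U ->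
  smooth U f -> smooth U g -> smooth U (fun x => dot (f x) (g x)).
Proof.
move=> oU /smooth_coord-/(_ oU) sf /smooth_coord-/(_ oU) sg r.
by apply: Ck_sum => // j _; apply: CkM => //; [exact: sf|exact: sg].
Qed.

Definition symp n (u v : 'rV[R]_(n + n)) : R :=
  dot (rsubmx u) (lsubmx v) - dot (rsubmx v) (lsubmx u).

Lemma symplectic_formE n (X : smooth_space n) (z : cotangent X) u v :
  symplectic_form z u v = symp u v.
Proof. by rewrite /symplectic_form /symp /dot -sumrB. Qed.

Section GoodSpace.
Context {n : nat} {X : smooth_space n}.
Hypothesis gX : good_space X.
Implicit Types (c d : chart X n) (m x : X).

Definition mkcov (m : X) (zeta : 'Hom('rV[R]_n, R^o)) : cotangent X := (m, zeta).

Lemma cotangent_domE c (z : cotangent X) :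
  dom (cotangent_chart c : chart (cotangent X) (n + n)) z <-> dom c (z : cotangent_point X).1.
Proof. by []. Qed.

Definition cov_comp c (z : cotangent X) : 'rV[R]_n :=
  rsubmx (coord (cotangent_chart c : chart (cotangent X) (n + n)) z).

Lemma cotangent_coord c (z : cotangent X) :
  coord (cotangent_chart c : chart (cotangent X) (n + n)) z =
  row_mx (coord c (z : cotangent_point X).1) (cov_comp c z).
Proof. by rewrite /cov_comp /= row_mxKr. Qed.

Lemma cov_compE c (z : cotangent X) v : maximal_atlas c ->
  dom c (z : cotangent_point X).1 ->
  (z : cotangent_point X).2 v = dot (cov_comp c z) (dcoord c (z : cotangent_point X).1 v).
Proof.
case: z => m zeta mc /= cm.
rewrite -[in LHS](dcoordK gX mc cm v) [in LHS](row_sum_delta (dcoord c m v)).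
rewrite !linear_sum /=; apply: eq_bigr => j _.
rewrite !linearZ /= /cov_comp /= row_mxKr mxE mulrC.
by [].
Qed.

Lemma cov_comp_surj c (m : X) (w : 'rV[R]_n) : maximal_atlas c -> dom c m ->
  exists zeta, cov_comp c (mkcov m zeta) = w.
Proof.
move=> mc cm; pose L : {linear 'rV[R]_n -> R^o} := dot w.
exists (linfun L \o dcoord c m)%VF; apply/rowP => j.
by rewrite /cov_comp /= row_mxKr mxE /= comp_lfunE lfunE /= dcoordVK// dot_delta.
Qed.

Lemma cotangent_is_chart c : maximal_atlas c ->
  is_chart (cotangent_chart c : chart (cotangent X) (n + n)).
Proof.
move=> mc; have [[inj oc] _] := mc; split.
  move=> [x zeta] [y eta] /= cx cy /eq_row_mx[/(inj _ _ cx cy) xy E].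
  subst y; congr pair; apply/lfunP => v.
  rewrite (cov_compE (z := mkcov x zeta) v mc cx) (cov_compE (z := mkcov x eta) v mc cx).
  by rewrite /cov_comp /= !row_mxKr E.
have -> : coord (cotangent_chart c : chart (cotangent X) (n + n)) @`
    dom (cotangent_chart c : chart (cotangent X) (n + n)) =
    lsubmx @^-1` (coord c @` dom c).
  apply/seteqP; split=> [_ [z cz <-]|y [x cx E]].
    by rewrite /= row_mxKl; exists (z : cotangent_point X).1.
  have [zeta Ez] := cov_comp_surj (rsubmx y) mc cx.
  exists (mkcov x zeta) => //; rewrite cotangent_coord Ez /= E.
  exact: hsubmxK.
by apply: open_comp => // y _; exact: linear_mx_continuous.
Qed.

(* The coordinate change of the cotangent bundle induced by the coordinate change
   from [c] to [d]; the covector is transported by the inverse coordinate change. *)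
Definition cotangent_lift c d x0 (y : 'rV[R]_(n + n)) : 'rV[R]_(n + n) :=
  row_mx (transition c d x0 (lsubmx y))
    (\row_j dot (rsubmx y)
      ('d (transition d c x0) (transition c d x0 (lsubmx y)) (delta_mx 0 j))).

Lemma cotangent_liftE c d x0 (z : cotangent X) : maximal_atlas c -> maximal_atlas d ->
  dom c (z : cotangent_point X).1 -> dom d (z : cotangent_point X).1 ->
  cotangent_lift c d x0 (coord (cotangent_chart c : chart (cotangent X) (n + n)) z) =
  coord (cotangent_chart d : chart (cotangent X) (n + n)) z.
Proof.
move=> mc md cz dz; have [chc _] := mc.
apply: (etrans (congr1 (cotangent_lift c d x0) (cotangent_coord c z))).
apply: esym; apply: (etrans (cotangent_coord d z)); apply: esym.
rewrite /cotangent_lift row_mxKl row_mxKr transitionE//.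
congr row_mx; apply/rowP => j; rewrite mxE.
move: z cz dz => [m zeta] /= cm dm.
apply: (etrans (congr1 (dot _) (transition_base gX x0 _ md mc dm cm))).
have -> : cov_comp d (m, zeta) 0 j = zeta ((dcoord d m)^-1%VF (delta_mx 0 j)).
  by rewrite /cov_comp /= row_mxKr mxE.
apply: esym; apply: (etrans (cov_compE (z := mkcov m zeta) _ mc cm)).
congr (dot _ _); apply: (etrans (esym (dcoord_transition gX _ md mc dm cm))).
by apply: congr1; exact: dcoordVK.
Qed.

Lemma cotangent_overlap c d : maximal_atlas c -> maximal_atlas d ->
  overlap (cotangent_chart c : chart (cotangent X) (n + n)) (cotangent_chart d) =
  lsubmx @^-1` overlap c d.
Proof.
move=> mc md; apply/seteqP; split=> [_ [z [cz dz] <-]|y [x [cx dx] E]].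
  by rewrite /= row_mxKl; exists (z : cotangent_point X).1.
have [zeta Ez] := cov_comp_surj (rsubmx y) mc cx.
exists (mkcov x zeta) => //; rewrite cotangent_coord Ez /= E.
exact: hsubmxK.
Qed.

Lemma lsubmx_preimage_open q r (U : set 'rV[R]_q) :
  open U -> open ((lsubmx : 'rV[R]_(q + r) -> 'rV[R]_q) @^-1` U).
Proof. by move=> oU; apply: open_comp => // y _; exact: linear_mx_continuous. Qed.

Lemma smooth_lsubmx q r (A : set 'rV[R]_(q + r)) :
  smooth A (lsubmx : 'rV[R]_(q + r) -> 'rV[R]_q).
Proof. exact: (@smooth_linear _ _ _ _ A lsubmx). Qed.

Lemma smooth_rsubmx q r (A : set 'rV[R]_(q + r)) :
  smooth A (rsubmx : 'rV[R]_(q + r) -> 'rV[R]_r).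
Proof. exact: (@smooth_linear _ _ _ _ A rsubmx). Qed.

Lemma cotangent_lift_smooth c d x0 : maximal_atlas c -> maximal_atlas d ->
  smooth (lsubmx @^-1` overlap c d) (cotangent_lift c d x0).
Proof.
move=> mc md; have [chc _] := mc; have oU := overlap_open gX mc md.
have oV : open (lsubmx @^-1` overlap c d : set 'rV[R]_(n + n)).
  exact: lsubmx_preimage_open.
have sT : smooth (lsubmx @^-1` overlap c d : set 'rV[R]_(n + n))
    (fun y => transition c d x0 (lsubmx y)).
  by apply: (@smooth_comp _ _ _ _ _ (overlap c d)) => //;
    [exact: smooth_transitionP|exact: smooth_lsubmx].
apply: smooth_row_mx => //; apply/smooth_coord => // i j.
under eq_fun do rewrite mxE; apply: smooth_dot => //; first exact: smooth_rsubmx.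
apply: (@smooth_comp _ _ _ _ _ (overlap d c)
  (fun y => 'd (transition d c x0) y (delta_mx 0 j))
  (fun y => transition c d x0 (lsubmx y))) => //.
  by move=> y [x [cx dx] E]; rewrite -E transitionE//; exists x.
exact: smooth_diff (smooth_transitionP gX x0 md mc).
Qed.

Lemma cotangent_compatible c d : maximal_atlas c -> maximal_atlas d ->
  compatible (cotangent_chart c : chart (cotangent X) (n + n)) (cotangent_chart d).
Proof.
suff H c' d' : maximal_atlas c' -> maximal_atlas d' ->
    smooth_transition (cotangent_chart c' : chart (cotangent X) (n + n)) (cotangent_chart d').
  by move=> mc md; split; exact: H.
move=> mc md; have chc := cotangent_is_chart mc.
have E := cotangent_overlap mc md.
have oV : open (lsubmx @^-1` overlap c' d' : set 'rV[R]_(n + n)).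
  exact/lsubmx_preimage_open/(overlap_open gX mc md).
split=> [|z0 _]; first by rewrite -[X in open X]/(overlap _ _) E.
apply/smooth_onE; rewrite -[X in smooth X]/(overlap _ _) E.
apply: smooth_ext (cotangent_lift_smooth (z0 : cotangent_point X).1 mc md) => //.
rewrite -E => _ [z [cz dz] <-].
apply: (etrans (cotangent_liftE _ mc md cz dz)); apply: esym.
exact: (congr1 (@coord R (cotangent X) (n + n) (cotangent_chart d')) (chart_invK z0 chc cz)).
Qed.

Lemma cotangent_good : good_space (cotangent X).
Proof.
split.
- by move=> _ [c ac <-]; exact: cotangent_is_chart (atlas_maximal gX ac).
- move=> _ _ [c ac <-] [d ad <-].
  exact: cotangent_compatible (atlas_maximal gX ac) (atlas_maximal gX ad).
- move=> z; have [a az] := chart_atP gX (z : cotangent_point X).1.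
  by exists (cotangent_chart (chart_at (z : cotangent_point X).1)) => //;
    exists (chart_at (z : cotangent_point X).1).
Qed.

Lemma cotangent_maximal c : maximal_atlas c ->
  maximal_atlas (cotangent_chart c : chart (cotangent X) (n + n)).
Proof.
move=> mc; split; first exact: cotangent_is_chart.
by move=> _ [d ad <-]; exact: cotangent_compatible mc (atlas_maximal gX ad).
Qed.

(** Besides the transported covector, the differential of the lift has a term from the second
    derivative [H] of the inverse coordinate change. Paired with a base vector it contributes the
    covector applied to [H (A w') (A w)]; this is symmetric in w and w', and cancels in the
    alternating form. *)
Lemma cotangent_lift_symp c d x0 x (y u v : 'rV[R]_(n + n)) : maximal_atlas c ->
  maximal_atlas d -> dom c x -> dom d x -> lsubmx y = coord c x ->
  symp ('d (cotangent_lift c d x0) y u) ('d (cotangent_lift c d x0) y v) = symp u v.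
Proof.
move=> mc md cx dx yx; have [chc _] := mc.
pose phi := transition c d x0; pose psi := transition d c x0.
pose A (u : 'rV[R]_(n + n)) := 'd phi (coord c x) (lsubmx u).
pose H b e := 'd (fun y => 'd psi y e) (coord d x) b.
pose xi := rsubmx y.
have dpsi := smooth_transitionP gX x0 md mc.
have Ox : overlap d c (coord d x) by exists x.
have Hsym b e : H b e = H e b.
  exact: smooth_sym (overlap_open gX md mc) Ox dpsi.
have phix : phi (coord c x) = coord d x by rewrite /phi transitionE.
have psiA w : 'd psi (coord d x) (A w) = lsubmx w.
  apply: (etrans (transition_base gX x0 _ md mc dx cx)).
  apply: (etrans (congr1 _ (transition_base gX x0 _ mc md cx dx))).
  apply: (etrans (transition_chain gX _ mc md mc cx dx cx)).
  exact: transition_id.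
have oU := overlap_open gX mc md.
have Oy : (lsubmx @^-1` overlap c d) y by rewrite /= yx; exists x.
have DL := is_diff_smooth (cotangent_lift_smooth x0 mc md) Oy.
have Dphi : is_diff (lsubmx y) phi ('d phi (coord c x)).
  rewrite yx; apply: is_diff_smooth (smooth_transitionP gX x0 mc md) _.
  by exists x.
have Dls : is_diff y (lsubmx : 'rV[R]_(n + n) -> 'rV[R]_n) lsubmx.
  exact: (is_diff_linear lsubmx y).
have Dphil := is_diff_comp Dls Dphi.
have lsubE w : lsubmx ('d (cotangent_lift c d x0) y w) = A w.
  have D := is_diff_comp DL (is_diff_linear lsubmx (cotangent_lift c d x0 y)).
  have E : lsubmx \o cotangent_lift c d x0 = phi \o lsubmx.
    by apply/funext => z; rewrite /cotangent_lift /= row_mxKl.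
  rewrite E in D.
  exact: etrans (esym (diff_eval w D)) (diff_eval w Dphil).
have rsubE w j : rsubmx ('d (cotangent_lift c d x0) y w) 0 j =
    dot xi (H (A w) (delta_mx 0 j)) +
    dot (rsubmx w) ('d psi (coord d x) (delta_mx 0 j)).
  pose p (z : 'rV[R]_(n + n)) : R^o := rsubmx z 0 j.
  have lp : linear p by move=> a s t; rewrite /p !mxE.
  pose L : {linear 'rV[R]_(n + n) -> R^o} := HB.pack p (GRing.isLinear.Build _ _ _ _ _ lp).
  have D := is_diff_comp DL (is_diff_linear L (cotangent_lift c d x0 y)).
  have E : L \o cotangent_lift c d x0 =
      (fun z => dot (rsubmx z) ('d psi (phi (lsubmx z)) (delta_mx 0 j))).
    by apply/funext => z; rewrite /= /p /cotangent_lift row_mxKr mxE.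
  rewrite E in D.
  have Drs : is_diff y (rsubmx : 'rV[R]_(n + n) -> 'rV[R]_n) rsubmx.
    exact: (is_diff_linear rsubmx y).
  have Dps : is_diff ((phi \o lsubmx) y) (fun y => 'd psi y (delta_mx 0 j))
      (H ^~ (delta_mx 0 j)).
    rewrite /= yx phix; apply: is_diff_smooth Ox.
    exact: smooth_diff dpsi.
  have Dps2 := is_diff_comp Dphil Dps.
  have Dd := is_diff_dot Drs Dps2.
  have := etrans (esym (diff_eval w D)) (diff_eval w Dd).
  rewrite /= /p /xi => ->.
  have -> : phi (lsubmx y) = coord d x by rewrite yx.
  by [].
have key w w' : dot (rsubmx ('d (cotangent_lift c d x0) y w))
    (lsubmx ('d (cotangent_lift c d x0) y w')) =
    dot xi (H (A w') (A w)) + dot (rsubmx w) (lsubmx w').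
  have lin (L : {linear 'rV[R]_n -> R^o}) a : L a = \sum_j a 0 j * L (delta_mx 0 j).
    rewrite {1}(row_sum_delta a) linear_sum; apply: eq_bigr => j _.
    by rewrite linearZ.
  have E1 : dot xi (H (A w') (A w)) = \sum_j A w' 0 j * dot xi (H (A w) (delta_mx 0 j)).
    apply: (etrans (lin (dot xi \o 'd (fun y => 'd psi y (A w)) (coord d x)) (A w'))).
    by apply: eq_bigr => j _; congr (_ * dot _ _); exact: Hsym.
  have E2 : dot (rsubmx w) (lsubmx w') =
      \sum_j A w' 0 j * dot (rsubmx w) ('d psi (coord d x) (delta_mx 0 j)).
    apply: (etrans (congr1 (dot _) (esym (psiA w')))).
    exact: (lin (dot (rsubmx w) \o 'd psi (coord d x)) (A w')).
  rewrite E1 E2 lsubE -big_split /=; apply: eq_bigr => j _.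
  by rewrite rsubE mulrC mulrDr.
rewrite /symp !key Hsym opprD addrACA subrr add0r.
by [].
Qed.

(** Tangent vectors are given by components in the chart chosen at [z], which is the cotangent chart
    of some chart of the base; hence the form there is related to any other cotangent chart by a
    lift. *)
Lemma symp_cotangent_chart c (z : cotangent X) (u v : 'rV[R]_(n + n)) : maximal_atlas c ->
  dom c (z : cotangent_point X).1 ->
  symp (dcoord (cotangent_chart c : chart (cotangent X) (n + n)) z u)
       (dcoord (cotangent_chart c : chart (cotangent X) (n + n)) z v) = symp u v.
Proof.
move=> mc cz; have gC := cotangent_good.
have [[a aa Ea] az] := chart_atP gC z.
have ma := atlas_maximal gX aa.
have D w : dcoord (cotangent_chart c : chart (cotangent X) (n + n)) z w =
    'd (cotangent_lift a c (z : cotangent_point X).1)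
       (coord (cotangent_chart a : chart (cotangent X) (n + n)) z) w.
  apply: (etrans (dcoordE _ _ _)); rewrite -Ea.
  have az' : dom (cotangent_chart a : chart (cotangent X) (n + n)) z by rewrite Ea.
  have Oz : (lsubmx @^-1` overlap a c)
      (coord (cotangent_chart a : chart (cotangent X) (n + n)) z).
    by rewrite /= row_mxKl; exists (z : cotangent_point X).1.
  apply: (@diff_near_eval _ _ _ (cotangent_lift a c (z : cotangent_point X).1)); last first.
    exact: is_diff_smooth (cotangent_lift_smooth _ ma mc) Oz.
  have := near_overlap gC (cotangent_maximal ma) (cotangent_maximal mc) az' cz.
  apply: filterS => _ [z' [aw cw] <-].
  apply: (etrans (cotangent_liftE _ ma mc aw cw)); apply: esym.
  exact: transitionE (cotangent_is_chart ma) aw.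
rewrite !D.
have az' : dom a (z : cotangent_point X).1 by rewrite -cotangent_domE Ea.
apply: (@cotangent_lift_symp _ _ _ (z : cotangent_point X).1) => //.
by rewrite /= row_mxKl.
Qed.

End GoodSpace.
End Cotangent.

(** * Charts of submanifolds *)

Section SubSpace.
Context {R : realType}.
Local Notation chart := (chart R).
Local Notation smooth_space := (smooth_space R).

(** One [pid_mx p] truncates to the first p coordinates and the other pads with zeros; they identify
    flat vectors with R^p. *)
Lemma flat_pid n p (y : 'rV[R]_n) : (p <= n)%N ->
  flat p y -> y *m (pid_mx p : 'M[R]_(n, p)) *m (pid_mx p : 'M[R]_(p, n)) = y.
Proof.
move=> pn fy; rewrite -mulmxA mul_pid_mx !minnn; apply/rowP => j.
rewrite !mxE (bigD1 j)//= big1 ?addr0.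
  rewrite !mxE eqxx /=; case: ltnP => jp; first by rewrite mulr1.
  by rewrite mulr0 fy.
by move=> i ij; rewrite !mxE -val_eqE in ij *; rewrite (negbTE ij) mulr0.
Qed.

Lemma pid_flat n p (w : 'rV[R]_p) : flat p (w *m (pid_mx p : 'M[R]_(p, n))).
Proof.
move=> i pi; rewrite !mxE big1// => j _; rewrite !mxE.
case: eqP => [E|_]; last by rewrite mulr0.
by move: (ltn_ord j); rewrite E ltnNge pi.
Qed.

Lemma pid_pid n p (w : 'rV[R]_p) : (p <= n)%N ->
  w *m (pid_mx p : 'M[R]_(p, n)) *m (pid_mx p : 'M[R]_(n, p)) = w.
Proof.
by move=> pn; rewrite -mulmxA mul_pid_mx minnn (minn_idPr pn) pid_mx_1 mulmx1.
Qed.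

Section GoodSpace.
Context {n : nat} {X : smooth_space n} (p : nat) (Z : set X).
Hypotheses (gX : good_space X) (sZ : submanifold p Z).
Implicit Types (c d : chart X n).

Let pn : (p <= n)%N. Proof. by case: sZ. Qed.
Local Notation E := (pid_mx p : 'M[R]_(n, p)).
Local Notation Et := (pid_mx p : 'M[R]_(p, n)).
Local Notation sub := (subspace_chart p Z).

Lemma slice_flat c x : slice_chart p Z c -> Z x -> dom c x -> flat p (coord c x).
Proof.
move=> [_ Hc] Zx cx; have : (coord c @` dom c `&` flat p) (coord c x).
  by rewrite -Hc; exists x.
by case.
Qed.

Lemma slice_mem c x : slice_chart p Z c -> dom c x -> flat p (coord c x) -> Z x.
Proof.
move=> [[[inj _] _] Hc] cx fx; have : (coord c @` (dom c `&` Z)) (coord c x).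
  by rewrite Hc; split=> //; exists x.
by move=> [y [cy Zy] /(inj _ _ cy cx) <-].
Qed.

Definition mksub x (Zx : Z x) : sub_space p Z := exist _ x (mem_set Zx).

Lemma sub_mem (x : sub_space p Z) : Z (val x).
Proof. exact: set_mem (valP x). Qed.

Lemma sub_coordK c (x : sub_space p Z) : slice_chart p Z c -> dom c (val x) ->
  coord (sub c) x *m Et = coord c (val x).
Proof. by move=> sc cx; apply: flat_pid => //; apply: slice_flat => //; exact: sub_mem. Qed.

Lemma subspace_overlap c d : slice_chart p Z c -> slice_chart p Z d ->
  coord (sub c) @` (dom (sub c) `&` dom (sub d)) =
  (fun w => w *m Et) @^-1` overlap c d.
Proof.
move=> sc sd; apply/seteqP; split=> [_ [x [cx dx] <-]|w [x [cx dx] Ex]].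
  rewrite /= -[_ *m Et]/(coord (sub c) x *m Et) sub_coordK//.
  by exists (val x).
have Zx : Z x by apply: (slice_mem sc cx); rewrite Ex; exact: pid_flat.
exists (mksub Zx) => //.
by rewrite -[LHS]/(coord c x *m E) Ex pid_pid.
Qed.

Lemma continuous_mulmxr a b (A : 'M[R]_(a, b)) : continuous (fun w : 'rV[R]_a => w *m A).
Proof. exact: (linear_mx_continuous (L := mulmxr A)). Qed.

Lemma smooth_mulmxr a b (A : 'M[R]_(a, b)) U : smooth U (fun w : 'rV[R]_a => w *m A).
Proof. exact: (@smooth_linear _ _ _ _ U (mulmxr A)). Qed.

Lemma subspace_is_chart c : slice_chart p Z c -> is_chart (sub c).
Proof.
move=> sc; have [[[inj oc] _] _] := sc; split.
  move=> x y cx cy Exy; apply/val_inj; apply: inj => //.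
  by rewrite -!(sub_coordK sc)// Exy.
have := subspace_overlap sc sc; rewrite /overlap !setIid => ->.
by apply: open_comp => // w _; exact: continuous_mulmxr.
Qed.

Lemma subspace_smooth_transition c d : slice_chart p Z c -> slice_chart p Z d ->
  smooth_transition (sub c) (sub d).
Proof.
move=> sc sd; have O := subspace_overlap sc sd.
have [mc _] := sc; have [md _] := sd; have chc := subspace_is_chart sc.
have oU : open ((fun w : 'rV[R]_p => w *m Et) @^-1` overlap c d).
  apply: open_comp; last exact: overlap_open.
  by move=> w _; exact: continuous_mulmxr.
split=> [|x0 _]; first by rewrite O.
apply/smooth_onE; rewrite O.
apply: (@smooth_ext _ _ _ _ (fun w => transition c d (val x0) (w *m Et) *m E)) => //.
  rewrite -O => _ [x [cx dx] <-].
  rewrite (sub_coordK sc cx) chart_invK// transitionE//.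
  by case: mc.
apply: (@smooth_comp _ _ _ _ _ setT (fun y => y *m E)) => //.
  exact: smooth_mulmxr.
apply: (@smooth_comp _ _ _ _ _ (overlap c d) _ (fun w => w *m Et)) => //.
  exact: smooth_transitionP.
exact: smooth_mulmxr.
Qed.

Lemma sub_space_good : good_space (sub_space p Z).
Proof.
split.
- by move=> _ [c sc <-]; exact: subspace_is_chart.
- by move=> _ _ [c sc <-] [d sd <-]; split; exact: subspace_smooth_transition.
- move=> x; have [_ /(_ _ (sub_mem x))[c sc cx]] := sZ.
  by exists (sub c) => //; exists c.
Qed.

Lemma subspace_maximal c : slice_chart p Z c ->
  maximal_atlas (sub c : chart (sub_space p Z) p).
Proof. by move=> sc; apply: (atlas_maximal sub_space_good); exists c. Qed.

Lemma sub_incl_mdiff c (x : sub_space p Z) v : slice_chart p Z c -> dom c (val x) ->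
  dcoord c (val x) (mdiff (fun y : sub_space p Z => val y : X) x v) =
  dcoord (sub c : chart (sub_space p Z) p) x v *m Et.
Proof.
move=> sc cx; have [mc _] := sc.
have [|||_ H] := @mdiff_local_rep _ _ _ _ _ sub_space_good gX
  (fun y : sub_space p Z => val y : X) x (sub c) c (fun w => w *m Et) v
  (subspace_maximal sc) mc cx.
- by [].
- by move=> z cz; rewrite sub_coordK.
- exact: smooth_mulmxr.
exact: etrans H (diff_eval _ (is_diff_linear (mulmxr Et) _)).
Qed.

End GoodSpace.
End SubSpace.

(** * Charts of the dual of the vertical bundle *)

Section VerticalDual.
Context {R : realType}.
Local Notation chart := (chart R).
Local Notation smooth_space := (smooth_space R).

Lemma unitmx_of_injective n (A : 'M[R]_n) :
  (forall a : 'rV_n, a *m A = 0 -> a = 0) -> A \in unitmx.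
Proof.
move=> H; rewrite -row_free_unit -kermx_eq0; apply/eqP/row_matrixP => i.
by rewrite row0; apply: H; rewrite -row_mul mulmx_ker row0.
Qed.

Lemma dot_self_eq0 n (u : 'rV[R]_n) : dot u u = 0 -> u = 0.
Proof.
move=> /eqP; rewrite psumr_eq0 => [/allP H|i _]; last by rewrite -expr2 sqr_ge0.
apply/rowP => j; rewrite mxE; apply/eqP.
by have := H j (mem_index_enum _); rewrite /= mulf_eq0 orbb.
Qed.

(** If a E E^T = 0, then the vector a E has square norm zero. The Gram matrix gives a smooth formula
    for coefficients in a frame. *)
Lemma gram_unitmx q n (E : 'M[R]_(q, n)) :
  (forall a : 'rV_q, a *m E = 0 -> a = 0) -> E *m E^T \in unitmx.
Proof.
move=> H; apply: unitmx_of_injective => a aE; apply/H/dot_self_eq0.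
by rewrite dot_mulmx -mulmxA aE /dot big1// => i _; rewrite mxE mul0r.
Qed.

Lemma smooth_diff_apply (V W : normedModType R) a (U : set V) (O : set 'rV[R]_a)
    (f : 'rV[R]_a -> W) (g v : V -> 'rV[R]_a) : open U -> (forall x, U x -> O (g x)) ->
  smooth O f -> smooth U g -> smooth U v -> smooth U (fun x => 'd f (g x) (v x)).
Proof.
move=> oU UO sf sg /smooth_coord-/(_ oU) sv.
have -> : (fun x => 'd f (g x) (v x)) =
    (fun x => \sum_j v x 0 j *: 'd f (g x) (delta_mx 0 j)).
  apply/funext => x; rewrite {1}(row_sum_delta (v x)) linear_sum.
  by apply: eq_bigr => j _; rewrite linearZ.
move=> r; apply: Ck_sum => // j _; apply: CkZ => //; first exact: sv.
apply: (@smooth_comp _ _ _ _ _ O (fun y => 'd f y (delta_mx 0 j))) => //.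
exact: smooth_diff.
Qed.

Context {n k : nat} {M : smooth_space n} {B : smooth_space k} (pi : M -> B).
Hypothesis gM : good_space M.
Implicit Types (c d : chart M n) (m : M) (e f : M -> 'I_(n - k) -> 'rV[R]_n).

Lemma frame_span c e m v : vertical_frame pi c e -> dom c m -> v \in vertical pi m ->
  exists a : 'rV[R]_(n - k), v = \sum_i a 0 i *: e m i.
Proof.
move=> [H _] cm vm; have := H m cm; pose X := [tuple e m i | i < n - k].
have -> : codom (e m) = X by [].
move=> bX; exists (\row_i vector.coord X i v).
rewrite {1}(coord_basis bX vm); apply: eq_bigr => i _.
by rewrite mxE -tnth_nth tnth_mktuple.
Qed.

Lemma frame_mem c e m i : vertical_frame pi c e -> dom c m -> e m i \in vertical pi m.
Proof.
move=> [H _] cm; have /andP[/eqP <- _] := H m cm.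
by apply/memv_span/codom_f.
Qed.

Lemma frame_free c e m (a : 'rV[R]_(n - k)) : vertical_frame pi c e -> dom c m ->
  \sum_i a 0 i *: e m i = 0 -> a = 0.
Proof.
move=> [H _] cm; have := H m cm; pose X := [tuple e m i | i < n - k].
have -> : codom (e m) = X by [].
move=> /basis_free/freeP fX E; apply/rowP => i; rewrite mxE; apply: fX.
by rewrite -[RHS]E; apply: eq_bigr => j _; rewrite -tnth_nth tnth_mktuple.
Qed.

Definition vdual_comp e (w : vdual_point pi) : 'rV[R]_(n - k) :=
  \row_i tagged w (vsproj (vertical pi (tag w)) (e (tag w) i)).

Lemma vdual_coord c e (w : vdual pi) :
  coord (vdual_chart pi c e : chart (vdual pi) _) w =
  row_mx (coord c (tag (w : vdual_point pi))) (vdual_comp e w).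
Proof. by []. Qed.

Lemma vdual_compE c e (w : vdual_point pi) (a : 'rV[R]_(n - k)) :
  vertical_frame pi c e -> dom c (tag w) ->
  tagged w (vsproj _ (\sum_i a 0 i *: e (tag w) i)) = dot a (vdual_comp e w).
Proof.
move=> Hf cm; rewrite !linear_sum; apply: eq_bigr => i _.
by rewrite !linearZ mxE.
Qed.

Lemma vdual_comp_surj c e m (b : 'rV[R]_(n - k)) : vertical_frame pi c e -> dom c m ->
  exists eta, vdual_comp e (vdual_of (pi := pi) (m := m) eta) = b.
Proof.
move=> Hf cm; have [/(_ m cm) bX _] := Hf; move: bX.
pose X := [tuple e m i | i < n - k].
have -> : codom (e m) = X by [].
move=> bX; pose g (u : subvs_of (vertical pi m)) : R^o :=
  \sum_i vector.coord X i (vsval u) * b 0 i.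
have lg : linear g.
  move=> a u v; rewrite /g scaler_sumr -big_split; apply: eq_bigr => i _ /=.
  by rewrite linearD linearZ mulrDl -[_ *: (_ * _)]/(_ * (_ * _)) mulrA.
pose L : {linear _ -> R^o} := HB.pack g (GRing.isLinear.Build _ _ _ _ _ lg).
exists (linfun L); apply/rowP => j; rewrite mxE.
apply: (etrans (lfunE L _)); rewrite /= /g.
rewrite vsprojK; last exact: frame_mem Hf cm.
have -> : e m j = X`_j by rewrite -tnth_nth tnth_mktuple.
rewrite (bigD1 j)//= big1 ?addr0 => [|i ij].
  by rewrite coord_free ?(basis_free bX)// eqxx mul1r.
by rewrite coord_free ?(basis_free bX)// eq_sym (negbTE ij) mul0r.
Qed.

Lemma vdual_is_chart c e : maximal_atlas c -> vertical_frame pi c e ->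
  is_chart (vdual_chart pi c e : chart (vdual pi) _).
Proof.
move=> [[inj oc] _] Hf; split.
  move=> [x zeta] [y eta] /= cx cy /eq_row_mx[/(inj _ _ cx cy) xy].
  subst y => E; congr existT; apply/lfunP => u.
  have [a Ea] := frame_span Hf cx (subvsP u).
  have Eu : u = vsproj (vertical pi x) (\sum_i a 0 i *: e x i).
    by rewrite -Ea vsvalK.
  rewrite Eu.
  rewrite (vdual_compE (w := existT _ x zeta) a Hf cx).
  by rewrite (vdual_compE (w := existT _ x eta) a Hf cx); congr dot.
have -> : coord (vdual_chart pi c e : chart (vdual pi) _) @`
    dom (vdual_chart pi c e : chart (vdual pi) _) = lsubmx @^-1` (coord c @` dom c).
  apply/seteqP; split=> [_ [w cw <-]|y [x cx E]].
    by rewrite /= row_mxKl; exists (tag (w : vdual_point pi)).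
  have [eta Ee] := vdual_comp_surj (rsubmx y) Hf cx.
  by exists (vdual_of eta) => //; rewrite vdual_coord Ee /= E hsubmxK.
exact: lsubmx_preimage_open.
Qed.

Lemma vdual_overlap c d e f : maximal_atlas c -> vertical_frame pi c e ->
  coord (vdual_chart pi c e : chart (vdual pi) _) @`
    (dom (vdual_chart pi c e : chart (vdual pi) _) `&` dom (vdual_chart pi d f)) =
  lsubmx @^-1` overlap c d.
Proof.
move=> mc Hf; apply/seteqP; split=> [_ [w [cw dw] <-]|y [x [cx dx] E]].
  by rewrite /= row_mxKl; exists (tag (w : vdual_point pi)).
have [eta Ee] := vdual_comp_surj (rsubmx y) Hf cx.
by exists (vdual_of eta) => //; rewrite vdual_coord Ee /= E hsubmxK.
Qed.

Definition frame_mx c e m : 'M[R]_(n - k, n) := \matrix_(i, j) dcoord c m (e m i) 0 j.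

Lemma mul_frame_mx c e m (a : 'rV[R]_(n - k)) :
  a *m frame_mx c e m = dcoord c m (\sum_i a 0 i *: e m i).
Proof.
rewrite linear_sum; apply/rowP => j; rewrite mxE summxE; apply: eq_bigr => i _.
by rewrite linearZ !mxE.
Qed.

Lemma frame_mx_injective c e m (a : 'rV[R]_(n - k)) : maximal_atlas c ->
  vertical_frame pi c e -> dom c m -> a *m frame_mx c e m = 0 -> a = 0.
Proof.
move=> mc Hf cm; rewrite mul_frame_mx => E; apply: (frame_free Hf cm).
by apply: (can_inj (dcoordK gM mc cm)); rewrite E linear0.
Qed.

(** With E and F the matrices of the two frames, F E^T (E E^T)^-1 solves F = A E when a solution
    exists. This explicit expression is visibly smooth in the frames. *)
Definition frame_change c e f m : 'M[R]_(n - k) :=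
  frame_mx c f m *m (frame_mx c e m)^T *m
    invmx (frame_mx c e m *m (frame_mx c e m)^T).

Lemma frame_changeE c d e f m i : maximal_atlas c -> vertical_frame pi c e ->
  vertical_frame pi d f -> dom c m -> dom d m ->
  f m i = \sum_l frame_change c e f m i l *: e m l.
Proof.
move=> mc He Hf cm dm.
have H j : exists a : 'rV[R]_(n - k), f m j = \sum_i a 0 i *: e m i.
  by apply: (frame_span He cm); exact: frame_mem Hf dm.
have [A HA] := choice H; pose A0 := \matrix_(i, l) A i 0 l.
have E : frame_mx c f m = A0 *m frame_mx c e m.
  apply/row_matrixP => j; rewrite row_mul mul_frame_mx.
  have -> : \sum_i (row j A0) 0 i *: e m i = f m j.
    by rewrite HA; apply: eq_bigr => l _; rewrite !mxE.
  by apply/rowP => l; rewrite !mxE.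
have U : frame_mx c e m *m (frame_mx c e m)^T \in unitmx.
  by apply: gram_unitmx => a; exact: frame_mx_injective.
rewrite /frame_change E -!mulmxA (mulmxA (frame_mx c e m)) mulmxV// mulmx1 HA.
by apply: eq_bigr => l _; rewrite mxE.
Qed.

Lemma vdual_comp_change c d e f (w : vdual_point pi) : maximal_atlas c ->
  vertical_frame pi c e -> vertical_frame pi d f -> dom c (tag w) -> dom d (tag w) ->
  vdual_comp f w = vdual_comp e w *m (frame_change c e f (tag w))^T.
Proof.
move=> mc He Hf cw dw; apply/rowP => i; rewrite mxE (frame_changeE i mc He Hf cw dw).
have -> : \sum_l frame_change c e f (tag w) i l *: e (tag w) l =
    \sum_l (row i (frame_change c e f (tag w))) 0 l *: e (tag w) l.
  by apply: eq_bigr => l _; rewrite [in RHS]mxE.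
rewrite (vdual_compE _ He cw) [RHS]mxE dotC; apply: eq_bigr => l _.
by congr (_ * _); rewrite [LHS]mxE [RHS]mxE.
Qed.

Lemma frame_mx_smooth c e x0 : maximal_atlas c -> vertical_frame pi c e ->
  smooth (coord c @` dom c) (fun y => frame_mx c e (chart_inv c x0 y)).
Proof.
move=> mc [_ He]; have [chc _] := mc; have [_ oc] := chc.
apply/smooth_coord => // i j; under eq_fun do rewrite mxE.
have H : smooth (coord c @` dom c) (fun y => dcoord c (chart_inv c x0 y) (e (chart_inv c x0 y) i)).
  apply: smooth_local => _ [x cx <-]; exists (coord c @` dom c); split=> //.
  have /smooth_onE := He i x cx; apply: smooth_ext => // _ [z cz <-] /=.
  by rewrite !chart_invK.
by have /smooth_coord := H; move=> /(_ oc)/(_ 0 j).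
Qed.

(** The frame [f] is known to be smooth in its own chart [d]; its components in [c] are obtained by
    applying the differential of the transition from [d] to [c]. *)
Lemma frame_mx_change_smooth c d f x0 : maximal_atlas c -> maximal_atlas d ->
  vertical_frame pi d f ->
  smooth (overlap c d) (fun y => frame_mx c f (chart_inv c x0 y)).
Proof.
move=> mc md Hf; have [chc _] := mc; have [chd _] := md.
have oU := overlap_open gM mc md.
have sT := smooth_transitionP gM x0 mc md.
apply/smooth_coord => // i j.
pose F y : 'rV[R]_n := 'd (transition d c x0) (transition c d x0 y)
  (row i (frame_mx d f (chart_inv d x0 (transition c d x0 y)))).
have sF : smooth (overlap c d) F.
  apply: (@smooth_diff_apply _ _ _ _ (overlap d c)) => //.
  - by move=> _ [x [cx dx] <-]; rewrite transitionE//; exists x.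
  - exact: smooth_transitionP.
  - apply: (@smooth_comp _ _ _ _ _ (coord d @` dom d)
      (fun y => row i (frame_mx d f (chart_inv d x0 y))) (transition c d x0)) => //.
      by move=> _ [x [cx dx] <-]; rewrite transitionE//; exists x.
    apply: (@smooth_linear_comp _ _ _ _ _ _ (row i)); first by case: chd.
    exact: frame_mx_smooth.
have sFj : smooth (overlap c d) (fun y => F y 0 j).
  by have /smooth_coord := sF; move=> /(_ oU)/(_ 0 j).
apply: smooth_ext sFj => // _ [x [cx dx] <-].
rewrite mxE chart_invK// /F transitionE// chart_invK//.
have -> : row i (frame_mx d f x) = dcoord d x (f x i).
  by apply/rowP => l; rewrite !mxE.
congr (fun_of_matrix _ 0 j).
apply: (etrans (transition_base gM x0 _ md mc dx cx)).
exact: dcoord_transition.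
Qed.

Lemma vdual_smooth_transition c d e f : maximal_atlas c -> maximal_atlas d ->
  vertical_frame pi c e -> vertical_frame pi d f ->
  smooth_transition (vdual_chart pi c e : chart (vdual pi) _) (vdual_chart pi d f).
Proof.
move=> mc md He Hf; have chC := vdual_is_chart mc He.
have E := vdual_overlap d f mc He; have [chc _] := mc.
have oU := overlap_open gM mc md.
have oV := lsubmx_preimage_open (r := n - k) oU.
split=> [|w0 _]; first by rewrite E.
apply/smooth_onE; rewrite E; pose x0 := tag (w0 : vdual_point pi).
pose G y : 'rV[R]_(n + (n - k)) := row_mx (transition c d x0 (lsubmx y))
  (rsubmx y *m (frame_change c e f (chart_inv c x0 (lsubmx y)))^T).
have sG : smooth (lsubmx @^-1` overlap c d) G.
  apply: smooth_row_mx => //.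
    by apply: (@smooth_comp _ _ _ _ _ (overlap c d)) => //;
      [exact: smooth_transitionP|exact: smooth_lsubmx].
  move=> r; apply: Ck_mulmx => //; first exact: smooth_rsubmx.
  have oc : overlap c d `<=` coord c @` dom c by move=> _ [x [cx _] <-]; exists x.
  have s1 := smooth_subset oc (frame_mx_smooth x0 mc He).
  have s2 := frame_mx_change_smooth x0 mc md Hf.
  apply: (@Ck_comp _ _ _ _ r _ (overlap c d)
    (fun y => (frame_change c e f (chart_inv c x0 y))^T) lsubmx) => //; last exact: smooth_lsubmx.
  apply: Ck_trmx => //; apply: Ck_mulmx => //.
    by apply: Ck_mulmx; [|exact: s2|apply: Ck_trmx; [|exact: s1]].
  apply: Ck_invmx => //.
    move=> _ [x [cx dx] <-]; rewrite chart_invK//; apply: gram_unitmx => a.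
    exact: frame_mx_injective.
  by apply: Ck_mulmx; [|exact: s1|apply: Ck_trmx; [|exact: s1]].
apply: smooth_ext sG => //.
rewrite -E => _ [w [cw dw] <-].
apply: esym.
apply: (etrans (congr1 (@coord R (vdual pi) _ (vdual_chart pi d f))
  (chart_invK w0 chC cw))).
apply: (etrans (vdual_coord d f w)).
rewrite /G vdual_coord row_mxKl row_mxKr transitionE// chart_invK//.
congr row_mx.
exact: vdual_comp_change mc He Hf cw dw.
Qed.

Lemma vdual_good : (forall x, exists c e, [/\ maximal_atlas c, vertical_frame pi c e & dom c x]) ->
  good_space (vdual pi).
Proof.
move=> H; split.
- by move=> _ [c [e [mc He ->]]]; exact: vdual_is_chart.
- move=> _ _ [c [e [mc He ->]]] [d [f [md Hf ->]]].
  by split; exact: vdual_smooth_transition.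
- move=> w; have [c [e [mc He cw]]] := H (tag (w : vdual_point pi)).
  by exists (vdual_chart pi c e) => //; exists c, e.
Qed.

End VerticalDual.

(** * Images of zero sets under injective differentials *)

Section ImmersedImage.
Context {R : realType}.

Lemma is_diff_mulmxr (V : normedModType R) a b (f df : V -> 'rV[R]_a) (A : 'M[R]_(a, b)) x :
  is_diff x f df -> is_diff x (fun y => f y *m A) (fun v => df v *m A).
Proof. by move=> D; exact: is_diff_comp D (is_diff_linear (mulmxr A) (f x)). Qed.

Lemma is_diff_row_mx (V : normedModType R) a b (f df : V -> 'rV[R]_a)
    (g dg : V -> 'rV[R]_b) x : is_diff x f df -> is_diff x g dg ->
  is_diff x (fun y => row_mx (f y) (g y)) (fun v => row_mx (df v) (dg v)).
Proof.
move=> Df Dg.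
have E (u : 'rV[R]_a) (w : 'rV[R]_b) :
    u *m row_mx 1%:M 0 + w *m row_mx 0 1%:M = row_mx u w.
  by rewrite !mul_mx_row !mulmx0 !mulmx1 add_row_mx addr0 add0r.
have D := is_diffD (is_diff_mulmxr (row_mx 1%:M 0) Df) (is_diff_mulmxr (row_mx 0 1%:M) Dg).
have E1 : (fun y => f y *m row_mx 1%:M 0) + (fun y => g y *m row_mx 0 1%:M) =
    (fun y => row_mx (f y) (g y)) by apply/funext => y; exact: E.
have E2 : (fun y => df y *m row_mx 1%:M 0) + (fun y => dg y *m row_mx 0 1%:M) =
    (fun y => row_mx (df y) (dg y)) by apply/funext => y; exact: E.
by rewrite -E1 -E2.
Qed.

Lemma is_diff_fun_id a (x : 'rV[R]_a) : is_diff x (fun y : 'rV[R]_a => y) (fun v => v).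
Proof. exact: is_diff_id. Qed.

(** If the rows of [K] form a basis of the kernel of [J], those of [K *m Rho] are independent, and
    [P] is a right inverse of that product. Then [Rho *m P] gives linear coordinates on the kernel
    that factor through [Rho]. *)
Lemma kernel_projection N m p q (J : 'M[R]_(N, q)) (Rho : 'M[R]_(N, m)) :
  N = (p + q)%N -> \rank J = q ->
  (forall v : 'rV_N, v *m J = 0 -> v *m Rho = 0 -> v = 0) ->
  exists P : 'M[R]_(m, p), \rank P = p /\
    forall v : 'rV_N, v *m J = 0 -> v *m (Rho *m P) = 0 -> v = 0.
Proof.
move=> EN rJ inj.
have rK : \rank (kermx J) = p by rewrite mxrank_ker rJ EN addnK.
pose K := castmx (rK, erefl N) (row_base (kermx J)).
have eK : (K :=: kermx J)%MS by apply: eqmx_trans (eqmx_cast _ _) (eq_row_base _).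
have KJ : K *m J = 0 by apply/sub_kermxP; rewrite eK.
have fK : row_free K by rewrite /row_free eK rK.
have /row_freeP[P KP] : row_free (K *m Rho).
  rewrite -kermx_eq0; apply/eqP/row_matrixP => i; rewrite row0.
  have E : row i (kermx (K *m Rho)) *m K = 0.
    by apply: inj; rewrite -!mulmxA ?KJ ?mulmx0// -row_mul mulmx_ker row0.
  have /row_freeP[L KL] := fK.
  by rewrite -[LHS]mulmx1 -KL mulmxA E mul0mx.
exists P; split.
  apply/eqP; rewrite eqn_leq rank_leq_col /=.
  by rewrite -[X in (X <= _)%N](mxrank1 R p) -KP mxrankM_maxr.
move=> v vJ vP; have /submxP[a va] : (v <= K)%MS by rewrite eK; exact/sub_kermxP.
by move: vP; rewrite va mulmxA -(mulmxA a) -(mulmxA a) KP mulmx1 => ->; rewrite mul0mx.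
Qed.

(* With [P] chosen so that [z |-> (z Rho P, h z)] is a local diffeomorphism, the
   zero set of [h] is parametrized by [f y], [y P] being the parameter, and its
   image under [Rho] is the graph [y = f y Rho]. *)
Lemma immersed_image N m p q m' (O : set 'rV[R]_N) (h : 'rV[R]_N -> 'rV[R]_q) z0
    (Rho : 'M[R]_(N, m)) : N = (p + q)%N -> m = (m' + p)%N ->
  open O -> O z0 -> smooth O h ->
  (forall w, exists v, 'd h z0 v = w) ->
  (forall v, 'd h z0 v = 0 -> v *m Rho = 0 -> v = 0) ->
  exists (U : set 'rV[R]_N) (V : set 'rV[R]_m) (g : 'rV[R]_m -> 'rV[R]_m')
    (f : 'rV[R]_m -> 'rV[R]_N),
  [/\ open U, U z0, U `<=` O, open V & smooth V g] /\
  [/\ (forall y, V y -> forall w, exists v, 'd g y v = w),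
      (forall y, V y -> {for y, continuous f}),
      (forall z, U z -> h z = 0 -> [/\ V (z *m Rho), g (z *m Rho) = 0 & f (z *m Rho) = z]),
      (forall y, V y -> g y = 0 -> [/\ U (f y), h (f y) = 0 & f y *m Rho = y]) &
      (forall z, U z -> h z = 0 -> forall w, 'd g (z *m Rho) w = 0 <->
         exists2 v, 'd h z v = 0 & w = v *m Rho)].
Proof.
move=> EN Em oO Oz sh surj inj; subst N m.
have rJ : \rank (lin1_mx ('d h z0)) = q.
  by apply: surjective_rank => w; have [v <-] := surj w; exists v; rewrite lin1_mxE.
have [|P [rP HP]] := @kernel_projection _ _ p q (lin1_mx ('d h z0)) Rho erefl rJ.
  by move=> v; rewrite -lin1_mxE; exact: inj.
have [Q HQ] := complement_mx (erefl (m' + p)%N) rP.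
pose G z : 'rV[R]_(p + q) := row_mx (z *m (Rho *m P)) (h z).
have DG z : O z -> is_diff z G (fun v => row_mx (v *m (Rho *m P)) ('d h z v)).
  move=> Oz'; apply: is_diff_row_mx; last exact: is_diff_smooth sh Oz'.
  exact: (is_diff_mulmxr (Rho *m P) (is_diff_fun_id z)).
have sG : smooth O G by apply: smooth_row_mx => //; exact: smooth_mulmxr.
have injG v : 'd G z0 v = 0 -> v = 0.
  move=> E; have := etrans (esym (diff_eval v (DG _ Oz))) E.
  rewrite -[0 in RHS]row_mx0 => /eq_row_mx[E1 E2].
  by apply: HP E1; rewrite -lin1_mxE.
have [U [K [[oU Uz UO oGU] [sK GK]]]] := inverse_function oO Oz sG injG.
pose emb (y : 'rV[R]_(m' + p)) : 'rV[R]_(p + q) := y *m row_mx P 0.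
have embE y : emb y = row_mx (y *m P) 0 by rewrite /emb mul_mx_row mulmx0.
pose V := emb @^-1` (G @` U).
pose f y := K (emb y).
pose g y := (y - f y *m Rho) *m Q.
have oV : open V.
  by apply: open_comp => // y _; exact: continuous_mulmxr.
have fP y : V y -> [/\ U (f y), h (f y) = 0 & f y *m (Rho *m P) = y *m P].
  move=> [z Uz' Ez]; rewrite /f -Ez GK//.
  by move: Ez; rewrite /G embE => /eq_row_mx[].
have HU z : U z -> h z = 0 -> V (z *m Rho) /\ f (z *m Rho) = z.
  move=> Uz' hz; have E : G z = emb (z *m Rho) by rewrite /G embE hz mulmxA.
  by split; [exists z|rewrite /f -E GK].
have sf : smooth V f.
  apply: (@smooth_comp _ _ _ _ _ (G @` U)) => //; exact: smooth_mulmxr.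
have Df y : V y -> is_diff y f ('d f y) by exact: is_diff_smooth sf.
have Dg y : V y -> is_diff y g (fun w => (w - 'd f y w *m Rho) *m Q).
  move=> Vy; apply: (is_diff_mulmxr Q (f := fun y => y - f y *m Rho)
    (df := fun w => w - 'd f y w *m Rho)).
  exact: is_diffB (is_diff_fun_id y) (is_diff_mulmxr Rho (Df y Vy)).
have sg : smooth V g.
  apply: (@smooth_ext _ _ _ _ (fun y => y *m Q + f y *m (- (Rho *m Q)))) => //.
    by move=> y _; rewrite /g mulmxBl mulmxN mulmxA.
  move=> r; apply: CkD => //; first exact: smooth_mulmxr.
  apply: (@smooth_comp _ _ _ _ _ setT (fun z => z *m (- (Rho *m Q))) f) => //.
  exact: smooth_mulmxr.
have dfE y w : V y -> 'd f y w = 'd K (emb y) (emb w).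
  move=> Vy; have DK : is_diff (emb y) K ('d K (emb y)) by exact: is_diff_smooth sK Vy.
  exact: diff_eval (is_diff_comp (is_diff_mulmxr (row_mx P 0) (is_diff_fun_id y)) DK).
exists U, V, g, f; split; split=> //.
- move=> y Vy w.
  have uQP : row_mx Q P \in unitmx.
    apply: unitmx_of_injective => a; rewrite mul_mx_row => E.
    by move: E; rewrite -[in RHS]row_mx0 => /eq_row_mx[E1 E2]; exact: HQ.
  (* With [u *m P] zero the parameter does not move, so neither does [f] to first order, and the
     differential of [g] along [u] is [u *m Q], that is, w. *)
  pose u := row_mx w 0 *m invmx (row_mx Q P).
  have : u *m row_mx Q P = row_mx w 0 by rewrite mulmxKV.
  rewrite mul_mx_row => /eq_row_mx[uQ uP].
  exists u; apply: (etrans (diff_eval u (Dg y Vy))).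
  have -> : 'd f y u = 0.
    by apply: (etrans (dfE y u Vy)); rewrite (embE u) uP row_mx0 linear0.
  by rewrite mul0mx subr0.
- by move=> y Vy; exact: smooth_continuous sf Vy.
- by move=> z Uz' hz; have [Vz fz] := HU z Uz' hz; split=> //;
    rewrite /g fz subrr mul0mx.
- move=> y Vy gy; have [Uf hf fRP] := fP y Vy; split=> //.
  apply/esym/eqP; rewrite -subr_eq0; apply/eqP/HQ => //.
  by rewrite mulmxBl -mulmxA fRP subrr.
- move=> z Uz' hz w; have [Vz fz] := HU z Uz' hz.
  have Dgz := diff_eval w (Dg _ Vz).
  have Dh : is_diff (f (z *m Rho)) h ('d h z).
    by rewrite fz; apply: is_diff_smooth sh (UO _ Uz').
  have Vnear : \forall y \near z *m Rho, V y by apply: open_nbhs_nbhs.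
  (* The preimage of w is its image under the differential of [f]: h f = 0 puts it in the kernel,
     and f y Rho P = y P together with the vanishing of the differential of [g] identifies its image
     under [Rho]. *)
  split=> [dg0|[v dh0 ->]].
    exists ('d f (z *m Rho) w).
      have D := is_diff_comp (Df _ Vz) Dh.
      have N : {near z *m Rho, h \o f =1 cst 0}.
        by move: Vnear; apply: filterS => y /fP[].
      exact: etrans (esym (diff_near_eval w N D))
        (diff_eval w (is_diff_cst (0 : 'rV[R]_q) (z *m Rho))).
    apply/eqP; rewrite -subr_eq0; apply/eqP/HQ; first by rewrite -Dgz.
    have D1 := is_diff_mulmxr (Rho *m P) (Df _ Vz).
    have D2 := is_diff_mulmxr P (is_diff_fun_id (z *m Rho)).
    have N : {near z *m Rho, (fun y => f y *m (Rho *m P)) =1 (fun y => y *m P)}.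
      by move: Vnear; apply: filterS => y /fP[].
    have E := etrans (esym (diff_near_eval w N D1)) (diff_eval w D2).
    by rewrite mulmxBl -mulmxA E subrr.
  apply: (etrans (diff_eval _ (Dg _ Vz))).
  (* On the kernel of the differential of [h], that of [G] is v |-> (v Rho P, 0), the embedding of v
     Rho; the inverse [K] of [G] sends it back to v. *)
  suff -> : 'd f (z *m Rho) (v *m Rho) = v by rewrite subrr mul0mx.
  apply: (etrans (dfE _ _ Vz)).
  have Gz : G z = emb (z *m Rho) by rewrite /G embE hz mulmxA.
  have DK : is_diff (G z) K ('d K (G z)) by apply: is_diff_smooth sK _; exists z.
  have D := is_diff_comp (DG z (UO _ Uz')) DK.
  have N : {near z, K \o G =1 id}.
    have : \forall x \near z, U x by apply: open_nbhs_nbhs.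
    by apply: filterS => x /GK.
  have := etrans (esym (diff_near_eval v N D)) (diff_eval v (is_diff_id z)).
  by rewrite /= dh0 -Gz embE mulmxA.
Qed.

End ImmersedImage.

(** * Countable covers *)

Section Lindelof.
Context {R : realType}.
Local Notation chart := (chart R).
Local Notation smooth_space := (smooth_space R).

Lemma rational_ball N (O : set 'rV[R]_N) y : open O -> O y ->
  exists (q : 'rV[rat]_N) (j : nat),
    `|y - map_mx ratr q| < j.+1%:R^-1 /\
    forall z, `|z - map_mx ratr q| < j.+1%:R^-1 -> O z.
Proof.
move=> oO Oy.
have /nbhs_closed_ball[e e0 He] : \forall z \near y, O z by apply: open_nbhs_nbhs.
have e20 : 0 < e / 2 by rewrite divr_gt0.
(* The radius [d] is below e/2 and the rational center within d/2 of y, so the points of the ball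
   are at distance less than d + d/2 < e from y. *)
pose j := Num.truncn (e / 2)^-1; pose d : R := j.+1%:R^-1.
have d0 : 0 < d by rewrite invr_gt0.
have de : d < e / 2.
  rewrite /d -[X in _ < X]invrK ltf_pV2 ?posrE ?invr_gt0//.
  by rewrite /j truncnS_gt// ?invr_ge0 ltW// .
have H i : exists q : rat, `|y 0 i - ratr q| < d / 2.
  have /rat_in_itvoo[q] : y 0 i - d / 2 < y 0 i + d / 2 by lra.
  by rewrite in_itv/= => /andP[q1 q2]; exists q; rewrite ltr_norml; apply/andP; split; lra.
have [q Hq] := choice H; exists (\row_i q i), j.
have yq : `|y - map_mx ratr (\row_i q i)| <= d / 2.
  apply: rV_norm_le => [|i]; first by rewrite divr_ge0// ltW.
  by rewrite !mxE ltW.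
split; first by rewrite -/d; lra.
move=> z; rewrite -/d => zq; apply: He.
rewrite -(subrKA (map_mx ratr (\row_i q i))) (le_trans (ler_normD _ _))//.
by rewrite [X in _ + X]distrC; lra.
Qed.

(** A [smooth_space] carries no topology, so openness is tested in charts. *)
Definition open_in n (X : smooth_space n) (U : set X) :=
  forall c : chart X n, maximal_atlas c -> open (coord c @` (dom c `&` U)).

Lemma chart_open_in n (X : smooth_space n) (c : chart X n) (O : set 'rV[R]_n) :
  good_space X -> maximal_atlas c -> open O ->
  open_in [set x | dom c x /\ O (coord c x)].
Proof.
move=> gX mc oO d md; have [chd _] := md; apply: open_nbhd => _ [x [dx [cx Ox]] <-].
exists (overlap d c `&` transition d c x @^-1` O); split.
- apply: (open_preimage (overlap_open gX md mc) oO) => y.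
  exact: smooth_continuous (smooth_transitionP gX x md mc).
- by split; [exists x|rewrite /= transitionE].
- by move=> _ [[z [dz cz] <-]] /=; rewrite transitionE// => Oz; exists z.
Qed.

(** The form in which sigma-compactness is passed from the base to T^*M. [None] stands for indices
    that enumerate no chart. *)
Definition countable_charts n (X : smooth_space n) :=
  exists A : nat -> option (chart X n),
    (forall i c, A i = Some c -> maximal_atlas c) /\
    forall x, exists i c, A i = Some c /\ dom c x.

(** [P] is not assumed to pass to smaller sets, so rational coordinate balls only index the cover:
    for each ball contained in some set with [P], one such set is chosen, and [set0] for the other
    balls. *)
Lemma lindelof n (X : smooth_space n) (S : set X) (P : set X -> Prop) :
  countable_charts X -> P set0 ->
  (forall x, S x -> exists U, [/\ U x, open_in U & P U]) ->
  exists T : nat -> set X, (forall i, P (T i)) /\ S `<=` \bigcup_i T i.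
Proof.
move=> [A [mA cA]] P0 HS.
pose small (t : nat * ('rV[rat]_n * nat)) (U : set X) := exists c, A t.1 = Some c /\
  forall x, dom c x -> `|coord c x - map_mx ratr t.2.1| < t.2.2.+1%:R^-1 -> U x.
have choice_fun (t : nat) : exists U, P U /\
    (forall u, unpickle t = Some u -> forall U', P U' -> small u U' -> small u U).
  case: (unpickle t) => [u|]; last by exists set0.
  have [[U [PU sU]]|no] := pselect (exists U, P U /\ small u U).
    by exists U; split=> // _ [<-].
  exists set0; split=> // _ [<-] U' PU' sU'; exfalso; apply: no.
  by exists U'.
have [T HT] := choice choice_fun; exists T; split=> [i|x Sx]; first by have [] := HT i.
have [U [Ux oU PU]] := HS x Sx; have [i [c [Ac cx]]] := cA x.
have mc := mA _ _ Ac; have [[inj _] _] := mc.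
have Ox : (coord c @` (dom c `&` U)) (coord c x) by exists x.
have [q [j [Bx BU]]] := rational_ball (oU c mc) Ox.
pose u := (i, (q, j)).
have sU : small u U.
  exists c; split=> // z cz /BU[z' [cz' Uz'] /(inj _ _ cz' cz) <-//].
have [PT /(_ u (pickleK u) U PU sU)[c' [Ac' Hc']]] := HT (pickle u).
exists (pickle u) => //; apply: Hc'; move: Ac'; rewrite Ac => -[<-] //.
Qed.

(* [compact_cover] needs a point of the space. *)
Lemma compact_cover_nonempty (T : topologicalType) (x0 : T) (A : set T) :
  compact A -> cover_compact A.
Proof.
pose pT : ptopologicalType := HB.pack (Topological.sort T) (isPointed.Build T x0).
have := @compact_cover pT; rewrite funeqE => /(_ A).
by move=> E cA; rewrite -[cover_compact A]/(@cover_compact pT A) -E.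
Qed.

(** Finitely many chosen charts cover each compact set of an exhaustion; the pairs (compact set,
    position in its list) are enumerated. *)
Lemma manifold_countable_charts n (M : manifold R n) : countable_charts M.
Proof.
have gM := manifold_good M.
have [_ [K [cK KT]] _ Hh _] := manifoldP M.
have H i : exists s : seq (mtop M), forall x, K i x ->
    exists2 y, y \in s & dom (chart_at (X := M) y) x.
  have [[x0 _]|K0] := pselect (exists x, K i x); last first.
    by exists [::] => x Kx; exfalso; apply: K0; exists x.
  have := compact_cover_nonempty x0 (cK i).
  move=> /(_ (mtop M) setT (fun y => dom (chart_at (X := M) y))) => -[].
  - by move=> y _; have [ay _] := chart_atP gM y; have [] := Hh _ ay.
  - by move=> x _; exists x => //; exact: (chart_atP gM x).2.
  - move=> D _ HD; exists (finmap.enum_fset D) => x /HD[y Dy yx].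
    by exists y.
have [s Hs] := choice H.
exists (fun t => if unpickle t is Some (i, j) then
  omap (fun y => chart_at (X := M) y) (onth (s i) j) else None); split.
- move=> t c; case: (unpickle t) => [[i j]|//].
  case: onth => [y|//] [<-]; exact: chart_at_maximal gM y.
- move=> x; have [i _ Kx] : (\bigcup_i K i) x by rewrite KT.
  have [y ys yx] := Hs i x Kx.
  exists (pickle (i, index y (s i))), (chart_at (X := M) y); split=> //.
  by rewrite pickleK (onthE) (nth_map y) ?index_mem// nth_index.
Qed.

Lemma cotangent_countable_charts n (X : smooth_space n) : good_space X ->
  countable_charts X -> countable_charts (cotangent X).
Proof.
move=> gX [A [mA cA]]; exists (fun i => omap (@cotangent_chart R n X) (A i)); split.
- move=> i c; case E : (A i) => [a|//] [<-].
  exact: cotangent_maximal (mA _ _ E).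
- move=> z; have [i [c [Ac cz]]] := cA (z : cotangent_point X).1.
  by exists i, (cotangent_chart c); rewrite Ac.
Qed.

End Lindelof.

(** * Charts adapted to a submersion *)

Section AdaptedCharts.
Context {R : realType}.
Local Notation chart := (chart R).
Local Notation smooth_space := (smooth_space R).

(** Together with [pid_mx (n - k)] it splits the coordinates of an adapted chart into vertical and
    base ones. *)
Definition last_mx n k : 'M[R]_(n, k) := \matrix_(i, j) (val i == (n - k) + val j)%N%:R.

Section LastColumns.
Variables (n k : nat) (kn : (k <= n)%N).
Local Notation P1 := (pid_mx (n - k) : 'M[R]_(n, n - k)).
Local Notation P1t := (pid_mx (n - k) : 'M[R]_(n - k, n)).
Local Notation P2 := (last_mx n k).

Lemma last_ord_subproof (j : 'I_k) : ((n - k) + j < n)%N.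
Proof. by rewrite -{2}(subnK kn) ltn_add2l. Qed.
Definition last_ord j := Ordinal (last_ord_subproof j).

Lemma mul_last_mx (y : 'rV[R]_n) j : (y *m P2) 0 j = y 0 (last_ord j).
Proof.
rewrite mxE (bigD1 (last_ord j))//= big1 => [|i ij]; last first.
  by rewrite !mxE -val_eqE /= in ij *; rewrite (negbTE ij) mulr0.
by rewrite !mxE eqxx mulr1 addr0.
Qed.

Lemma flat_last (y : 'rV[R]_n) : flat (n - k) y <-> y *m P2 = 0.
Proof.
split=> [H|H i ki].
  by apply/rowP => j; rewrite mul_last_mx mxE H//= leq_addr.
have ij : (i - (n - k) < k)%N by rewrite ltn_subLR// subnK.
have -> : i = last_ord (Ordinal ij) by apply/val_inj => /=; rewrite subnKC.
by rewrite -mul_last_mx H mxE.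
Qed.

Lemma pid_last (w : 'rV[R]_(n - k)) : w *m P1t *m P2 = 0.
Proof. by apply/flat_last; exact: pid_flat. Qed.

Lemma pid_lastK (w : 'rV[R]_(n - k)) : w *m P1t *m P1 = w.
Proof. exact: pid_pid (leq_subr k n). Qed.

Lemma tr_last_mx (w : 'rV[R]_k) : w *m P2^T *m P2 = w.
Proof.
apply/rowP => j; rewrite mul_last_mx mxE (bigD1 j)//= big1 => [|i ij].
  by rewrite !mxE eqxx mulr1 addr0.
by rewrite !mxE /= eqn_add2l eq_sym val_eqE (negbTE ij) mulr0.
Qed.

Lemma tr_last_pid (w : 'rV[R]_k) : w *m P2^T *m P1 = 0.
Proof.
apply/rowP => j; rewrite mxE mxE big1// => i _; rewrite !mxE big_distrl big1//= => l _.
rewrite !mxE; case: eqP => [E|_]; last by rewrite mulr0 mul0r.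
case: eqP => [E'|_]; last by rewrite mulr0.
by have := ltn_ord j; rewrite -E' E ltnNge leq_addr.
Qed.

Lemma flat_eq0 (y : 'rV[R]_n) : y *m P1 = 0 -> y *m P2 = 0 -> y = 0.
Proof. by move=> y1 /flat_last/(flat_pid (leq_subr k n)) <-; rewrite y1 mul0mx. Qed.

Lemma split_last (y : 'rV[R]_n) : y = y *m P1 *m P1t + y *m P2 *m P2^T.
Proof.
apply/eqP; rewrite -subr_eq0; apply/eqP/flat_eq0; rewrite mulmxBl mulmxDl.
  by rewrite pid_lastK tr_last_pid addr0 subrr.
by rewrite pid_last tr_last_mx add0r subrr.
Qed.
End LastColumns.

(** * Submersions as coordinate projections, their fibers and vertical covectors *)

Section Submersion.
Context {n k : nat} {M : smooth_space n} {B : smooth_space k} (pi : M -> B).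
Hypotheses (gM : good_space M) (gB : good_space B).
Hypothesis smooth_pi : forall x, smooth_near pi x.
Hypothesis submersion_pi : forall x, limg (mdiff pi x) = fullv.
Hypothesis kn : (k <= n)%N.
Local Notation P1 := (pid_mx (n - k) : 'M[R]_(n, n - k)).
Local Notation P1t := (pid_mx (n - k) : 'M[R]_(n - k, n)).
Local Notation P2 := (last_mx n k).
Implicit Types (c : chart M n) (d : chart B k) (x m : M).

Lemma mdiff_surjective x w : exists v, mdiff pi x v = w.
Proof.
have : w \in limg (mdiff pi x) by rewrite submersion_pi memvf.
by move=> /memv_imgP[v _ ->]; exists v.
Qed.

(* In adapted charts [pi] is the projection onto the last [k] coordinates. *)
Definition adapted c d := [/\ maximal_atlas c, maximal_atlas d,
  (forall z, dom c z -> dom d (pi z)) &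
  forall z, dom c z -> coord c z *m P2 = coord d (pi z)].

Lemma smooth_translation a (u : 'rV[R]_a) (A : set 'rV[R]_a) : open A ->
  smooth A (fun y => y + u).
Proof.
move=> oA r; apply: CkD => //; last exact: Ck_cst.
exact: (@smooth_linear _ _ _ _ A idfun).
Qed.

(** Slice charts require vanishing coordinates on the fiber over [b], hence [b] at the origin. *)
Lemma centered_chart (b : B) : exists d, [/\ maximal_atlas d, dom d b & coord d b = 0].
Proof.
have [ad db] := chart_atP gB b; have md := atlas_maximal gB ad.
set d := chart_at b in ad db md; have [[_ od] _] := md.
pose u := coord d b; pose t := fun y : 'rV[R]_k => y - u.
have oi : open (t @` (coord d @` dom d)).
  have -> : t @` (coord d @` dom d) = (fun y => y + u) @^-1` (coord d @` dom d).
    apply/seteqP; split=> [_ [y dy <-]|y dy]; first by rewrite /= /t subrK.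
    by exists (y + u); rewrite /t ?addrK.
  apply: open_comp => // y _.
  by apply: smooth_continuous (smooth_translation u openT) _.
exists (comp_chart d (coord d @` dom d) t); split.
- apply: (@comp_chart_maximal _ _ _ gB d (coord d @` dom d) t (fun y => y + u)) => //.
  + exact: smooth_translation.
  + exact: smooth_translation.
  + by move=> y _; rewrite /t subrK.
- by split=> //; exists b.
- by rewrite /= /t subrr.
Qed.

(** The local representation [F] of [pi] has a surjective differential. Linear functions
    complementary to it become the first n - k coordinates, and [F] itself the last k. *)
Lemma adapted_chart x : exists c d, [/\ adapted c d, dom c x & coord d (pi x) = 0].
Proof.
have [d [md dx d0]] := centered_chart (pi x).
have [ac cx] := chart_atP gM x; set c := chart_at x in ac cx.
have mc := atlas_maximal gM ac; have [chc _] := mc.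
have [W [oW Wx HW sW]] := smooth_near_nbhd gM gB (smooth_pi x) mc md cx dx.
set F := local_rep c d pi x in sW.
have Wc : W `<=` coord c @` dom c by move=> _ /HW[z [cz _ ->]]; exists z.
have DF : is_diff (coord c x) F ('d F (coord c x)) by exact: is_diff_smooth sW Wx.
have rJ : \rank (lin1_mx ('d F (coord c x))) = k.
  apply: surjective_rank => w.
  have [v Ev] := mdiff_surjective x ((dcoord d (pi x))^-1%VF w).
  exists (dcoord c x v); rewrite -lin1_mxE.
  apply: (etrans (esym (mdiffE gM gB v (smooth_pi x) mc md cx dx))).
  apply: (etrans (congr1 (dcoord d (pi x)) Ev)); exact: dcoordVK.
have [A HA] := complement_mx (esym (subnK kn)) rJ.
pose psi y := y *m (A *m P1t) + F y *m P2^T.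
have psi2 y : psi y *m P2 = F y.
  by rewrite /psi mulmxDl mulmxA (pid_last kn) (tr_last_mx kn) add0r.
have Dpsi : is_diff (coord c x) psi
    (fun v => v *m (A *m P1t) + 'd F (coord c x) v *m P2^T).
  exact: is_diffD (is_diff_mulmxr _ (is_diff_fun_id _)) (is_diff_mulmxr _ DF).
have spsi : smooth W psi.
  move=> r; apply: CkD => //; first exact: smooth_mulmxr.
  apply: (@smooth_comp _ _ _ _ _ setT (fun z => z *m P2^T) F) => //.
  exact: smooth_mulmxr.
have inj v : 'd psi (coord c x) v = 0 -> v = 0.
  move=> E; have {}E := etrans (esym (diff_eval v Dpsi)) E; apply: HA.
    have := congr1 (fun u => u *m P1) E.
    by rewrite /= mulmxDl mulmxA pid_lastK tr_last_pid addr0 mul0mx.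
  have := congr1 (fun u => u *m P2) E.
  by rewrite /= mulmxDl mulmxA (pid_last kn) (tr_last_mx kn) add0r mul0mx -lin1_mxE.
have [U [G [[oU Ux UW opU] [sG GK]]]] := inverse_function oW Wx spsi inj.
exists (comp_chart c U psi), d; split=> //; split=> //.
- apply: (comp_chart_maximal gM mc oU _ (smooth_subset UW spsi) opU sG GK).
  by move=> y /UW/Wc.
- move=> z [cz Uz]; have [z' [cz' dz']] := HW _ (UW _ Uz).
  by move=> /(chc.1 _ _ cz cz') ->.
- by move=> z [cz Uz]; rewrite /= psi2 /F local_repE.
Qed.

Section Adapted.
Context {c : chart M n} {d : chart B k}.
Hypothesis acd : adapted c d.
Let mc : maximal_atlas c. Proof. by case: acd. Qed.
Let md : maximal_atlas d. Proof. by case: acd. Qed.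
Let cd z : dom c z -> dom d (pi z). Proof. by case: acd => _ _ + _; exact. Qed.
Let E z : dom c z -> coord c z *m P2 = coord d (pi z).
Proof. by case: acd => _ _ _; exact. Qed.

Lemma adapted_mdiff x v : dom c x ->
  dcoord d (pi x) (mdiff pi x v) = dcoord c x v *m P2.
Proof.
move=> cx; have [|_ H] := @mdiff_local_rep _ _ _ _ _ gM gB pi x c d
  (fun y => y *m P2) v mc md cx cd (fun z cz => esym (E cz)).
  exact: smooth_mulmxr.
exact: etrans H (diff_eval _ (is_diff_mulmxr P2 (is_diff_fun_id _))).
Qed.

Lemma adapted_vertical x v : dom c x ->
  (v \in vertical pi x) <-> dcoord c x v *m P2 = 0.
Proof.
move=> cx; rewrite /vertical memv_ker; split=> [/eqP H|H].
  by apply: (etrans (esym (adapted_mdiff v cx))); rewrite H linear0.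
apply/eqP/(can_inj (dcoordK gB md (cd cx))).
by rewrite linear0 -H; exact: adapted_mdiff.
Qed.

(** The coordinate vector fields along the fibers, whose components are constant in the chart. *)
Definition adapted_frame m (i : 'I_(n - k)) : 'rV[R]_n :=
  (dcoord c m)^-1%VF (delta_mx 0 i *m P1t).

Lemma dcoord_adapted_frame m i : dom c m ->
  dcoord c m (adapted_frame m i) = delta_mx 0 i *m P1t.
Proof. by move=> cm; exact: dcoordVK. Qed.

Lemma sum_adapted_frame m (a : 'rV[R]_(n - k)) : dom c m ->
  dcoord c m (\sum_i a 0 i *: adapted_frame m i) = a *m P1t.
Proof.
move=> cm; rewrite {2}(row_sum_delta a) linear_sum mulmx_suml; apply: eq_bigr => i _.
by rewrite linearZ /= dcoord_adapted_frame// -scalemxAl.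
Qed.

Lemma adapted_vertical_frame : vertical_frame pi c adapted_frame.
Proof.
have [[_ oc] _] := mc; split=> [m cm|i x0 cx0].
  pose X := [tuple adapted_frame m i | i < n - k].
  have -> : codom (adapted_frame m) = X by [].
  have XE (i : 'I_(n - k)) : X`_i = adapted_frame m i by rewrite -tnth_nth tnth_mktuple.
  apply/andP; split.
    rewrite eqEsubv; apply/andP; split.
      apply/span_subvP => _ /tnthP[i ->]; rewrite tnth_mktuple.
      by apply/(adapted_vertical _ cm); rewrite dcoord_adapted_frame// (pid_last kn).
    apply/subvP => v /(adapted_vertical _ cm) v2.
    have -> : v = \sum_i (dcoord c m v *m P1) 0 i *: adapted_frame m i.
      apply: (can_inj (dcoordK gM mc cm)); rewrite sum_adapted_frame//.
      by rewrite {1}(split_last kn (dcoord c m v)) v2 mul0mx addr0.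
    apply: memv_suml => i _; apply/memvZ/memv_span.
    by rewrite -XE mem_nth// size_tuple.
  apply/freeP => a Ea i.
  have {}Ea : \sum_i (\row_j a j) 0 i *: adapted_frame m i = 0.
    by rewrite -[RHS]Ea; apply: eq_bigr => j _; rewrite mxE XE.
  have := sum_adapted_frame (\row_j a j) cm; rewrite Ea linear0.
  move=> /(congr1 (fun u => u *m P1)); rewrite /= mul0mx pid_lastK.
  by move=> /rowP/(_ i); rewrite !mxE.
apply/smooth_onE; apply: (@smooth_ext _ _ _ _ (fun=> delta_mx 0 i *m P1t)) => //.
  by move=> _ [z cz <-] /=; rewrite chart_invK ?dcoord_adapted_frame//; case: mc.
by move=> r; exact: Ck_cst.
Qed.

Lemma adapted_slice (b : B) : dom d b -> coord d b = 0 ->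
  slice_chart (n - k) (pi @^-1` [set b]) c.
Proof.
move=> db d0; split=> //; have [[injd _] _] := md.
have H z : dom c z -> (pi z = b <-> flat (n - k) (coord c z)).
  move=> cz; rewrite (flat_last kn) E//; split=> [->//|dz].
  by apply: injd => //; [exact: cd|rewrite dz d0].
apply/seteqP; split=> [_ [z [cz /= pz] <-]|_ [[z cz <-] fz]].
  by split; [exists z|exact/(H z cz)].
by exists z => //; split=> //; exact/(H z cz).
Qed.

(** As the frame consists of coordinate vectors, restriction to ker dpi keeps the base coordinates
    and forgets the last k covector components. So in these charts it is a fixed linear map. *)
Lemma vdual_restrict_coord (z : cotangent M) : dom c (z : cotangent_point M).1 ->
  coord (vdual_chart pi c adapted_frame : chart (vdual pi) _) (vdual_restrict pi z) =
  coord (cotangent_chart c : chart (cotangent M) _) z *m block_mx 1%:M 0 0 P1.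
Proof.
case: z => [m zeta] /= cm; rewrite mul_row_block !mulmx0 addr0 add0r mulmx1.
congr row_mx; apply/rowP => i; rewrite mxE.
have -> : tagged (vdual_of (pi := pi) (m := m)
    (zeta \o linfun (vsval (U := vertical pi m)))%VF)
    (vsproj (vertical pi m) (adapted_frame m i)) = zeta (adapted_frame m i).
  rewrite /= comp_lfunE lfunE /= vsprojK//.
  by apply/(adapted_vertical _ cm); rewrite dcoord_adapted_frame// (pid_last kn).
apply: (etrans (cov_compE gM (z := mkcov m zeta) _ mc cm)).
rewrite dcoord_adapted_frame// dot_mulmx tr_pid_mx dot_delta.
by rewrite /cov_comp /= row_mxKr.
Qed.

Lemma cotangent_proj_mdiff (z : cotangent M) v : dom c (z : cotangent_point M).1 ->
  dcoord d (cotangent_proj pi z) (mdiff (cotangent_proj pi) z v) =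
  lsubmx (dcoord (cotangent_chart c : chart (cotangent M) _) z v) *m P2.
Proof.
move=> cz; have [||_ H] := @mdiff_local_rep _ _ _ _ _ (cotangent_good gM) gB
  (cotangent_proj pi) z (cotangent_chart c) d (fun y => lsubmx y *m P2) v
  (cotangent_maximal gM mc) md cz (fun z cz => cd cz).
- move=> w cw; rewrite cotangent_coord row_mxKl; exact: esym (E cw).
- apply: (@smooth_comp _ _ _ _ _ setT (fun y => y *m P2)) => //.
  + by case: (cotangent_is_chart gM mc).
  + exact: smooth_mulmxr.
  + exact: smooth_lsubmx.
exact: etrans H (diff_eval _ (is_diff_mulmxr P2 (is_diff_linear lsubmx _))).
Qed.

Lemma vdual_good_adapted : good_space (vdual pi) -> forall (w : vdual pi) v,
  dom c (tag (w : vdual_point pi)) ->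
  dcoord d (vdual_proj pi w) (mdiff (vdual_proj pi) w v) =
  lsubmx (dcoord (vdual_chart pi c adapted_frame : chart (vdual pi) _) w v) *m P2.
Proof.
move=> gV w v cw; have mC : maximal_atlas (vdual_chart pi c adapted_frame : chart (vdual pi) _).
  apply: (atlas_maximal gV); exists c, adapted_frame; split=> //.
  exact: adapted_vertical_frame.
have [||_ H] := @mdiff_local_rep _ _ _ _ _ gV gB
  (vdual_proj pi) w (vdual_chart pi c adapted_frame) d (fun y => lsubmx y *m P2) v
  mC md cw (fun z cz => cd cz).
- move=> u cu; rewrite vdual_coord row_mxKl; exact: esym (E cu).
- apply: (@smooth_comp _ _ _ _ _ setT (fun y => y *m P2)) => //.
  + by case: mC => -[].
  + exact: smooth_mulmxr.
  + exact: smooth_lsubmx.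
exact: etrans H (diff_eval _ (is_diff_mulmxr P2 (is_diff_linear lsubmx _))).
Qed.

End Adapted.

Lemma fiber_submanifold b : submanifold (n - k) (pi @^-1` [set b]).
Proof.
split; first exact: leq_subr.
move=> x /= xb; have [c [d [acd cx d0]]] := adapted_chart x.
exists c => //; rewrite xb in d0; apply: (adapted_slice acd) => //.
by rewrite -xb; case: acd => _ _ + _; exact.
Qed.

Lemma fiber_good b : good_space (fiber pi b).
Proof. exact: sub_space_good gM (fiber_submanifold b). Qed.

Section Fiber.
Context {b : B} {c : chart M n}.
Hypothesis sc : slice_chart (n - k) (pi @^-1` [set b]) c.
Let mc : maximal_atlas c. Proof. by case: sc. Qed.
Let gF := fiber_good b.
Local Notation cb := (subspace_chart (n - k) (pi @^-1` [set b]) c).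

Lemma fiber_chart_maximal : maximal_atlas (cb : chart (fiber pi b) _).
Proof.
have H := subspace_maximal gM (fiber_submanifold b) sc.
exact: H.
Qed.

(** In a slice chart the inclusion of the fiber pads with zeros, so its transpose truncates
    covectors; the pullback too is a fixed linear map. *)
Lemma pullback_coord (x : fiber pi b) (zeta : 'Hom('rV[R]_n, R^o)) : dom c (val x) ->
  coord (cotangent_chart (cb : chart (fiber pi b) _) : chart (cotangent (fiber pi b)) _)
    (mkcov x (zeta \o mdiff (fiber_incl pi b) x)%VF) =
  coord (cotangent_chart c : chart (cotangent M) _) (mkcov (val x : M) zeta) *m
    block_mx P1 0 0 P1.
Proof.
move=> cx; have mcb := fiber_chart_maximal.
apply: (etrans (cotangent_coord _ _)); apply: esym.
apply: (etrans (congr1 (fun y => y *m block_mx P1 0 0 P1)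
  (cotangent_coord c (mkcov (val x : M) zeta)))).
rewrite mul_row_block !mulmx0 addr0 add0r; congr row_mx.
apply: dot_eq => w.
pose v := (dcoord (cb : chart (fiber pi b) _) x)^-1%VF w.
have Ew : dcoord (cb : chart (fiber pi b) _) x v = w by exact: dcoordVK.
have H := cov_compE gF (z := mkcov x (zeta \o mdiff (fiber_incl pi b) x)%VF) v mcb cx.
rewrite /= Ew comp_lfunE in H; rewrite -H.
apply: esym; apply: (etrans (cov_compE gM (z := mkcov (val x : M) zeta) _ mc cx)).
apply: (etrans (congr1 (dot _) (sub_incl_mdiff gM (fiber_submanifold b) v sc cx))).
by rewrite Ew dot_mulmx tr_pid_mx.
Qed.

Lemma fiber_incl_dcoord (x : fiber pi b) v : dom c (val x) ->
  dcoord c (val x) (mdiff (fiber_incl pi b) x v) =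
  dcoord (cb : chart (fiber pi b) _) x v *m P1t.
Proof.
move=> cx; have H := sub_incl_mdiff gM (fiber_submanifold b) v sc cx.
exact: H.
Qed.

End Fiber.

Lemma limg_fiber_incl b (x : fiber pi b) :
  limg (mdiff (fiber_incl pi b) x) = vertical pi (val x).
Proof.
have xb : pi (val x) = b := sub_mem x.
have [c [d [acd cx d0]]] := adapted_chart (val x).
have sc : slice_chart (n - k) (pi @^-1` [set b]) c.
  rewrite xb in d0; apply: (adapted_slice acd) => //.
  by rewrite -xb; case: acd => _ _ + _; exact.
have [mc _ _ _] := acd.
have mcb := fiber_chart_maximal sc.
apply/eqP; rewrite eqEsubv; apply/andP; split; apply/subvP => v.
  move=> /memv_imgP[u _ ->]; apply/(adapted_vertical acd _ cx).
  apply: (etrans (congr1 (fun y => y *m P2) (fiber_incl_dcoord sc u cx))).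
  exact: pid_last.
move=> /(adapted_vertical acd _ cx) v2.
pose u := (dcoord (subspace_chart (n - k) (pi @^-1` [set b]) c : chart (fiber pi b) _) x)^-1%VF
  (dcoord c (val x) v *m P1).
apply/memv_imgP; exists u; first exact: memvf.
apply: (can_inj (dcoordK gM mc cx)).
apply: esym; apply: (etrans (fiber_incl_dcoord sc u cx)).
apply: (etrans (congr1 (fun y => y *m P1t) (dcoordVK (fiber_good b) mcb cx _))).
by apply: flat_pid; [exact: leq_subr|exact/(flat_last kn)].
Qed.

Lemma vdual_space_good : good_space (vdual pi).
Proof.
apply: (vdual_good gM) => x; have [c [d [acd cx _]]] := adapted_chart x.
exists c, (adapted_frame (c := c)); split=> //; first by case: acd.
exact: adapted_vertical_frame acd.
Qed.

End Submersion.
End AdaptedCharts.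

(** * Restriction of a Lagrangian cone to the fibers *)

Section LagrangianFamilies.
Context {R : realType}.
Local Notation chart := (chart R).
Local Notation smooth_space := (smooth_space R).

Lemma mul_rV_diag a b a' b' (y : 'rV[R]_(a + b)) (A : 'M[R]_(a, a')) (D : 'M[R]_(b, b')) :
  y *m block_mx A 0 0 D = row_mx (lsubmx y *m A) (rsubmx y *m D).
Proof. by rewrite -{1}[y]hsubmxK mul_row_block !mulmx0 addr0 add0r. Qed.

Lemma submanifold_set0 n (X : smooth_space n) p : (p <= n)%N -> submanifold p (set0 : set X).
Proof. by move=> pn; split. Qed.

Section Family.
Context {n k : nat} {M : smooth_space n} {B : smooth_space k} (pi : M -> B).
Hypotheses (gM : good_space M) (gB : good_space B).
Hypothesis smooth_pi : forall x, smooth_near pi x.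
Hypothesis submersion_pi : forall x, limg (mdiff pi x) = fullv.
Hypothesis kn : (k <= n)%N.
Hypothesis countable_M : countable_charts M.
Variable Lambda : set (cotangent M).
Hypothesis Lambda_nonzero : Lambda `<=` nonzero_covectors M.
Hypothesis Lambda_conic : conic Lambda.
Hypothesis Lambda_lagrangian : lagrangian Lambda.
Hypothesis Lambda_transverse : transverse (cotangent_proj pi) n Lambda.
Local Notation P1 := (pid_mx (n - k) : 'M[R]_(n, n - k)).
Local Notation P1t := (pid_mx (n - k) : 'M[R]_(n - k, n)).
Local Notation P2 := (last_mx n k).
Local Notation base z := (z : cotangent_point M).1.
Local Notation cot c := (cotangent_chart c : chart (cotangent M) (n + n)).

Let gC : good_space (cotangent M) := cotangent_good gM.

Lemma Lambda_equation (z : cotangent M) (c : chart M n) : Lambda z -> maximal_atlas c ->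
  dom c (base z) ->
  exists O (h : 'rV[R]_(n + n) -> 'rV[R]_n), O (coord (cot c) z) /\
    forall x, dom (cot c) x -> O (coord (cot c) x) -> local_equation (cot c) Lambda x O h.
Proof.
move=> Lz mc cz; have [sL _] := Lambda_lagrangian.
exact: (equation_of_submanifold gC erefl sL Lz (cotangent_maximal gM mc) cz).
Qed.

(** * The tangent space of Lambda as the kernel of a local equation *)

Section LocalEquation.
Context {z : cotangent M} {c : chart M n} {d : chart B k}
  {O : set 'rV[R]_(n + n)} {h : 'rV[R]_(n + n) -> 'rV[R]_n}.
Hypotheses (Lz : Lambda z) (acd : adapted pi c d) (cz : dom c (base z))
  (eqz : local_equation (cot c) Lambda z O h).
Let mc : maximal_atlas c. Proof. by case: acd. Qed.
Local Notation K v := ('d h (coord (cot c) z) v = 0).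

Lemma kernel_tangent v : K v -> tangent_sub n Lambda z ((dcoord (cot c) z)^-1%VF v).
Proof.
move=> Kv; have mC := cotangent_maximal gM mc.
apply/(tangent_of_equation _ gC erefl mC cz Lz eqz).
by apply: (etrans (congr1 _ (dcoordVK gC mC cz v))).
Qed.

Lemma tangent_kernel v : tangent_sub n Lambda z v -> K (dcoord (cot c) z v).
Proof.
by move=> /(tangent_of_equation _ gC erefl (cotangent_maximal gM mc) cz Lz eqz).
Qed.

Lemma kernel_isotropic u v : K u -> K v -> symp u v = 0.
Proof.
move=> Ku Kv; have mC := cotangent_maximal gM mc.
have [_ /(_ z Lz _ _ (kernel_tangent Ku) (kernel_tangent Kv))] := Lambda_lagrangian.
rewrite symplectic_formE => E.
have E1 := dcoordVK gC mC cz u; have E2 := dcoordVK gC mC cz v.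
apply: etrans (etrans (symp_cotangent_chart gM _ _ mc cz) E).
exact: congr2 (esym E1) (esym E2).
Qed.

Lemma kernel_transverse w : exists2 v, K v & lsubmx v *m P2 = w.
Proof.
have [_ md cd _] := acd.
have dz : dom d (cotangent_proj pi z) by exact: cd.
have [v Tv Ev] := Lambda_transverse Lz ((dcoord d (cotangent_proj pi z))^-1%VF w).
exists (dcoord (cot c) z v); first exact: tangent_kernel.
apply: (etrans (esym (cotangent_proj_mdiff gM gB acd v cz))).
apply: (etrans (congr1 _ Ev)); exact: (dcoordVK gB md dz).
Qed.

(* A vector tangent to Lambda along the conormal directions is symplectically
   orthogonal to the tangent space of Lambda, and so annihilates both the vertical
   space and a complement of it. *)
Lemma kernel_conormal_eq0 u : K u -> lsubmx u = 0 -> rsubmx u *m P1 = 0 -> u = 0.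
Proof.
move=> Ku u1 u2; pose a := rsubmx u *m P2.
have ua : rsubmx u = a *m P2^T.
  by rewrite {1}(split_last kn (rsubmx u)) u2 mul0mx add0r.
have a0 : a = 0.
  apply: dot_eq => w; have [v Kv <-] := kernel_transverse w.
  have := kernel_isotropic Ku Kv; rewrite /symp u1 linear0 subr0 ua.
  rewrite dotC dot_mulmx trmxK dotC => ->.
  by rewrite dotC linear0.
by rewrite -[u]hsubmxK u1 ua a0 mul0mx row_mx0.
Qed.

End LocalEquation.

(** * Dilations of covectors and the conormal bundle *)

Definition scale_covector (t : R) (z : cotangent M) : cotangent M :=
  mkcov (base z) (t *: (z : cotangent_point M).2).

Definition dilate a (t : R) (y : 'rV[R]_(a + a)) : 'rV[R]_(a + a) :=
  row_mx (lsubmx y) (t *: rsubmx y).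

Lemma dilate1 a (y : 'rV[R]_(a + a)) : dilate 1 y = y.
Proof. by rewrite /dilate scale1r hsubmxK. Qed.

Lemma dilateM a s t (y : 'rV[R]_(a + a)) : dilate s (dilate t y) = dilate (s * t) y.
Proof. by rewrite /dilate row_mxKl row_mxKr scalerA. Qed.

Lemma coord_scale (c : chart M n) (t : R) (z : cotangent M) :
  coord (cot c) (scale_covector t z) = dilate t (coord (cot c) z).
Proof.
rewrite /= /dilate row_mxKl row_mxKr; congr row_mx.
by apply/rowP => j; rewrite !mxE scale_lfunE.
Qed.

Lemma Lambda_scale t z : 0 < t -> Lambda z -> Lambda (scale_covector t z).
Proof. by case: z => m zeta; exact: Lambda_conic. Qed.

(* For a conormal covector the radial vector [u], which is tangent to a cone, is a
   conormal direction. *)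
Lemma disjoint_conormal : Lambda `&` conormal pi = set0.
Proof.
apply/seteqP; split=> // z [Lz Cz].
have [c [d [acd cz _]]] := adapted_chart gM gB smooth_pi submersion_pi kn (base z).
have [mc _ _ _] := acd.
have [A [h [Az /(_ z cz Az) eqz]]] := Lambda_equation Lz mc cz.
have [[oA _ _ sh _] HA] := eqz.
pose xi := cov_comp c z; pose u : 'rV[R]_(n + n) := row_mx 0 xi.
have xiP1 : xi *m P1 = 0.
  apply/rowP => i; rewrite -dot_delta [RHS]mxE -tr_pid_mx -dot_mulmx.
  rewrite -(dcoord_adapted_frame gM acd i cz) -(cov_compE gM _ mc cz).
  by apply: Cz; apply/(adapted_vertical gM gB acd _ cz);
    rewrite (dcoord_adapted_frame gM acd)// (pid_last kn).
have line t : coord (cot c) z + t *: u = dilate (1 + t) (coord (cot c) z).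
  rewrite cotangent_coord /u /dilate row_mxKl row_mxKr scale_row_mx add_row_mx.
  by rewrite scaler0 addr0 scalerDl scale1r.
have Ku : 'd h (coord (cot c) z) u = 0.
  apply: (diff_zero_along sh Az).
  have C : (fun t : R => coord (cot c) z + t *: u) @ (0 : R) --> coord (cot c) z.
    rewrite -[X in _ --> X]addr0 -[X in _ --> _ + X](scale0r u).
    by apply: cvgD; [exact: cvg_cst|exact: (@scalel_continuous _ _ u 0)].
  have N1 : \forall t \near (0 : R), A (coord (cot c) z + t *: u).
    by apply: C; exact: open_nbhs_nbhs.
  have N2 : \forall t \near (0 : R), 0 < 1 + t.
    have : \forall t \near (0 : R), `|t| < 1 by exact: nbhs0_lt.
    by apply: filterS => t; rewrite ltr_norml => /andP[t1 _]; lra.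
  apply: filterS2 N1 N2 => t At t0.
  move: At; rewrite line -coord_scale => At.
  by apply/HA => //; exact: Lambda_scale.
have u0 : u = 0.
  apply: (kernel_conormal_eq0 Lz acd cz eqz Ku); first by rewrite /u row_mxKl.
  by rewrite /u row_mxKr.
have xi0 : xi = 0 by rewrite -(row_mxKr (0 : 'rV[R]_n) xi) -/u u0 linear0.
have := Lambda_nonzero Lz; rewrite /nonzero_covectors /= => /eqP; apply.
apply/lfunP => v; rewrite (cov_compE gM v mc cz) -/xi xi0.
by rewrite dotC linear0 lfunE.
Qed.

(** Transversality is all that the family in V^*M asks of its pieces; conicity is only a matter for
    the individual fibers. *)
Definition vdual_pieces (U : set (cotangent M)) :=
  submanifold n (vdual_restrict pi @` (Lambda `&` U)) /\
  transverse (vdual_proj pi) n (vdual_restrict pi @` (Lambda `&` U)).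

(** [kernel_conormal_eq0] says that the matrix of the restriction is injective on the tangent space
    of Lambda, so [immersed_image] applies and gives n - k equations for the image. Transversality
    is inherited because the restriction keeps the base component of tangent vectors. *)
Lemma vdual_piece z : Lambda z -> exists U, [/\ U z, open_in U & vdual_pieces U].
Proof.
move=> Lz.
have [c [d [acd cz _]]] := adapted_chart gM gB smooth_pi submersion_pi kn (base z).
have [mc md cd _] := acd; have mC := cotangent_maximal gM mc.
have [chC _] := mC.
have gV := vdual_space_good gM gB smooth_pi submersion_pi kn.
have Hf := adapted_vertical_frame gM gB kn acd.
pose VC := vdual_chart pi c (@adapted_frame R n k M c) : chart (vdual pi) (n + (n - k)).
have mV : maximal_atlas VC.
  by apply: (atlas_maximal gV); exists c, (@adapted_frame R n k M c).
have [[injV oV] _] := mV.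
have [A [h [Az eqA]]] := Lambda_equation Lz mc cz.
have eqz := eqA z cz Az; have [[oA _ AC sh surj] HA] := eqz.
pose Rho : 'M[R]_(n + n, n + (n - k)) := block_mx 1%:M 0 0 P1.
have inj v : 'd h (coord (cot c) z) v = 0 -> v *m Rho = 0 -> v = 0.
  rewrite mul_rV_diag mulmx1 -[in X in _ -> X -> _]row_mx0 => Kv /eq_row_mx[v1 v2].
  exact: (kernel_conormal_eq0 Lz acd cz eqz Kv v1 v2).
have hz : h (coord (cot c) z) = 0 by apply/HA.
have [U0 [V [g [f [[oU Uz UA oV' sg] [surjg _ toV ofV kerg]]]]]] :=
  immersed_image (erefl (n + n)%N) (addnC n (n - k)%N) oA Az sh surj inj.
pose U := [set x : cotangent M | dom c (base x) /\ U0 (coord (cot c) x)].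
have restrictE x : dom c (base x) ->
    coord VC (vdual_restrict pi x) = coord (cot c) x *m Rho.
  by move=> cx; have H := vdual_restrict_coord gM gB kn acd cx; exact: H.
have dom_restrict x : dom VC (vdual_restrict pi x) <-> dom c (base x) by case: x.
have hL x : Lambda x -> U x -> h (coord (cot c) x) = 0.
  by move=> Lx [cx Ux]; exact: iffLR (HA x cx (UA _ Ux)) Lx.
(* Conversely to the image lying in the zero set of [g], the section [f] rebuilds from a zero of [g]
   the point of Lambda above it. *)
have SP w : dom VC w -> V (coord VC w) ->
    ((vdual_restrict pi @` (Lambda `&` U)) w <-> g (coord VC w) = 0).
  move=> cw Vw; split=> [[x [Lx Ux'] <-]|gw].
    have hx := hL x Lx Ux'; have [cx Ux] := Ux'; rewrite (restrictE x cx).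
    by have [_ gx _] := toV _ Ux hx; exact: gx.
  have [Uf hf fE] := ofV _ Vw gw.
  have [x cx xE] := AC _ (UA _ Uf).
  have Ax : A (coord (cot c) x) by rewrite xE; exact: UA.
  have U0x : U0 (coord (cot c) x) by rewrite xE.
  have Lx : Lambda x by apply: (iffRL (HA x cx Ax)); rewrite xE.
  exists x; first exact: conj Lx (conj cx U0x).
  apply: injV; [exact/dom_restrict|exact: cw|].
  by apply: etrans (restrictE x cx) _; rewrite xE.
have eqS x : Lambda x -> U x -> local_equation VC (vdual_restrict pi @` (Lambda `&` U))
    (vdual_restrict pi x) (V `&` coord VC @` dom VC) g.
  move=> Lx Ux'; have hx := hL x Lx Ux'; have [cx Ux] := Ux'.
  have [Vx _ _] := toV _ Ux hx.
  have cx' : dom VC (vdual_restrict pi x) by apply/dom_restrict.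
  split; first split.
  - exact: openI.
  - by split; [rewrite (restrictE x cx)|exists (vdual_restrict pi x)].
  - by move=> y [].
  - by apply: smooth_subset sg => y [].
  - by rewrite (restrictE x cx); exact: surjg.
  - by move=> w cw [Vw _]; exact: SP w cw Vw.
have dimE : (n + (n - k) = n + (n - k))%N by [].
exists U; split; [exact: conj cz Uz|exact: chart_open_in gC mC oU|split].
  apply: (submanifold_of_equation gV dimE) => _ [x [Lx Ux] <-].
  exists VC, (V `&` coord VC @` dom VC), g; split=> //.
    by apply/dom_restrict; case: Ux.
  exact: eqS.
move=> _ [x [Lx Ux] <-] w; have [cx Ux'] := Ux.
have cx' : dom VC (vdual_restrict pi x) by apply/dom_restrict.
have hx := hL x Lx Ux.
have [v Tv Ev] := Lambda_transverse Lx w.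
have eqx := eqA x cx (UA _ Ux').
have Kv := tangent_kernel Lx acd cx eqx Tv.
pose u := dcoord (cot c) x v *m Rho.
have gu : 'd g (coord (cot c) x *m Rho) u = 0.
  by apply/(kerg _ Ux' hx u); exists (dcoord (cot c) x v).
pose u' := (dcoord VC (vdual_restrict pi x))^-1%VF u.
have Eu : dcoord VC (vdual_restrict pi x) u' = u by exact: dcoordVK.
exists u'.
  apply/(tangent_of_equation _ gV dimE mV cx' _ (eqS x Lx Ux)); first by exists x.
  by rewrite Eu restrictE.
have dx : dom d (vdual_proj pi (vdual_restrict pi x)) by case: (x) cx => m zeta; exact: cd.
apply: (can_inj (dcoordK gB md dx)).
apply: (etrans (vdual_good_adapted gM gB kn acd gV u' cx')).
apply: (etrans (congr1 (fun y => lsubmx y *m P2) Eu)).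
rewrite /u mul_rV_diag row_mxKl mulmx1.
apply: (etrans (esym (cotangent_proj_mdiff gM gB acd v cx))).
by case: (x) w v Ev {Tv Kv u gu u' Eu} => m zeta w v ->.
Qed.

(** * The pullback of Lambda to one fiber *)

Section FiberPieces.
Variable b : B.
Local Notation fib := (fiber pi b).
Let gF : good_space fib := fiber_good gM gB smooth_pi submersion_pi kn b.
Let gCF : good_space (cotangent fib) := cotangent_good gF.

Definition pullback (U : set (cotangent M)) : set (cotangent fib) :=
  cotangent_pullback (fiber_incl pi b) U.

Definition pullback_point (x : fib) (zeta : 'Hom('rV[R]_n, R^o)) : cotangent fib :=
  mkcov x (zeta \o mdiff (fiber_incl pi b) x)%VF.

Lemma pullbackP U (w : cotangent fib) : pullback U w <->
  exists (x : fib) zeta, U (mkcov (fiber_incl pi b x) zeta) /\ w = pullback_point x zeta.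
Proof.
case: w => x eta; split=> [[zeta [/= Uz ->]]|[x' [zeta [Uz [-> ->]]]]].
  by exists x, zeta.
by exists zeta.
Qed.

Definition fiber_pieces (U : set (cotangent M)) :=
  conic (pullback (Lambda `&` U)) /\ lagrangian (pullback (Lambda `&` U)).

(** The forgotten covector components pair only with base components in the last k directions, which
    vanish for vectors tangent over the fiber. *)
Lemma symp_block (u v : 'rV[R]_(n + n)) : lsubmx u *m P2 = 0 -> lsubmx v *m P2 = 0 ->
  symp (u *m block_mx P1 0 0 P1) (v *m block_mx P1 0 0 P1) = symp u v.
Proof.
move=> u2 v2; rewrite !mul_rV_diag /symp !row_mxKl !row_mxKr.
have E y x : lsubmx y *m P2 = 0 ->
    dot (x *m P1) (lsubmx (y : 'rV[R]_(n + n)) *m P1) = dot x (lsubmx y).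
  move=> y2; rewrite -{2}(@flat_pid _ _ (n - k) (lsubmx y) (leq_subr _ _)); last exact/(flat_last kn).
  by rewrite [RHS]dot_mulmx tr_pid_mx.
by rewrite !E.
Qed.

Lemma symp_dilate a t (u v : 'rV[R]_(a + a)) : symp (dilate t u) (dilate t v) = t * symp u v.
Proof.
have D x y : dot (t *: x) y = t * dot (x : 'rV[R]_a) y by rewrite dotC linearZ dotC.
by rewrite /symp /dilate !row_mxKl !row_mxKr !D mulrBr.
Qed.

Lemma dilate_linear a t : linear (@dilate a t).
Proof.
have E y : dilate t y = y *m block_mx 1%:M 0 0 t%:M.
  by rewrite mul_rV_diag mulmx1 mul_mx_scalar.
by move=> s u v; rewrite !E mulmxDl -scalemxAl.
Qed.
HB.instance Definition _ a t := GRing.isLinear.Build R 'rV[R]_(a + a) 'rV[R]_(a + a) _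
  (@dilate a t) (@dilate_linear a t).

Lemma dilate_block t (y : 'rV[R]_(n + n)) :
  dilate t y *m block_mx P1 0 0 P1 = dilate t (y *m block_mx P1 0 0 P1).
Proof.
by rewrite !mul_rV_diag /dilate !row_mxKl !row_mxKr scalemxAl.
Qed.

Lemma dilate_cvg a (T : topologicalType) (F : set_system T) {FF : Filter F}
    (f : T -> R) (g : T -> 'rV[R]_(a + a)) (t : R) y :
  f @ F --> t -> g @ F --> y -> (fun x => dilate (f x) (g x)) @ F --> dilate t y.
Proof.
move=> ft gy.
have E s z : dilate s z = z *m block_mx 1%:M 0 0 0 + s *: (z *m block_mx 0 0 0 1%:M).
  rewrite !mul_rV_diag !mulmx1 !mulmx0 scale_row_mx scaler0 add_row_mx.
  by rewrite addr0 add0r.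
have C (A : 'M[R]_(a + a)) : (fun x => g x *m A) @ F --> y *m A.
  apply: (@cvg_comp _ _ _ g (fun w : 'rV[R]_(a + a) => w *m A) F (nbhs y)).
    exact: gy.
  exact: continuous_mulmxr.
under eq_fun do rewrite E; rewrite E; apply: cvgD; first exact: C.
exact: (cvgZ ft (C _)).
Qed.

Local Notation Rho := (block_mx P1 0 0 P1).

(* The equations [h] of Lambda and the last k base coordinates cut out the part of
   Lambda over the fiber; transversality makes them independent. *)
Lemma fiber_image z : Lambda z -> pi (base z) = b ->
  exists c (U : set 'rV[R]_(n + n)) (V : set 'rV[R]_((n - k) + (n - k)))
    (g : 'rV[R]_((n - k) + (n - k)) -> 'rV[R]_(n - k))
    (f : 'rV[R]_((n - k) + (n - k)) -> 'rV[R]_(n + n)),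
  [/\ slice_chart (n - k) (pi @^-1` [set b]) c, dom c (base z), open U &
      U (coord (cot c) z)] /\
  [/\ open V, smooth V g, (forall y, V y -> forall w, exists v, 'd g y v = w) &
      forall y, V y -> {for y, continuous f}] /\
  [/\ forall x, dom c (base x) -> pi (base x) = b -> Lambda x -> U (coord (cot c) x) ->
        [/\ V (coord (cot c) x *m Rho), g (coord (cot c) x *m Rho) = 0 &
            f (coord (cot c) x *m Rho) = coord (cot c) x],
      forall y, V y -> g y = 0 -> exists x : cotangent M,
        [/\ dom c (base x) /\ pi (base x) = b, Lambda x, coord (cot c) x = f y, U (f y) &
            f y *m Rho = y] &
      forall x, dom c (base x) -> pi (base x) = b -> Lambda x -> U (coord (cot c) x) ->
        forall w w', 'd g (coord (cot c) x *m Rho) w = 0 ->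
          'd g (coord (cot c) x *m Rho) w' = 0 -> symp w w' = 0].
Proof.
move=> Lz zb.
have [c [d [acd cz d0]]] := adapted_chart gM gB smooth_pi submersion_pi kn (base z).
have [mc md cd _] := acd; have mC := cotangent_maximal gM mc.
have sc : slice_chart (n - k) (pi @^-1` [set b]) c.
  by apply: (adapted_slice kn acd) => //; rewrite -zb; [exact: cd|exact: d0].
have [A [h [Az eqA]]] := Lambda_equation Lz mc cz.
have eqz := eqA z cz Az; have [[oA _ AC sh surj] HA] := eqz.
have fibE (x : cotangent M) : dom c (base x) ->
    pi (base x) = b <-> lsubmx (coord (cot c) x) *m P2 = 0.
  move=> cx; rewrite /= row_mxKl -(flat_last kn); split.
    by move=> xb; apply: (slice_flat sc).
  exact: (slice_mem sc).
pose H y := row_mx (h y) (lsubmx y *m P2).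
have DH y : A y -> is_diff y H (fun v => row_mx ('d h y v) (lsubmx v *m P2)).
  move=> Ay; apply: is_diff_row_mx; first exact: is_diff_smooth sh Ay.
  have Dl : is_diff y (lsubmx : 'rV[R]_(n + n) -> 'rV[R]_n) lsubmx.
    exact: (is_diff_linear lsubmx y).
  exact: (is_diff_mulmxr P2 Dl).
have sH : smooth A H.
  apply: smooth_row_mx => //.
  apply: (@smooth_comp _ _ _ _ _ setT (fun y => y *m P2)) => //.
    exact: smooth_mulmxr.
  exact: smooth_lsubmx.
(* [v1] solves the part of [h]; the base part is then corrected by a vector in the kernel of the
   differential of [h], where transversality gives every base direction. *)
have surjH w : exists v, 'd H (coord (cot c) z) v = w.
  have [v1 E1] := surj (lsubmx w).
  have [v2 E2 E3] := kernel_transverse Lz acd cz eqz (rsubmx w - lsubmx v1 *m P2).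
  exists (v1 + v2); apply: (etrans (diff_eval _ (DH _ Az))).
  rewrite !linearD E1 E2 addr0 mulmxDl E3 addrC subrK.
  exact: hsubmxK.
have injH v : 'd H (coord (cot c) z) v = 0 -> v *m Rho = 0 -> v = 0.
  move=> E; have := etrans (esym (diff_eval v (DH _ Az))) E.
  rewrite -[0 in RHS]row_mx0 => /eq_row_mx[Kv v2].
  rewrite mul_rV_diag -[X in _ = X -> _]row_mx0 => /eq_row_mx[v1 v3].
  apply: (kernel_conormal_eq0 Lz acd cz eqz Kv _ v3).
  apply: (flat_eq0 kn); [exact: v1|exact: v2].
(* The n equations of Lambda and the k equations of the fiber leave dimension n - k, half that of
   T^*M_b. *)
have dimN : (n + n = (n - k) + (n + k))%N by rewrite addnCA subnK// addnC.
have [U [V [g [f [[oU Uz UA oV sg] [surjg cf toV ofV kerg]]]]]] :=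
  immersed_image dimN erefl oA Az sH surjH injH.
have HE (x : cotangent M) : dom c (base x) -> pi (base x) = b -> Lambda x ->
    U (coord (cot c) x) -> H (coord (cot c) x) = 0.
  move=> cx xb Lx Ux; rewrite /H (iffLR (fibE x cx) xb).
  by rewrite (iffLR (HA x cx (UA _ Ux)) Lx) row_mx0.
exists c, U, V, g, f; split; [by []|split; first by []]; split.
- by move=> x cx xb Lx Ux; exact: toV Ux (HE x cx xb Lx Ux).
- move=> y Vy gy; have [Uf Hf fR] := ofV y Vy gy.
  have [x cx Ex] := AC _ (UA _ Uf).
  have Ax : A (coord (cot c) x) by rewrite Ex; exact: UA.
  have Hx : H (coord (cot c) x) = 0 by rewrite Ex.
  have [hx x2] : h (coord (cot c) x) = 0 /\ lsubmx (coord (cot c) x) *m P2 = 0.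
    by move: Hx; rewrite -[0 in RHS]row_mx0 => /eq_row_mx[].
  have Lx := iffRL (HA x cx Ax) hx; have xb := iffRL (fibE x cx) x2.
  exists x.
  exact: (And5 (conj cx xb) Lx Ex Uf fR).
- move=> x cx xb Lx Ux w w' gw gw'.
  have Hx := HE x cx xb Lx Ux; have eqx := eqA x cx (UA _ Ux).
  have Kv v : 'd H (coord (cot c) x) v = 0 ->
      'd h (coord (cot c) x) v = 0 /\ lsubmx v *m P2 = 0.
    move=> E; have := etrans (esym (diff_eval v (DH _ (UA _ Ux)))) E.
    by rewrite -[0 in RHS]row_mx0 => /eq_row_mx[].
  have [v Hv ->] := iffLR (kerg _ Ux Hx w) gw.
  have [v' Hv' ->] := iffLR (kerg _ Ux Hx w') gw'.
  have [K1 K2] := Kv v Hv; have [K1' K2'] := Kv v' Hv'.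
  apply: (etrans (symp_block K2 K2')).
  exact: (kernel_isotropic Lx acd cx eqx K1 K1').
Qed.

Lemma slice_conormal c z : slice_chart (n - k) (pi @^-1` [set b]) c ->
  dom c (base z) -> pi (base z) = b -> cov_comp c z *m P1 = 0 -> conormal pi z.
Proof.
move=> sc cz zb z1 v; have [mc _] := sc.
pose x : fib := mksub (n - k)%N (zb : (pi @^-1` [set b]) (base z)).
rewrite -(limg_fiber_incl gM gB smooth_pi submersion_pi kn x) => /memv_imgP[u _ ->].
apply: (etrans (cov_compE gM _ mc cz)).
have E := fiber_incl_dcoord gM gB smooth_pi submersion_pi kn sc (x := x) u cz.
apply: (etrans (congr1 (dot _) E)).
by rewrite dot_mulmx tr_pid_mx z1 dotC linear0.
Qed.

(* The image given by [fiber_image] is not conic. Since [z] is not conormal, some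
   vertical component [r] of its covector is nonzero; the conic piece consists of
   the covectors whose multiple with [r] equal to the value [a0] at [z] lies in [U0]. *)
Lemma fiber_piece z : Lambda z -> pi (base z) = b ->
  exists U, [/\ U z, open_in U & fiber_pieces U].
Proof.
move=> Lz zb.
have [c [U0 [V [g [f [[sc cz oU0 U0z] [[oV sg surjg cf] [toV ofV iso]]]]]]]] :=
  fiber_image Lz zb.
have [mc _] := sc; have mC := cotangent_maximal gM mc.
pose cb := subspace_chart (n - k) (pi @^-1` [set b]) c : chart fib (n - k).
have mcb : maximal_atlas cb := fiber_chart_maximal gM gB smooth_pi submersion_pi kn sc.
pose FC := cotangent_chart cb : chart (cotangent fib) ((n - k) + (n - k)).
have mFC : maximal_atlas FC := cotangent_maximal gF mcb.
have [[injF oFC] _] := mFC.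
have coordF (x : fib) zeta : dom c (val x) ->
    coord FC (pullback_point x zeta) = coord (cot c) (mkcov (fiber_incl pi b x) zeta) *m Rho.
  move=> cx.
  have H := pullback_coord gM gB smooth_pi submersion_pi kn sc zeta cx; exact: H.
have [j a0N0] : exists j, (cov_comp c z *m P1) 0 j != 0.
  have [//|no] := pselect (exists j, (cov_comp c z *m P1) 0 j != 0).
  have z1 : cov_comp c z *m P1 = 0.
    apply/rowP => j; rewrite [RHS]mxE; apply/eqP/negP => /negP jN0.
    by apply: no; exists j.
  have : (Lambda `&` conormal pi) z by split; [|exact: slice_conormal sc cz zb z1].
  by rewrite disjoint_conormal.
set a0 := (cov_comp c z *m P1) 0 j in a0N0.
pose r (y : 'rV[R]_((n - k) + (n - k))) : R := rsubmx y 0 j.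
pose tau y := a0 / r y.
have cr : continuous r.
  have lr : linear (r : _ -> R^o) by move=> s u v; rewrite /r !mxE.
  pose L : {linear 'rV[R]_((n - k) + (n - k)) -> R^o} :=
    HB.pack (r : _ -> R^o) (GRing.isLinear.Build _ _ _ _ _ lr).
  exact: (linear_mx_continuous (L := L)).
(* Where [r] has the sign of [a0], the normalizing factor [tau] is positive, so that normalized
   points stay in the cone Lambda. *)
pose pos := [set y | 0 < a0 * r y].
have oPos : open pos.
  apply: (@open_comp _ _ (fun y => a0 * r y) [set t | 0 < t]); last exact: open_gt.
  by move=> y _; exact: (cvgM (cvg_cst a0) (cr y)).
have pos_r y : pos y -> r y != 0.
  by rewrite /pos /=; apply: contraTneq => ->; rewrite mulr0 ltxx.
have tau_gt0 y : pos y -> 0 < tau y.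
  move=> py; have rN0 := pos_r y py.
  have -> : tau y = a0 * r y / r y ^+ 2 by rewrite /tau expr2; field.
  by rewrite divr_gt0// exprn_even_gt0.
have ctau y : pos y -> tau @ y --> tau y.
  by move=> py; exact: (cvgM (cvg_cst a0) (cvgV (pos_r y py) (cr y))).
have r_dilate s y : r (dilate s y) = s * r y.
  by rewrite /r /dilate row_mxKr mxE.
(* Dilating by s > 0 divides [tau] by s, so the normalized point, and with it membership in [U1], is
   unchanged; this makes the piece conic. *)
pose U1 := [set y : 'rV[R]_(n + n) | pos (y *m Rho)] `&`
  (fun y => dilate (tau (y *m Rho)) y) @^-1` U0.
have oU1 : open U1.
  have oA : open [set y : 'rV[R]_(n + n) | pos (y *m Rho)].
    apply: (@open_comp _ _ (fun y : 'rV[R]_(n + n) => y *m Rho) pos _ oPos) => y _.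
    exact: continuous_mulmxr.
  apply: (open_preimage oA oU0) => y py.
  have ctr : {for y, continuous (tau \o (fun y : 'rV[R]_(n + n) => y *m Rho))}.
    apply: continuous_comp; [exact: continuous_mulmxr|exact: ctau].
  exact: (dilate_cvg ctr cvg_id).
pose U := [set x : cotangent M | dom c (base x) /\ U1 (coord (cot c) x)].
have r0 : r (coord (cot c) z *m Rho) = a0.
  by rewrite /r mul_rV_diag row_mxKr.
have tau0 : tau (coord (cot c) z *m Rho) = 1 by rewrite /tau r0 divff.
exists U; split.
- have pz : pos (coord (cot c) z *m Rho).
    by rewrite /pos /mkset r0 -expr2 exprn_even_gt0.
  have Uz : U0 (dilate (tau (coord (cot c) z *m Rho)) (coord (cot c) z)).
    by rewrite tau0 dilate1.
  exact: conj cz (conj pz Uz).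
- exact: chart_open_in gC mC oU1.
have scaled x s : pi (base x) = b -> Lambda x -> dom c (base x) -> 0 < s ->
    U0 (dilate s (coord (cot c) x)) ->
    [/\ V (dilate s (coord (cot c) x *m Rho)), g (dilate s (coord (cot c) x *m Rho)) = 0 &
      f (dilate s (coord (cot c) x *m Rho)) = dilate s (coord (cot c) x)].
  move=> xb Lx cx s0 Us; rewrite -dilate_block -coord_scale.
  apply: (toV (scale_covector s x)); [exact: cx|exact: xb|exact: Lambda_scale|].
  by rewrite coord_scale.
pose S := pullback (Lambda `&` U).
have fibP (x : fib) : pi (val x) = b := sub_mem x.
have equations (x0 : fib) zeta0 : (Lambda `&` U) (mkcov (fiber_incl pi b x0) zeta0) ->
    exists O (g0 : 'rV[R]_((n - k) + (n - k)) -> 'rV[R]_(n - k)),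
      local_equation FC S (pullback_point x0 zeta0) O g0 /\
      forall u v, 'd g0 (coord FC (pullback_point x0 zeta0)) u = 0 ->
        'd g0 (coord FC (pullback_point x0 zeta0)) v = 0 -> symp u v = 0.
  set w0 := pullback_point x0 zeta0; set l1 := mkcov (fiber_incl pi b x0) zeta0.
  move=> [Ll1 [cl1 [pl1 Ul1]]].
  set y0 := coord FC w0.
  have y0E : y0 = coord (cot c) l1 *m Rho by exact: coordF.
  pose t0 := tau y0.
  have py0 : pos y0 by rewrite y0E.
  have t00 : 0 < t0 by exact: tau_gt0.
  have t0N0 : t0 != 0 by rewrite gt_eqF.
  have ti0 : 0 < t0^-1 by rewrite invr_gt0.
  have U0l : U0 (dilate t0 (coord (cot c) l1)) by rewrite /t0 y0E.
  have [Vl gl fl] := scaled l1 t0 (fibP x0) Ll1 cl1 t00 U0l.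
  rewrite -y0E in Vl gl fl.
  (* The factor is frozen at its value at the given point, so that [g0] is [g] after an invertible
     linear map: its differential stays surjective and its kernel is the dilated kernel of that of
     [g]. *)
  pose g0 y := g (dilate t0 y).
  (* Freezing the factor costs two conditions on the scale. The one with tau y / t0 ensures that a
     zero of [g0], lifted by [f], normalizes into [U0]; the one with t0 / tau y ensures that a point
     of the piece, scaled by [t0] instead of its own factor, is still in [U0], where [g] is known to
     vanish. Both hold at [y0], hence nearby. *)
  pose Q y := [/\ pos y, V (dilate t0 y), U0 (dilate (tau y / t0) (f (dilate t0 y))),
    U0 (dilate (t0 / tau y) (f (dilate (tau y) y))) & (coord FC @` dom FC) y].
  have NQ : \forall y \near y0, Q y.
    have ct : tau @ y0 --> t0 by exact: ctau.
    have cd : dilate t0 @ y0 --> dilate t0 y0.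
      exact: (linear_mx_continuous (L := dilate t0)).
    have cdt : (fun y => dilate (tau y) y) @ y0 --> dilate t0 y0.
      exact: (dilate_cvg ct cvg_id).
    have c1 : (fun y => dilate (tau y / t0) (f (dilate t0 y))) @ y0 -->
        dilate t0 (coord (cot c) l1).
      have cf1 : {for y0, continuous (f \o dilate t0)}.
        by apply: continuous_comp; [exact: cd|exact: cf Vl].
      rewrite -[X in _ --> X]dilate1 -(divff t0N0) -fl.
      exact: (dilate_cvg (cvgM ct (cvg_cst t0^-1)) cf1).
    have c2 : (fun y => dilate (t0 / tau y) (f (dilate (tau y) y))) @ y0 -->
        dilate t0 (coord (cot c) l1).
      have cf2 : {for y0, continuous (f \o (fun y => dilate (tau y) y))}.
        by apply: continuous_comp; [exact: cdt|exact: cf Vl].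
      rewrite -[X in _ --> X]dilate1 -(divff t0N0) -fl.
      exact: (dilate_cvg (cvgM (cvg_cst t0) (cvgV t0N0 ct)) cf2).
    have n1 : \forall y \near y0, pos y by apply: open_nbhs_nbhs.
    have n2 : \forall y \near y0, V (dilate t0 y) by apply: cd; exact: open_nbhs_nbhs.
    have n3 : \forall y \near y0, U0 (dilate (tau y / t0) (f (dilate t0 y))).
      by apply: c1; exact: open_nbhs_nbhs.
    have n4 : \forall y \near y0, U0 (dilate (t0 / tau y) (f (dilate (tau y) y))).
      by apply: c2; exact: open_nbhs_nbhs.
    have n5 : \forall y \near y0, (coord FC @` dom FC) y.
      by apply: open_nbhs_nbhs; split; [exact: oFC|exists w0].
    by near=> y; split; near: y.
  have Dg0 : is_diff y0 g0 (fun u => 'd g (dilate t0 y0) (dilate t0 u)).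
    exact: (is_diff_comp (is_diff_linear (dilate t0) y0) (is_diff_smooth sg Vl)).
  exists (Q°)%classic, g0; split; last first.
    move=> u v gu0 gv0.
    have gu := etrans (esym (diff_eval u Dg0)) gu0.
    have gv := etrans (esym (diff_eval v Dg0)) gv0.
    (* Isotropy is known at the scaled point in [U0]; dilation by [t0] multiplies the form by [t0],
       which is nonzero. *)
    have := @iso (scale_covector t0 l1) cl1 (fibP x0) (Lambda_scale t00 Ll1).
    rewrite coord_scale dilate_block -y0E => /(_ U0l _ _ gu gv).
    by rewrite symp_dilate => /eqP; rewrite mulf_eq0 (negbTE t0N0) => /eqP.
  split; first split.
  - exact: open_interior.
  - exact: NQ.
  - by move=> y /interior_subset[].
  - apply: (@smooth_comp _ _ _ _ _ V g (dilate t0)) sg _.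
    + exact: open_interior.
    + by move=> y /interior_subset[].
    + exact: (@smooth_linear _ _ _ _ _ (dilate t0)).
  - move=> w; have [v Ev] := surjg _ Vl w; exists (dilate t0^-1 v).
    apply: (etrans (diff_eval _ Dg0)); rewrite dilateM (divff t0N0) dilate1; exact: Ev.
  move=> w cw /interior_subset[py Vt0 Q3 Q4 _].
  set y := coord FC w in py Vt0 Q3 Q4 *; have ty0 := tau_gt0 _ py.
  have tyN0 : tau y != 0 by rewrite gt_eqF.
  split=> [/pullbackP[x [zeta [[Lx [cx [px Ux]]] wE]]]|gy].
    have yE : y = coord (cot c) (mkcov (fiber_incl pi b x) zeta) *m Rho.
      by rewrite /y wE; exact: coordF.
    have Ut : U0 (dilate (tau y) (coord (cot c) (mkcov (fiber_incl pi b x) zeta))).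
      by rewrite yE.
    have [_ _ fy] := scaled (mkcov (fiber_incl pi b x) zeta) _ (fibP x) Lx cx ty0 Ut.
    rewrite -yE in fy; rewrite fy dilateM (divfK tyN0) in Q4.
    have [_ gy _] := scaled (mkcov (fiber_incl pi b x) zeta) _ (fibP x) Lx cx t00 Q4.
    rewrite -yE in gy; exact: gy.
  have [l2 [[cl2 l2b] Ll2 El2 _ fR]] := ofV _ Vt0 gy.
  have Ll := Lambda_scale ti0 Ll2.
  pose x : fib := mksub (n - k)%N (l2b : (pi @^-1` [set b]) (base l2)).
  pose zeta := (scale_covector t0^-1 l2 : cotangent_point M).2.
  have El : coord (cot c) (mkcov (fiber_incl pi b x) zeta) = dilate t0^-1 (f (dilate t0 y)).
    by rewrite -El2; exact: coord_scale.
  have ElR : coord (cot c) (mkcov (fiber_incl pi b x) zeta) *m Rho = y.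
    by rewrite El dilate_block fR dilateM (mulVf t0N0) dilate1.
  have Ul : U (mkcov (fiber_incl pi b x) zeta).
    have pl : pos (coord (cot c) (mkcov (fiber_incl pi b x) zeta) *m Rho) by rewrite ElR.
    have Utl : U0 (dilate (tau (coord (cot c) (mkcov (fiber_incl pi b x) zeta) *m Rho))
        (coord (cot c) (mkcov (fiber_incl pi b x) zeta))).
      by rewrite ElR El dilateM.
    exact: conj cl2 (conj pl Utl).
  apply/pullbackP; exists x, zeta; split; first by split.
  apply: injF; [exact: cw|exact: cl2|].
  by rewrite (coordF x zeta cl2) ElR.
have dimE : ((n - k) + (n - k) = (n - k) + (n - k))%N by [].
split.
  move=> t x xi t0 /pullbackP[x' [zeta [[Lx [cx [px Ux]]] [-> ->]]]].
  apply/pullbackP; exists x', (t *: zeta); split.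
    split; first exact: (Lambda_scale (z := mkcov (fiber_incl pi b x') zeta) t0 Lx).
    have E : coord (cot c) (mkcov (fiber_incl pi b x') (t *: zeta)) =
        dilate t (coord (cot c) (mkcov (fiber_incl pi b x') zeta)).
      exact: (coord_scale c t (mkcov (fiber_incl pi b x' : M) zeta)).
    split; first exact: cx.
    rewrite E; split.
      by rewrite /mkset dilate_block /pos /mkset r_dilate mulrCA mulr_gt0.
    rewrite /preimage /mkset dilate_block /tau r_dilate dilateM invfM.
    by rewrite mulrCA mulrAC mulVf ?gt_eqF// mul1r.
  by rewrite /pullback_point comp_lfunZl.
split.
  apply: (submanifold_of_equation gCF dimE) => w /pullbackP[x [zeta [H ->]]].
  have [A [g0 [eq0 _]]] := equations x zeta H.
  exists FC, A, g0; split; [exact: mFC| |exact: eq0].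
  by case: H => _ [].
move=> w Sw u v Tu Tv; rewrite symplectic_formE.
have /pullbackP[x [zeta [H wE]]] := Sw.
have [A [g0 [eq0 iso0]]] := equations x zeta H.
rewrite -wE in eq0 iso0.
have cw : dom FC w by rewrite wE; case: H => _ [].
have du := iffLR (tangent_of_equation u gCF dimE mFC cw Sw eq0) Tu.
have dv := iffLR (tangent_of_equation v gCF dimE mFC cw Sw eq0) Tv.
exact: etrans (esym (symp_cotangent_chart gF u v mcb cw)) (iso0 _ _ du dv).
Unshelve. all: by end_near. Qed.

(** Vertical vectors are in the image of d i_b, so on them the inverse of d i_b cancels against the
    d i_b of the pullback. *)
Lemma fiber_to_vdual_pullback (x : fib) zeta :
  fiber_to_vdual pi b (pullback_point x zeta) =
    vdual_restrict pi (mkcov (fiber_incl pi b x) zeta).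
Proof.
rewrite /fiber_to_vdual /vdual_restrict /=; congr (vdual_of _).
apply/lfunP => u; rewrite !comp_lfunE; congr (zeta _).
apply: limg_lfunVK; rewrite (limg_fiber_incl gM gB smooth_pi submersion_pi kn x).
by rewrite lfunE; exact: subvsP.
Qed.

Lemma fiber_to_vdual_image :
  fiber_to_vdual pi b @` pullback Lambda =
    vdual_restrict pi @` Lambda `&` vdual_proj pi @^-1` [set b].
Proof.
apply/seteqP; split=> [_ [w /pullbackP[x [zeta [Lx ->]]] <-]|_ [[z Lz <-] zb]].
  rewrite fiber_to_vdual_pullback; split; first by exists (mkcov (fiber_incl pi b x) zeta).
  exact: (sub_mem x).
case: z Lz zb => m zeta Lz zb.
pose x : fib := mksub (n - k)%N (zb : (pi @^-1` [set b]) m).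
exists (pullback_point x zeta); last exact: (fiber_to_vdual_pullback x zeta).
by apply/pullbackP; exists x, zeta.
Qed.

(** A covector with zero pullback vanishes on the image of d i_b, which is ker dpi, so it is
    conormal. *)
Lemma pullback_nonzero : pullback Lambda `<=` nonzero_covectors fib.
Proof.
move=> w /pullbackP[x [zeta [Lx ->]]]; apply/negP => /eqP E.
suff : (Lambda `&` conormal pi) (mkcov (fiber_incl pi b x) zeta) by rewrite disjoint_conormal.
split=> // v; rewrite -(limg_fiber_incl gM gB smooth_pi submersion_pi kn x).
move=> /memv_imgP[u _ ->]; apply: etrans (esym (comp_lfunE _ _ _)) _.
by rewrite [X in fun_of_lfun X]E lfunE.
Qed.

(** The countable subcover is taken in T^*M, before pulling back, so countably many charts of [M]
    are enough and none of the fiber have to be enumerated. *)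
Lemma pullback_local_submanifold : conic_lagrangian_local_submanifold (pullback Lambda).
Proof.
pose S := [set z : cotangent M | Lambda z /\ pi (base z) = b].
have pull0 : pullback (Lambda `&` set0) = set0.
  by rewrite setI0; apply/seteqP; split=> // w /pullbackP[x [zeta []]].
have P0 : fiber_pieces set0.
  rewrite /fiber_pieces pull0; split; first by move=> t x xi t0 [].
  by split; [exact: submanifold_set0 (leq_addr _ _)|move=> z []].
have HS z : S z -> exists U, [/\ U z, open_in U & fiber_pieces U].
  by case=> Lz zb; exact: fiber_piece.
have [T [PT ST]] := lindelof (cotangent_countable_charts gM countable_M) P0 HS.
exists (fun i => pullback (Lambda `&` T i)); split.
  by move=> i; have [cP lP] := PT i; split; [case: lP|].
apply/seteqP; split=> [w /pullbackP[x [zeta [Lx wE]]]|w [i _ /pullbackP[x [zeta [[Lx Tx] wE]]]]].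
  have [i _ Ti] := ST (mkcov (fiber_incl pi b x) zeta) (conj Lx (sub_mem x)).
  by exists i => //; apply/pullbackP; exists x, zeta.
by apply/pullbackP; exists x, zeta.
Qed.

End FiberPieces.

Lemma vdual_local_submanifold :
  transverse_local_submanifold (vdual_proj pi) (vdual_restrict pi @` Lambda).
Proof.
have P0 : vdual_pieces set0.
  rewrite /vdual_pieces setI0 image_set0; split; last by move=> z [].
  exact: submanifold_set0 (leq_addr _ _).
have [T [PT LT]] := lindelof (cotangent_countable_charts gM countable_M) P0 vdual_piece.
exists n, (fun i => vdual_restrict pi @` (Lambda `&` T i)); split; first exact: PT.
rewrite -image_bigcup -setI_bigcupr; congr (_ @` _).
by apply/seteqP; split=> [z Lz|z []//]; split=> //; exact: LT.
Qed.

Lemma vdual_smooth_family :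
  smooth_family (vdual_proj pi) (fun b => fiber_to_vdual pi b @` pullback (b := b) Lambda).
Proof.
split=> [b|]; first by rewrite fiber_to_vdual_image => w [].
have -> : \bigcup_b (fiber_to_vdual pi b @` pullback (b := b) Lambda) =
    vdual_restrict pi @` Lambda.
  apply/seteqP; split=> [w [b _]|w Lw]; first by rewrite fiber_to_vdual_image => -[].
  by exists (vdual_proj pi w) => //; rewrite fiber_to_vdual_image.
exact: vdual_local_submanifold.
Qed.

End Family.
End LagrangianFamilies.

Theorem theorem3 (R : realType) (n k : nat) (M : manifold R n)
    (B : manifold R k) (pi : M -> B)
    (pi_submersion : surjective_submersion pi)
    (Lambda : set (cotangent M))
    (Lambda_nonzero : Lambda `<=` nonzero_covectors M)
    (Lambda_conic : conic Lambda)
    (Lambda_lagrangian : lagrangian Lambda)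
    (Lambda_transverse : transverse (cotangent_proj pi) n Lambda) :
  Lambda `&` conormal pi = set0 /\
  let i_pullback (b : B) : set (cotangent (fiber pi b)) :=
    cotangent_pullback (fiber_incl pi b) Lambda in
  [/\ smooth_family (vdual_proj pi)
        (fun b => fiber_to_vdual pi b @` i_pullback b),
      transverse_local_submanifold (vdual_proj pi) (vdual_restrict pi @` Lambda),
      forall b, fiber_to_vdual pi b @` i_pullback b =
        vdual_restrict pi @` Lambda `&` vdual_proj pi @^-1` [set b] &
      forall b, conic_lagrangian_local_submanifold (i_pullback b) /\
        i_pullback b `<=` nonzero_covectors (fiber pi b)].
Proof.
have gM := manifold_good M; have gB := manifold_good B.
have [[smap rank_pi] surj_pi] := pi_submersion.
have smooth_pi x : smooth_near pi x by exact: smooth_map_near.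
have cM := manifold_countable_charts M.
(* The rank of the differential at a point gives the inequality of dimensions, so a point of [M] is
   required; the empty case is separated below. *)
have kn (x : M) : (k <= n)%N.
  have := limg_ker_dim (mdiff pi x) fullv.
  rewrite rank_pi !dimvf /dim /= !mul1n => <-.
  exact: leq_addl.
have [[x _]|noM] := pselect (exists x : M, True).
  split; first exact: (disjoint_conormal gM gB smooth_pi rank_pi (kn x)).
  split.
  - exact: (vdual_smooth_family gM gB smooth_pi rank_pi (kn x) cM).
  - exact: (vdual_local_submanifold gM gB smooth_pi rank_pi (kn x) cM).
  - by move=> b; exact: (fiber_to_vdual_image gM gB smooth_pi rank_pi (kn x)).
  - move=> b; split; last exact: (pullback_nonzero gM gB smooth_pi rank_pi (kn x)).
    exact: (pullback_local_submanifold gM gB smooth_pi rank_pi (kn x) cM).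
have noB (b : B) : False by have [x _] := surj_pi b; apply: noM; exists x.
have noL (z : cotangent M) : ~ Lambda z.
  by move=> _; apply: noM; exists (z : cotangent_point M).1.
have empty_family (Z : set (vdual pi)) : (forall w, ~ Z w) ->
    transverse_local_submanifold (vdual_proj pi) Z.
  move=> Z0; have -> : Z = set0 by apply/seteqP; split=> // w /Z0.
  (* Without a point nothing compares k with n, so n - k may be truncated; dimension 0 is admissible
     in every ambient dimension. *)
  exists 0%N, (fun=> set0); split; last by rewrite bigcup0.
  by move=> i; split; [exact: submanifold_set0|move=> z []].
split; first by apply/seteqP; split=> // z [/noL].
split=> [||b|b]; try by have := noB b.
  split=> [b|]; first by have := noB b.
  by apply: empty_family => w [b]; have := noB b.
by apply: empty_family => w [z /noL].
Qed.
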